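(* Let $\Omega$ be an angular domain with $\Omega_I=\{re^{I(\zeta_I+\vartheta)}: r>0,\ |\vartheta|<\varphi_I/2\}$ for all $I\in\mathbb{S}$. Let $\rho>0$ and let $f$ be a slice regular function on $\Omega$, continuous on $\overline\Omega$, of order $\rho$ and type $\sigma$. If the opening of $\Omega$ is at most $\pi/\rho$ and $|f|\le M$ on $\partial\Omega$, then for every $I\in\mathbb{S}$, $$|f(re^{I(\zeta_I+\vartheta)})|\le M e^{\sigma r^\rho\cos(\rho\vartheta)}$$ for all $r>0$ and $|\vartheta|<\varphi_I/2$.
   Context: $\mathbb{H}$ denotes the quaternions with Euclidean norm $|q|$; $\mathbb{S}=\{ix_1+jx_2+kx_3: x_1^2+x_2^2+x_3^2=1\}$; for $I\in\mathbb{S}$, $L_I=\mathbb{R}+\mathbb{R}I$, $e^{I\vartheta}=\cos\vartheta+I\sin\vartheta$, and $\Omega_I=\Omega\cap L_I$. A function $f:\Omega\to\mathbb{H}$ on an open set $\Omega$ is slice regular if for every $I\in\mathbb{S}$ its restriction $f_I$ to $\Omega_I$ satisfies $\frac12\left(\frac{\partial}{\partial x}+I\frac{\partial}{\partial y}\right)f_I(x+yI)=0$. A domain $\Omega$ is a slice domain if $\Omega\cap\mathbb{R}\ne\emptyset$ and each $\Omega_I$ is a domain in $L_I$. A slice domain $\Omega$ is an angular domain if for every $I\in\mathbb{S}$, $\Omega_I=\{re^{I(\zeta_I+\vartheta)}: r>0,\ |\vartheta|<\varphi_I/2\}$ for some $\zeta_I\in\mathbb{R}$, $0<\varphi_I<2\pi$;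 its opening is $\sup_{I\in\mathbb{S}}\varphi_I$. For $f$ slice regular on $\Omega$ and continuous up to the boundary, $M_f(r,\Omega)=\max\{|f(q)|: q\in\overline\Omega,\ |q|=r\}$; the order of $f$ is $\rho=\limsup_{r\to+\infty}\frac{\ln^+\ln^+M_f(r,\Omega)}{\ln r}$ and its type is $\sigma=\limsup_{r\to+\infty}\frac{\ln^+M_f(r,\Omega)}{r^\rho}$, where $\ln^+x=\max\{\ln x,0\}$. *)

(* Defs.v *)
From Stdlib Require Import Reals.
Open Scope R_scope.

Record quat : Type := mkQ { qa : R; qb : R; qc : R; qd : R }.

Definition qadd (p q : quat) : quat :=
  mkQ (qa p + qa q) (qb p + qb q) (qc p + qc q) (qd p + qd q).
Definition qopp (p : quat) : quat := mkQ (- qa p) (- qb p) (- qc p) (- qd p).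
Definition qsub (p q : quat) : quat := qadd p (qopp q).
Definition qmul (p q : quat) : quat :=
  mkQ (qa p * qa q - qb p * qb q - qc p * qc q - qd p * qd q)
      (qa p * qb q + qb p * qa q + qc p * qd q - qd p * qc q)
      (qa p * qc q - qb p * qd q + qc p * qa q + qd p * qb q)
      (qa p * qd q + qb p * qc q - qc p * qb q + qd p * qa q).
Definition qreal (x : R) : quat := mkQ x 0 0 0.
Definition qzero : quat := qreal 0.
Definition qscale (r : R) (q : quat) : quat := mkQ (r * qa q) (r * qb q) (r * qc q) (r * qd q).

Definition qnorm (q : quat) : R :=
  sqrt (qa q ^ 2 + qb q ^ 2 + qc q ^ 2 + qd q ^ 2).

Definition in_S (I : quat) : Prop :=
  qa I = 0 /\ qb I ^ 2 + qc I ^ 2 + qd I ^ 2 = 1.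

Definition slice_pt (I : quat) (x y : R) : quat := qadd (qreal x) (qscale y I).

Definition qexpI (I : quat) (t : R) : quat := slice_pt I (cos t) (sin t).

Definition in_L (I q : quat) : Prop := exists x y : R, q = slice_pt I x y.

Definition qset := quat -> Prop.

Definition q_open (O : qset) : Prop :=
  forall q, O q -> exists eps, 0 < eps /\ forall p, qnorm (qsub p q) < eps -> O p.

Definition q_connected (O : qset) : Prop :=
  forall U V : qset, q_open U -> q_open V ->
    (forall q, O q -> U q \/ V q) ->
    (forall q, ~ (O q /\ U q /\ V q)) ->
    (exists q, O q /\ U q) -> (exists q, O q /\ V q) -> False.

Definition q_domain (O : qset) : Prop := q_open O /\ q_connected O /\ exists q, O q.

Definition q_closure (O : qset) (q : quat) : Prop :=
  forall eps, 0 < eps -> exists p, O p /\ qnorm (qsub p q) < eps.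

Definition q_boundary (O : qset) (q : quat) : Prop := q_closure O q /\ ~ O q.

Definition qderiv (h : R -> quat) (t : R) (d : quat) : Prop :=
  derivable_pt_lim (fun s => qa (h s)) t (qa d) /\
  derivable_pt_lim (fun s => qb (h s)) t (qb d) /\
  derivable_pt_lim (fun s => qc (h s)) t (qc d) /\
  derivable_pt_lim (fun s => qd (h s)) t (qd d).

Definition slice_regular (Omega : qset) (f : quat -> quat) : Prop :=
  q_open Omega /\
  forall I, in_S I -> forall x y, Omega (slice_pt I x y) ->
    exists Dx Dy : quat,
      qderiv (fun s => f (slice_pt I s y)) x Dx /\
      qderiv (fun s => f (slice_pt I x s)) y Dy /\
      qscale (1/2) (qadd Dx (qmul I Dy)) = qzero.

(** Omega_I as a subset of the plane R^2 ~ L_I (via x + yI). *)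
Definition plane_open (O : R -> R -> Prop) : Prop :=
  forall x y, O x y -> exists eps, 0 < eps /\
    forall u v, (u - x) ^ 2 + (v - y) ^ 2 < eps ^ 2 -> O u v.

Definition plane_connected (O : R -> R -> Prop) : Prop :=
  forall U V : R -> R -> Prop, plane_open U -> plane_open V ->
    (forall x y, O x y -> U x y \/ V x y) ->
    (forall x y, ~ (O x y /\ U x y /\ V x y)) ->
    (exists x y, O x y /\ U x y) -> (exists x y, O x y /\ V x y) -> False.

Definition plane_domain (O : R -> R -> Prop) : Prop :=
  plane_open O /\ plane_connected O /\ exists x y, O x y.

Definition is_slice_domain (Omega : qset) : Prop :=
  q_domain Omega /\ (exists x : R, Omega (qreal x)) /\
  forall I, in_S I -> plane_domain (fun x y => Omega (slice_pt I x y)).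

Definition angular_domain (Omega : qset) (zeta phi : quat -> R) : Prop :=
  is_slice_domain Omega /\
  forall I, in_S I ->
    0 < phi I < 2 * PI /\
    forall q, (Omega q /\ in_L I q) <->
      exists r t, 0 < r /\ Rabs t < phi I / 2 /\ q = qscale r (qexpI I (zeta I + t)).

(** opening of Omega: sup_I phi_I *)
Definition opening_le (phi : quat -> R) (c : R) : Prop :=
  forall I, in_S I -> phi I <= c.

Definition cont_on_closure (Omega : qset) (f : quat -> quat) : Prop :=
  forall q, q_closure Omega q -> forall eps, 0 < eps -> exists delta, 0 < delta /\
    forall p, q_closure Omega p -> qnorm (qsub p q) < delta ->
      qnorm (qsub (f p) (f q)) < eps.

Definition is_max_modulus (Omega : qset) (f : quat -> quat) (r m : R) : Prop :=
  (exists q, q_closure Omega q /\ qnorm q = r /\ qnorm (f q) = m) /\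
  (forall q, q_closure Omega q -> qnorm q = r -> qnorm (f q) <= m).

Definition lnp (x : R) : R := Rmax (ln x) 0.

Definition is_limsup_infty (g : R -> R) (L : R) : Prop :=
  forall eps, 0 < eps ->
    (exists R0, forall r, R0 < r -> g r < L + eps) /\
    (forall R0, exists r, R0 < r /\ L - eps < g r).

(** f has order rho and type sigma, where Mf r = M_f(r, Omega) *)
Definition has_order (Mf : R -> R) (rho : R) : Prop :=
  is_limsup_infty (fun r => lnp (lnp (Mf r)) / ln r) rho.

Definition has_type (Mf : R -> R) (rho sigma : R) : Prop :=
  is_limsup_infty (fun r => lnp (Mf r) / Rpower r rho) sigma.

(* Main.v *)
Require Import Defs.
From Stdlib Require Import Reals.
From Stdlib Require Import Lra Lia Classical ClassicalEpsilon.
From Coquelicot Require Import Coquelicot.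
Open Scope R_scope.

(** On the slice [L_I], fix a unit quaternion [c]. Then [u = <f, c>] and [v = <f, I c>] satisfy the
    Cauchy-Riemann equations and [u^2 + v^2 <= |f|^2], with equality at a given point for a suitable
    [c]; so it suffices to bound [u + i v] by a Phragmen-Lindelof argument in a sector.
    After multiplication by [exp (- (sigma + eps) z^rho)] the function is bounded on the bisector,
    hence on each half sector (comparison with [exp (- eta z^(3 rho / 2))]), hence by [M] on the whole
    sector (comparison with [exp (- eta z^(rho / 2))]); then [eps] tends to 0.

    Slice regularity only provides partial derivatives at each point, so the maximum principle needs
    the Looman-Menchoff theorem. In the form used here: if [P], [Q] are continuous, have partial
    derivatives everywhere and [P_x + Q_y = 0], then the flux of [(P, Q)] out of every rectangle
    vanishes. If [E] is the closed set of points having no neighbourhood in which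
    [|flux R| <= e * area R], Baire's theorem gives a portion of [E] on which the difference quotients
    are uniformly close to the derivatives at one point of [E]. After subtraction of a linear field of
    zero divergence, [(P, Q)] is Lipschitz with a small constant on the horizontal and vertical lines
    through points of [E]. The smallest rectangle containing [E] in a small cell has a point of [E] on
    each of its sides, so its flux is small compared with the area of the cell, while the rest of the
    cell misses [E]. Summation over finer and finer dyadic cells shows that the portion is empty.
    Box averages applied twice then yield harmonic approximations of [u] and [v]. *)

(** * Compactness of rectangles *)

(** The opening may equal [PI / rho], and this forces two passes. A comparison function with
    exponent [l] decays on a sector only if [l] times the opening is less than [PI]. On the whole
    sector this means [l < rho], too weak against growth of order [rho], so boundedness must be
    known before. Half sectors admit every [l < 2 * rho]; [3 * rho / 2] and [rho / 2] are merely
    convenient choices on either side of [rho].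

    All estimates concern squared moduli, whence [M ^ 2] and the factors 2 in the exponents. The
    maximum principle is a second derivative test for [U^2 + V^2]. It needs two derivatives, and
    this is why the averaging is done twice: vanishing flux gives the Cauchy-Riemann equations for
    the first average, and these become the Laplace equation for the second.

    With [s = ln r] as coordinate a sector is a strip and the powers of [z] become
    [exp (k s) cos (k t)]. The vertex moves to [s = -oo], where continuity of [f] at 0 replaces a
    boundary estimate. *)

Lemma nested_intervals (a b : nat -> R) :
  (forall n, a n <= a (S n)) -> (forall n, b (S n) <= b n) ->
  (forall n, a n <= b n) -> exists x, forall n, a n <= x <= b n.
Proof.
  intros Ha Hb Hab.
  assert (Ma : forall n k, a n <= a (n + k)%nat).
  { intros n k; induction k as [|k IH]; [rewrite Nat.add_0_r; lra|].
    rewrite Nat.add_succ_r; specialize (Ha (n + k)%nat); lra. }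
  assert (Mb : forall n k, b (n + k)%nat <= b n).
  { intros n k; induction k as [|k IH]; [rewrite Nat.add_0_r; lra|].
    rewrite Nat.add_succ_r; specialize (Hb (n + k)%nat); lra. }
  assert (Hnm : forall n m, a n <= b m).
  { intros n m.
    generalize (Ma n m) (Hab (n + m)%nat) (Mb m n).
    rewrite (Nat.add_comm m n); lra. }
  destruct (completeness (fun x => exists n, x = a n)) as [x [Hx1 Hx2]].
  - exists (b 0%nat); intros y [n ->]; apply Hnm.
  - exists (a 0%nat); exists 0%nat; reflexivity.
  - exists x; intros n; split.
    + apply Hx1; exists n; reflexivity.
    + apply Hx2; intros y [m ->]; apply Hnm.
Qed.

Definition near (r x y u v : R) : Prop := Rabs (u - x) < r /\ Rabs (v - y) < r.

Definition in_rect (a b c d x y : R) : Prop := a <= x <= b /\ c <= y <= d.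

Lemma pow_half_small (L r : R) : 0 < r -> exists n : nat, L * (/ 2) ^ n < r.
Proof.
  intros Hr.
  destruct (pow_lt_1_zero (/ 2)) with (y := r / (Rabs L + 1)) as [n Hn].
  - rewrite Rabs_right; lra.
  - apply Rdiv_lt_0_compat; [lra|]. generalize (Rabs_pos L); lra.
  - exists n. specialize (Hn n (Nat.le_refl n)).
    rewrite Rabs_right in Hn by (apply Rle_ge, pow_le; lra).
    assert (HL := Rabs_pos L).
    apply (Rmult_lt_compat_l (Rabs L + 1)) in Hn; [|lra].
    replace ((Rabs L + 1) * (r / (Rabs L + 1))) with r in Hn by (field; lra).
    assert (0 <= (/ 2) ^ n) by (apply pow_le; lra).
    generalize (Rle_abs L); nra.
Qed.

(** If [T] failed, it would fail on a quarter, on a quarter of that, and so on; these quarters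
    shrink to a point near which the local hypothesis gives [T]. This is the form in which
    compactness of rectangles is used below. *)
Lemma cousin_rect (T : R -> R -> R -> R -> Prop) (a0 b0 c0 d0 : R) :
  a0 <= b0 -> c0 <= d0 ->
  (forall a b c d, a <= b -> c <= d ->
     T a ((a + b) / 2) c ((c + d) / 2) -> T ((a + b) / 2) b c ((c + d) / 2) ->
     T a ((a + b) / 2) ((c + d) / 2) d -> T ((a + b) / 2) b ((c + d) / 2) d ->
     T a b c d) ->
  (forall x y, in_rect a0 b0 c0 d0 x y -> exists r, 0 < r /\
     forall a b c d, a0 <= a -> b <= b0 -> c0 <= c -> d <= d0 ->
       in_rect a b c d x y -> b - a < r -> d - c < r -> T a b c d) ->
  T a0 b0 c0 d0.
Proof.
  intros Hab Hcd Hsplit Hloc.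
  apply NNPP; intros HT.
  set (dec := fun P : Prop => excluded_middle_informative P).
  (* The last quarter is the default: when the other three satisfy [T], it is the one that fails, by
     [Hsplit]. *)
  set (step := fun q : R * R * R * R =>
    let '(a, b, c, d) := q in
    let m := (a + b) / 2 in let k := (c + d) / 2 in
    if dec (T a m c k) then
      if dec (T m b c k) then
        if dec (T a m k d) then (m, b, k, d) else (a, m, k, d)
      else (m, b, c, k)
    else (a, m, c, k)).
  set (q := fun n => Nat.iter n step (a0, b0, c0, d0)).
  set (A := fun n => fst (fst (fst (q n)))).
  set (B := fun n => snd (fst (fst (q n)))).
  set (C := fun n => snd (fst (q n))).
  set (D := fun n => snd (q n)).
  assert (Inv : forall n, (~ T (A n) (B n) (C n) (D n)) /\
    B n - A n = (b0 - a0) * (/ 2) ^ n /\ D n - C n = (d0 - c0) * (/ 2) ^ n /\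
    A n <= A (S n) /\ B (S n) <= B n /\ C n <= C (S n) /\ D (S n) <= D n).
  { assert (Step : forall n,
      ~ T (A n) (B n) (C n) (D n) -> A n <= B n -> C n <= D n ->
      (~ T (A (S n)) (B (S n)) (C (S n)) (D (S n))) /\
      B (S n) - A (S n) = (B n - A n) / 2 /\ D (S n) - C (S n) = (D n - C n) / 2 /\
      A n <= A (S n) /\ B (S n) <= B n /\ C n <= C (S n) /\ D (S n) <= D n).
    { intros n. unfold A, B, C, D, q. rewrite Nat.iter_succ.
      destruct (Nat.iter n step (a0, b0, c0, d0)) as [[[a b] c] d]. cbn [fst snd].
      intros H1 H2 H3. unfold step.
      destruct (dec (T a ((a + b) / 2) c ((c + d) / 2))); cbn [fst snd];
      [|repeat split; try assumption; lra].
      destruct (dec (T ((a + b) / 2) b c ((c + d) / 2))); cbn [fst snd];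
      [|repeat split; try assumption; lra].
      destruct (dec (T a ((a + b) / 2) ((c + d) / 2) d)); cbn [fst snd];
      [|repeat split; try assumption; lra].
      repeat split; try lra.
      intros H4; apply H1; apply Hsplit; assumption. }
    assert (Base : forall n, (~ T (A n) (B n) (C n) (D n)) /\
      B n - A n = (b0 - a0) * (/ 2) ^ n /\ D n - C n = (d0 - c0) * (/ 2) ^ n).
    { intros n; induction n as [|n [I1 [I2 I3]]].
      - cbn; repeat split; try assumption; ring.
      - assert (0 <= (/ 2) ^ n) by (apply pow_le; lra).
        destruct (Step n I1) as [S1 [S2 [S3 _]]]; [nra|nra|].
        repeat split; [assumption| |].
        + rewrite S2, I2; cbn; field.
        + rewrite S3, I3; cbn; field. }
    intros n. destruct (Base n) as [I1 [I2 I3]].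
    assert (0 <= (/ 2) ^ n) by (apply pow_le; lra).
    destruct (Step n I1) as [_ [_ [_ S]]]; [nra|nra|].
    repeat split; try assumption; apply S. }
  assert (Pow : forall n, 0 <= (/ 2) ^ n) by (intros n; apply pow_le; lra).
  destruct (nested_intervals A B) as [x Hx]; try (intros n; apply (Inv n)).
  { intros n; destruct (Inv n) as [_ [H _]]; specialize (Pow n); nra. }
  destruct (nested_intervals C D) as [y Hy]; try (intros n; apply (Inv n)).
  { intros n; destruct (Inv n) as [_ [_ [H _]]]; specialize (Pow n); nra. }
  destruct (Hloc x y) as [r [Hr HTr]].
  { split; [apply (Hx 0%nat)|apply (Hy 0%nat)]. }
  destruct (pow_half_small (Rmax (b0 - a0) (d0 - c0)) r Hr) as [n Hn].
  destruct (Inv n) as [I1 [I2 [I3 _]]].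
  assert (Mono : a0 <= A n /\ B n <= b0 /\ c0 <= C n /\ D n <= d0).
  { clear - Inv. induction n as [|n IH]; [cbn; lra|].
    destruct (Inv n) as [_ [_ [_ H]]]; lra. }
  apply I1, HTr; try apply Mono.
  - split; [apply Hx|apply Hy].
  - generalize (Rmax_l (b0 - a0) (d0 - c0)) (Pow n); nra.
  - generalize (Rmax_r (b0 - a0) (d0 - c0)) (Pow n); nra.
Qed.

(** Only closedness of [K] in the rectangle and upper semicontinuity of [p] on [K] enter.
    [cousin_rect] serves twice: for an upper bound, then for a uniform gap below the supremum if it
    is not attained. *)
Lemma rect_max (K : R -> R -> Prop) (p : R -> R -> R) (a b c d : R) :
  (exists x y, K x y) ->
  (forall x y, K x y -> in_rect a b c d x y) ->
  (forall x y, in_rect a b c d x y -> ~ K x y ->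
     exists r, 0 < r /\ forall u v, near r x y u v -> ~ K u v) ->
  (forall x y, K x y -> forall e, 0 < e ->
     exists r, 0 < r /\ forall u v, K u v -> near r x y u v -> p u v < p x y + e) ->
  exists x y, K x y /\ forall u v, K u v -> p u v <= p x y.
Proof.
  intros [xK [yK HK]] Hin Hcl Hp.
  assert (Hab : a <= b) by (destruct (Hin _ _ HK); lra).
  assert (Hcd : c <= d) by (destruct (Hin _ _ HK); lra).
  assert (Hnear : forall r x y a' b' c' d' u v, in_rect a' b' c' d' x y ->
    b' - a' < r -> d' - c' < r -> in_rect a' b' c' d' u v -> near r x y u v).
  { intros r x y a' b' c' d' u v [] ? ? []; split; apply Rabs_def1; lra. }
  assert (Hquad : forall a' b' c' d' x y, in_rect a' b' c' d' x y ->
    in_rect a' ((a' + b') / 2) c' ((c' + d') / 2) x y \/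
    in_rect ((a' + b') / 2) b' c' ((c' + d') / 2) x y \/
    in_rect a' ((a' + b') / 2) ((c' + d') / 2) d' x y \/
    in_rect ((a' + b') / 2) b' ((c' + d') / 2) d' x y).
  { intros a' b' c' d' x y [? ?]. unfold in_rect.
    destruct (Rle_dec x ((a' + b') / 2)); destruct (Rle_dec y ((c' + d') / 2));
      [left|right; right; left|right; left|right; right; right]; lra. }
  assert (Hbd : exists M, forall u v, in_rect a b c d u v -> K u v -> p u v <= M).
  { apply (cousin_rect (fun a b c d =>
      exists M, forall u v, in_rect a b c d u v -> K u v -> p u v <= M)); try assumption.
    - intros a' b' c' d' _ _ [M1 H1] [M2 H2] [M3 H3] [M4 H4].
      exists (Rmax (Rmax M1 M2) (Rmax M3 M4)); intros u v Huv HKuv.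
      generalize (Rmax_l (Rmax M1 M2) (Rmax M3 M4)) (Rmax_r (Rmax M1 M2) (Rmax M3 M4))
        (Rmax_l M1 M2) (Rmax_r M1 M2) (Rmax_l M3 M4) (Rmax_r M3 M4); intros.
      destruct (Hquad _ _ _ _ _ _ Huv) as [Q|[Q|[Q|Q]]];
        [specialize (H1 u v Q HKuv)|specialize (H2 u v Q HKuv)
        |specialize (H3 u v Q HKuv)|specialize (H4 u v Q HKuv)]; lra.
    - intros x y Hxy. destruct (classic (K x y)) as [Kxy|NK].
      + destruct (Hp x y Kxy 1) as [r [Hr H]]; [lra|].
        exists r; split; [assumption|]. intros. exists (p x y + 1); intros u v ? ?.
        apply Rlt_le, H; [assumption|]. eapply Hnear; eassumption.
      + destruct (Hcl x y Hxy NK) as [r [Hr H]].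
        exists r; split; [assumption|]. intros. exists 0; intros u v ? ?.
        exfalso; apply (H u v); [|assumption]. eapply Hnear; eassumption. }
  destruct Hbd as [M HM].
  destruct (completeness (fun z => exists u v, K u v /\ z = p u v)) as [s [Hs1 Hs2]].
  { exists M; intros z [u [v [Kuv ->]]]; apply HM; auto. }
  { exists (p xK yK), xK, yK; auto. }
  apply NNPP; intros Hno.
  assert (Hlt : forall u v, K u v -> p u v < s).
  { intros u v Kuv. destruct (Rle_lt_or_eq_dec (p u v) s) as [|E]; [|assumption|].
    - apply Hs1; exists u, v; auto.
    - exfalso; apply Hno; exists u, v; split; [assumption|].
      intros u' v' K'. rewrite E; apply Hs1; exists u', v'; auto. }
  assert (Hgap : exists e, 0 < e /\
    forall u v, in_rect a b c d u v -> K u v -> p u v <= s - e).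
  { apply (cousin_rect (fun a b c d => exists e, 0 < e /\
      forall u v, in_rect a b c d u v -> K u v -> p u v <= s - e)); try assumption.
    - intros a' b' c' d' _ _ [M1 [P1 H1]] [M2 [P2 H2]] [M3 [P3 H3]] [M4 [P4 H4]].
      exists (Rmin (Rmin M1 M2) (Rmin M3 M4)).
      generalize (Rmin_l (Rmin M1 M2) (Rmin M3 M4)) (Rmin_r (Rmin M1 M2) (Rmin M3 M4))
        (Rmin_l M1 M2) (Rmin_r M1 M2) (Rmin_l M3 M4) (Rmin_r M3 M4); intros.
      split; [repeat apply Rmin_glb_lt; assumption|]. intros u v Huv HKuv.
      destruct (Hquad _ _ _ _ _ _ Huv) as [Q|[Q|[Q|Q]]];
        [specialize (H1 u v Q HKuv)|specialize (H2 u v Q HKuv)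
        |specialize (H3 u v Q HKuv)|specialize (H4 u v Q HKuv)]; lra.
    - intros x y Hxy. destruct (classic (K x y)) as [Kxy|NK].
      + assert (L := Hlt x y Kxy).
        destruct (Hp x y Kxy ((s - p x y) / 2)) as [r [Hr H]]; [lra|].
        exists r; split; [assumption|]. intros. exists ((s - p x y) / 2); split; [lra|].
        intros u v ? ?. enough (p u v < p x y + (s - p x y) / 2) by lra.
        apply H; [assumption|]. eapply Hnear; eassumption.
      + destruct (Hcl x y Hxy NK) as [r [Hr H]].
        exists r; split; [assumption|]. intros. exists 1; split; [lra|]; intros u v ? ?.
        exfalso; apply (H u v); [|assumption]. eapply Hnear; eassumption. }
  destruct Hgap as [e [He H]].
  assert (s <= s - e); [|lra].
  apply Hs2; intros z [u [v [Kuv ->]]]; apply H; auto.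
Qed.

(** * The flux of a continuous field *)

(** Otherwise no square around a point of [K] has its trace on [K] inside [F n], so it contains a
    smaller closed square, again centred in [K], that avoids [F n]. The centres lie in [K], so the
    common point of these nested squares cannot lie off the closed set [K]; it lies in no [F n],
    against the covering. *)
Lemma baire_closed (K : R -> R -> Prop) (F : nat -> R -> R -> Prop) (x0 y0 r0 : R) :
  K x0 y0 -> 0 < r0 ->
  (forall x y, in_rect (x0 - r0) (x0 + r0) (y0 - r0) (y0 + r0) x y -> ~ K x y ->
     exists r, 0 < r /\ forall u v, near r x y u v -> ~ K u v) ->
  (forall n x y, ~ F n x y -> exists r, 0 < r /\ forall u v, near r x y u v -> ~ F n u v) ->
  (forall x y, in_rect (x0 - r0) (x0 + r0) (y0 - r0) (y0 + r0) x y -> K x y ->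
     exists n, F n x y) ->
  exists n x y r, K x y /\ 0 < r /\ forall u v, near r x y u v -> K u v -> F n u v.
Proof.
  intros HK0 Hr0 Kcl Fop Fcov. apply NNPP; intros Hno.
  set (St := {s : R * R * R | K (fst (fst s)) (snd (fst s)) /\ 0 < snd s}).
  set (X := fun s : St => fst (fst (proj1_sig s))).
  set (Y := fun s : St => snd (fst (proj1_sig s))).
  set (r := fun s : St => snd (proj1_sig s)).
  assert (Step : forall n (s : St), exists s' : St,
    r s' <= r s / 2 /\ X s - r s <= X s' - r s' /\ X s' + r s' <= X s + r s /\
    Y s - r s <= Y s' - r s' /\ Y s' + r s' <= Y s + r s /\
    forall u v, X s' - r s' <= u <= X s' + r s' -> Y s' - r s' <= v <= Y s' + r s' ->
      ~ F n u v).
  { intros n s. destruct s as [[[x y] q] [HK Hq]]; unfold X, Y, r; cbn in *.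
    assert (Hex : exists u v, near q x y u v /\ K u v /\ ~ F n u v).
    { apply NNPP; intros H1; apply Hno. exists n, x, y, q. repeat split; try assumption.
      intros u v Huv Kuv. apply NNPP; intros H2. apply H1; exists u, v; auto. }
    destruct Hex as [u [v [[Hu Hv] [Kuv NF]]]].
    apply Rabs_def2 in Hu; apply Rabs_def2 in Hv.
    destruct (Fop n u v NF) as [e [He HF]].
    (* Half the old radius, inside the neighbourhood that avoids [F n], and inside the old square on
       all four sides. *)
    set (q' := Rmin (q / 2) (Rmin (e / 2) (Rmin (Rmin (x + q - u) (u - x + q))
                 (Rmin (y + q - v) (v - y + q))))).
    assert (Hq' : 0 < q').
    { unfold q'; repeat apply Rmin_glb_lt; lra. }
    assert (q' <= q / 2 /\ q' <= e / 2 /\ q' <= x + q - u /\ q' <= u - x + q /\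
            q' <= y + q - v /\ q' <= v - y + q).
    { unfold q'; repeat split;
        repeat first [apply Rle_refl | eapply Rle_trans; [apply Rmin_l|];
          first [apply Rle_refl | apply Rmin_l | apply Rmin_r]
         | eapply Rle_trans; [apply Rmin_r|]]. }
    exists (exist _ (u, v, q') (conj Kuv Hq')); cbn.
    repeat split; try lra.
    intros u' v' Hu' Hv'. apply HF; split; apply Rabs_def1; lra. }
  set (nxt := fun n s => proj1_sig (constructive_indefinite_description _ (Step n s))).
  assert (Hnxt : forall n s, _) by
    (exact (fun n s => proj2_sig (constructive_indefinite_description _ (Step n s)))).
  fold (nxt) in Hnxt.
  set (q := fix q n : St := match n with
    | O => exist (fun s => K (fst (fst s)) (snd (fst s)) /\ 0 < snd s)
             (x0, y0, r0) (conj HK0 Hr0)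
    | S n => nxt n (q n) end).
  assert (HS : forall n, r (q (S n)) <= r (q n) / 2 /\
    X (q n) - r (q n) <= X (q (S n)) - r (q (S n)) /\
    X (q (S n)) + r (q (S n)) <= X (q n) + r (q n) /\
    Y (q n) - r (q n) <= Y (q (S n)) - r (q (S n)) /\
    Y (q (S n)) + r (q (S n)) <= Y (q n) + r (q n) /\
    forall u v, X (q (S n)) - r (q (S n)) <= u <= X (q (S n)) + r (q (S n)) ->
      Y (q (S n)) - r (q (S n)) <= v <= Y (q (S n)) + r (q (S n)) -> ~ F n u v).
  { intros n; exact (Hnxt n (q n)). }
  assert (Hr : forall n, 0 < r (q n)) by (intros n; apply (proj2_sig (q n))).
  destruct (nested_intervals (fun n => X (q n) - r (q n)) (fun n => X (q n) + r (q n)))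
    as [x Hx]; try (intros n; destruct (HS n); specialize (Hr n); tauto || lra).
  destruct (nested_intervals (fun n => Y (q n) - r (q n)) (fun n => Y (q n) + r (q n)))
    as [y Hy]; try (intros n; destruct (HS n); specialize (Hr n); tauto || lra).
  assert (Hin : in_rect (x0 - r0) (x0 + r0) (y0 - r0) (y0 + r0) x y).
  { split; [apply (Hx 0%nat)|apply (Hy 0%nat)]. }
  assert (Hrn : forall n, r (q n) <= r0 * (/ 2) ^ n).
  { intros n; induction n as [|n IH]; [cbn; lra|].
    destruct (HS n) as [H _]. cbn [pow]. lra. }
  destruct (classic (K x y)) as [Kxy|NK].
  - destruct (Fcov x y Hin Kxy) as [n Hn].
    destruct (HS n) as [_ [_ [_ [_ [_ H]]]]]. apply (H x y); auto.
  - destruct (Kcl x y Hin NK) as [e [He H]].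
    destruct (pow_half_small r0 e He) as [n Hn]. specialize (Hrn n).
    apply (H (X (q n)) (Y (q n))); [|apply (proj2_sig (q n))].
    specialize (Hx n); specialize (Hy n); split; apply Rabs_def1; lra.
Qed.

(** Continuity on the whole plane, so that no integral below carries a domain condition; functions
    defined only locally are extended by [clamp]. *)
Definition cont2 (P : R -> R -> R) : Prop := forall x y, continuity_2d_pt P x y.

Lemma cont2_l (P : R -> R -> R) (y x : R) : cont2 P -> continuous (fun s => P s y) x.
Proof.
  intros H. apply continuity_pt_filterlim, continuity_pt_locally. intros e.
  destruct (H x y e) as [d Hd]. exists d; intros u Hu. apply Hd; [exact Hu|].
  rewrite Rminus_diag, Rabs_R0; apply cond_pos.
Qed.

Lemma cont2_r (P : R -> R -> R) (x y : R) : cont2 P -> continuous (fun s => P x s) y.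
Proof.
  intros H. apply continuity_pt_filterlim, continuity_pt_locally. intros e.
  destruct (H x y e) as [d Hd]. exists d; intros u Hu. apply Hd; [|exact Hu].
  rewrite Rminus_diag, Rabs_R0; apply cond_pos.
Qed.

(** Outward flux through the boundary of [[a, b] x [c, d]]. Opposite sides share one integral, so
    that bounds on increments apply directly. *)
Definition flux (P Q : R -> R -> R) (a b c d : R) : R :=
  RInt (fun y => P b y - P a y) c d + RInt (fun x => Q x d - Q x c) a b.

Lemma ex_RInt_diff_r (P : R -> R -> R) (a b c d : R) :
  cont2 P -> ex_RInt (fun y => P b y - P a y) c d.
Proof.
  intros HP. apply (ex_RInt_continuous (V := R_CompleteNormedModule)); intros z _.
  apply (continuous_minus (V := R_NormedModule)); apply cont2_r; assumption.
Qed.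

Lemma ex_RInt_diff_l (P : R -> R -> R) (a b c d : R) :
  cont2 P -> ex_RInt (fun x => P x d - P x c) a b.
Proof.
  intros HP. apply (ex_RInt_continuous (V := R_CompleteNormedModule)); intros z _.
  apply (continuous_minus (V := R_NormedModule)); apply (cont2_l P _ z HP).
Qed.

Lemma flux_split_x (P Q : R -> R -> R) (a m b c d : R) : cont2 P -> cont2 Q ->
  flux P Q a b c d = flux P Q a m c d + flux P Q m b c d.
Proof.
  intros HP HQ; unfold flux.
  assert (E1 : RInt (fun x => Q x d - Q x c) a b =
    RInt (fun x => Q x d - Q x c) a m + RInt (fun x => Q x d - Q x c) m b).
  { symmetry; apply (RInt_Chasles (V := R_CompleteNormedModule));
      apply ex_RInt_diff_l; assumption. }
  assert (E2 : RInt (fun y => P b y - P a y) c d =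
    RInt (fun y => P m y - P a y) c d + RInt (fun y => P b y - P m y) c d).
  { rewrite <- (RInt_plus (V := R_CompleteNormedModule)) by (apply ex_RInt_diff_r; assumption).
    apply (RInt_ext (V := R_CompleteNormedModule)); intros; cbn; unfold plus; cbn; ring. }
  rewrite E1, E2; ring.
Qed.

Lemma flux_split_y (P Q : R -> R -> R) (a b c m d : R) : cont2 P -> cont2 Q ->
  flux P Q a b c d = flux P Q a b c m + flux P Q a b m d.
Proof.
  intros HP HQ; unfold flux.
  assert (E1 : RInt (fun x => P b x - P a x) c d =
    RInt (fun x => P b x - P a x) c m + RInt (fun x => P b x - P a x) m d).
  { symmetry; apply (RInt_Chasles (V := R_CompleteNormedModule));
      apply ex_RInt_diff_r; assumption. }
  assert (E2 : RInt (fun y => Q y d - Q y c) a b =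
    RInt (fun y => Q y m - Q y c) a b + RInt (fun y => Q y d - Q y m) a b).
  { rewrite <- (RInt_plus (V := R_CompleteNormedModule)) by (apply ex_RInt_diff_l; assumption).
    apply (RInt_ext (V := R_CompleteNormedModule)); intros; cbn; unfold plus; cbn; ring. }
  rewrite E1, E2; ring.
Qed.

Lemma flux_bound (P Q : R -> R -> R) (a b c d M1 M2 : R) : cont2 P -> cont2 Q ->
  a <= b -> c <= d ->
  (forall y, c <= y <= d -> Rabs (P b y - P a y) <= M1) ->
  (forall x, a <= x <= b -> Rabs (Q x d - Q x c) <= M2) ->
  Rabs (flux P Q a b c d) <= (d - c) * M1 + (b - a) * M2.
Proof.
  intros HP HQ Hab Hcd H1 H2. unfold flux.
  eapply Rle_trans; [apply Rabs_triang|]. apply Rplus_le_compat.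
  - apply abs_RInt_le_const; try assumption. apply ex_RInt_diff_r; assumption.
  - apply abs_RInt_le_const; try assumption. apply ex_RInt_diff_l; assumption.
Qed.

(** The flux of a linear field is its constant divergence times the area. *)
Lemma flux_sub_linear (P Q : R -> R -> R) (p1 p2 q1 q2 a b c d : R) : cont2 P -> cont2 Q ->
  flux (fun x y => P x y - (p1 * x + p2 * y)) (fun x y => Q x y - (q1 * x + q2 * y)) a b c d =
  flux P Q a b c d - (p1 + q2) * ((b - a) * (d - c)).
Proof.
  intros HP HQ; unfold flux.
  assert (E1 : RInt (fun y => P b y - (p1 * b + p2 * y) - (P a y - (p1 * a + p2 * y))) c d =
    RInt (fun y => P b y - P a y) c d - RInt (fun y => p1 * (b - a)) c d).
  { symmetry. rewrite <- (RInt_minus (V := R_CompleteNormedModule));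
      [|apply ex_RInt_diff_r; assumption|apply ex_RInt_const].
    apply (RInt_ext (V := R_CompleteNormedModule)); intros.
    unfold minus, plus, opp; cbn; ring. }
  assert (E2 : RInt (fun y => Q y d - (q1 * y + q2 * d) - (Q y c - (q1 * y + q2 * c))) a b =
    RInt (fun y => Q y d - Q y c) a b - RInt (fun y => q2 * (d - c)) a b).
  { symmetry. rewrite <- (RInt_minus (V := R_CompleteNormedModule));
      [|apply ex_RInt_diff_l; assumption|apply ex_RInt_const].
    apply (RInt_ext (V := R_CompleteNormedModule)); intros.
    unfold minus, plus, opp; cbn; ring. }
  rewrite E1, E2, !RInt_const; unfold scal; cbn; unfold mult; cbn; ring.
Qed.

Lemma cont2_usc (P : R -> R -> R) (x y : R) : cont2 P -> forall e, 0 < e ->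
  exists r, 0 < r /\ forall u v, near r x y u v -> Rabs (P u v - P x y) < e.
Proof.
  intros HP e He. destruct (HP x y (mkposreal e He)) as [r Hr].
  exists r; split; [apply cond_pos|]. intros u v [? ?]; apply Hr; assumption.
Qed.

Lemma cont2_bounded (P : R -> R -> R) (a b c d : R) : cont2 P ->
  exists M, 0 < M /\ forall x y, in_rect a b c d x y -> Rabs (P x y) <= M.
Proof.
  intros HP.
  destruct (classic (a <= b /\ c <= d)) as [[Hab Hcd]|HN].
  2:{ exists 1; split; [lra|]. intros x y [? ?]; exfalso; apply HN; lra. }
  destruct (rect_max (in_rect a b c d) (fun x y => Rabs (P x y)) a b c d) as [x [y [_ H]]].
  - exists a, c; split; lra.
  - auto.
  - intros; contradiction.
  - intros x y _ e He. destruct (cont2_usc P x y HP e He) as [r [Hr H]].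
    exists r; split; [assumption|]. intros u v _ Huv. specialize (H u v Huv).
    generalize (Rabs_triang_inv (P u v) (P x y)); lra.
  - exists (Rabs (P x y) + 1); split; [generalize (Rabs_pos (P x y)); lra|].
    intros u v Huv; specialize (H u v Huv); lra.
Qed.

Lemma cont2_unif (P : R -> R -> R) (a b c d e : R) : cont2 P -> 0 < e ->
  exists r, 0 < r /\ forall x y u v, in_rect a b c d x y -> in_rect a b c d u v ->
    near r x y u v -> Rabs (P u v - P x y) < e.
Proof.
  intros HP He.
  destruct (uniform_continuity_2d P a b c d) with (eps := mkposreal e He) as [r Hr].
  { intros; apply HP. }
  exists r; split; [apply cond_pos|]. intros x y u v [] [] []; apply Hr; assumption.
Qed.

(** On the two long sides the increment across the thin direction is small by uniform continuity; on
    the two short sides the integrand is bounded and the length small. *)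
Lemma flux_thin (P Q : R -> R -> R) (a0 b0 c0 d0 e : R) : cont2 P -> cont2 Q -> 0 < e ->
  exists t, 0 < t /\ forall a b c d, a0 <= a -> a <= b -> b <= b0 -> c0 <= c -> c <= d -> d <= d0 ->
    b - a <= t \/ d - c <= t -> Rabs (flux P Q a b c d) <= e.
Proof.
  intros HP HQ He.
  destruct (cont2_bounded P a0 b0 c0 d0 HP) as [M1 [HM1 B1]].
  destruct (cont2_bounded Q a0 b0 c0 d0 HQ) as [M2 [HM2 B2]].
  set (L := Rmax 1 (Rmax (b0 - a0) (d0 - c0))).
  assert (HL : 1 <= L /\ b0 - a0 <= L /\ d0 - c0 <= L).
  { unfold L; repeat split; [apply Rmax_l| |];
      (eapply Rle_trans; [|apply Rmax_r]); [apply Rmax_l|apply Rmax_r]. }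
  destruct HL as [HL1 [HL2 HL3]].
  assert (He' : 0 < e / (2 * L)) by (apply Rdiv_lt_0_compat; lra).
  assert (HeL : e / (2 * L) * L = e / 2) by (field; lra).
  destruct (cont2_unif P a0 b0 c0 d0 _ HP He') as [r1 [Hr1 U1]].
  destruct (cont2_unif Q a0 b0 c0 d0 _ HQ He') as [r2 [Hr2 U2]].
  set (t := Rmin (Rmin (r1 / 2) (r2 / 2)) (Rmin (e / (4 * M1)) (e / (4 * M2)))).
  assert (Ht : t <= r1 / 2 /\ t <= r2 / 2 /\ t <= e / (4 * M1) /\ t <= e / (4 * M2)).
  { unfold t; repeat split;
     first [eapply Rle_trans; [apply Rmin_l|]; first [apply Rmin_l|apply Rmin_r]
           |eapply Rle_trans; [apply Rmin_r|]; first [apply Rmin_l|apply Rmin_r]]. }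
  destruct Ht as [T1 [T2 [T3 T4]]].
  assert (E1 : e / (4 * M1) * M1 = e / 4) by (field; lra).
  assert (E2 : e / (4 * M2) * M2 = e / 4) by (field; lra).
  exists t; split.
  { unfold t; repeat apply Rmin_glb_lt; try lra; apply Rdiv_lt_0_compat; lra. }
  intros a b c d Ha Hab Hb Hc Hcd Hd [Hw|Hh].
  - eapply Rle_trans; [apply (flux_bound _ _ _ _ _ _ (e / (2 * L)) (2 * M2)); try assumption|].
    + intros y Hy; apply Rlt_le, U1; [split; lra|split; lra|].
      split; apply Rabs_def1; lra.
    + intros x Hx. unfold Rminus; eapply Rle_trans; [apply Rabs_triang|].
      rewrite Rabs_Ropp.
      assert (Rabs (Q x d) <= M2) by (apply B2; split; lra).
      assert (Rabs (Q x c) <= M2) by (apply B2; split; lra). lra.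
    + nra.
  - eapply Rle_trans; [apply (flux_bound _ _ _ _ _ _ (2 * M1) (e / (2 * L))); try assumption|].
    + intros y Hy. unfold Rminus; eapply Rle_trans; [apply Rabs_triang|].
      rewrite Rabs_Ropp.
      assert (Rabs (P b y) <= M1) by (apply B1; split; lra).
      assert (Rabs (P a y) <= M1) by (apply B1; split; lra). lra.
    + intros x Hx; apply Rlt_le, U2; [split; lra|split; lra|].
      split; apply Rabs_def1; lra.
    + nra.
Qed.

(** * Dyadic covers *)

(** The rectangles need not contain the point, which makes the set of good points open. *)
Definition good (P Q : R -> R -> R) (e x y : R) : Prop :=
  exists r, 0 < r /\ forall a b c d, a <= b -> c <= d ->
    x - r <= a -> b <= x + r -> y - r <= c -> d <= y + r ->
    Rabs (flux P Q a b c d) <= e * ((b - a) * (d - c)).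

Lemma good_near (P Q : R -> R -> R) (e x y : R) : good P Q e x y ->
  exists r, 0 < r /\ forall u v, near r x y u v -> good P Q e u v.
Proof.
  intros [r [Hr H]]. exists (r / 2); split; [lra|]. intros u v [Hu Hv].
  apply Rabs_def2 in Hu; apply Rabs_def2 in Hv.
  exists (r / 2); split; [lra|]. intros; apply H; lra.
Qed.

Lemma flux_quad (P Q : R -> R -> R) (a m b c k d : R) : cont2 P -> cont2 Q ->
  flux P Q a b c d = flux P Q a m c k + flux P Q m b c k + flux P Q a m k d + flux P Q m b k d.
Proof.
  intros HP HQ. rewrite (flux_split_y P Q a b c k d HP HQ).
  rewrite (flux_split_x P Q a m b c k HP HQ), (flux_split_x P Q a m b k d HP HQ). ring.
Qed.

Lemma Rabs_plus4 (x y z t : R) : Rabs (x + y + z + t) <= Rabs x + Rabs y + Rabs z + Rabs t.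
Proof.
  generalize (Rabs_triang (x + y + z) t) (Rabs_triang (x + y) z) (Rabs_triang x y); lra.
Qed.

Lemma good_rect (P Q : R -> R -> R) (e a b c d : R) : cont2 P -> cont2 Q -> a <= b -> c <= d ->
  (forall x y, in_rect a b c d x y -> good P Q e x y) ->
  Rabs (flux P Q a b c d) <= e * ((b - a) * (d - c)).
Proof.
  intros HP HQ Hab Hcd HG.
  apply (cousin_rect (fun a b c d => Rabs (flux P Q a b c d) <= e * ((b - a) * (d - c))));
    try assumption.
  - intros a' b' c' d' _ _ H1 H2 H3 H4.
    rewrite (flux_quad P Q a' ((a' + b') / 2) b' c' ((c' + d') / 2) d' HP HQ).
    eapply Rle_trans; [apply Rabs_plus4|]. lra.
  - intros x y Hxy. destruct (HG x y Hxy) as [r [Hr H]]. exists r; split; [assumption|].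
    intros a' b' c' d' _ _ _ _ [? ?] ? ?. apply H; lra.
Qed.

(** A frame of four thin strips carries little flux, and [good_rect] applies to what it encloses.
    The sides must be allowed to be bad: the rectangles next to the hull of the exceptional set
    share a side with it. *)
Lemma good_interior (P Q : R -> R -> R) (e a b c d : R) : cont2 P -> cont2 Q -> 0 <= e ->
  a <= b -> c <= d ->
  (forall x y, a < x < b -> c < y < d -> good P Q e x y) ->
  Rabs (flux P Q a b c d) <= e * ((b - a) * (d - c)).
Proof.
  intros HP HQ He Hab Hcd HG. apply Rle_plus_epsilon; intros e1 He1.
  destruct (flux_thin P Q a b c d (e1 / 4) HP HQ) as [t [Ht HT]]; [lra|].
  (* With no room for two strips of width [t], both halves of the rectangle are themselves thin. *)
  assert (Hsmall : b - a <= 2 * t \/ 2 * t < b - a) by lra.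
  assert (Area : 0 <= e * ((b - a) * (d - c))).
  { apply Rmult_le_pos; [assumption|]. apply Rmult_le_pos; lra. }
  destruct Hsmall as [Hs|Hs].
  { rewrite (flux_split_x P Q a ((a + b) / 2) b c d HP HQ).
    eapply Rle_trans; [apply Rabs_triang|].
    assert (Rabs (flux P Q a ((a + b) / 2) c d) <= e1 / 4) by (apply HT; lra).
    assert (Rabs (flux P Q ((a + b) / 2) b c d) <= e1 / 4) by (apply HT; lra). lra. }
  assert (Hsmall2 : d - c <= 2 * t \/ 2 * t < d - c) by lra.
  destruct Hsmall2 as [Hs2|Hs2].
  { rewrite (flux_split_y P Q a b c ((c + d) / 2) d HP HQ).
    eapply Rle_trans; [apply Rabs_triang|].
    assert (Rabs (flux P Q a b c ((c + d) / 2)) <= e1 / 4) by (apply HT; lra).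
    assert (Rabs (flux P Q a b ((c + d) / 2) d) <= e1 / 4) by (apply HT; lra). lra. }
  rewrite (flux_split_x P Q a (a + t) b c d HP HQ).
  rewrite (flux_split_x P Q (a + t) (b - t) b c d HP HQ).
  rewrite (flux_split_y P Q (a + t) (b - t) c (c + t) d HP HQ).
  rewrite (flux_split_y P Q (a + t) (b - t) (c + t) (d - t) d HP HQ).
  assert (Rabs (flux P Q a (a + t) c d) <= e1 / 4) by (apply HT; lra).
  assert (Rabs (flux P Q (b - t) b c d) <= e1 / 4) by (apply HT; lra).
  assert (Rabs (flux P Q (a + t) (b - t) c (c + t)) <= e1 / 4) by (apply HT; lra).
  assert (Rabs (flux P Q (a + t) (b - t) (d - t) d) <= e1 / 4) by (apply HT; lra).
  assert (G : Rabs (flux P Q (a + t) (b - t) (c + t) (d - t)) <=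
    e * (((b - t) - (a + t)) * ((d - t) - (c + t)))).
  { apply good_rect; try assumption; try lra. intros x y [? ?]; apply HG; lra. }
  set (F1 := flux P Q a (a + t) c d) in *.
  set (F2 := flux P Q (b - t) b c d) in *.
  set (F3 := flux P Q (a + t) (b - t) c (c + t)) in *.
  set (F4 := flux P Q (a + t) (b - t) (d - t) d) in *.
  set (F5 := flux P Q (a + t) (b - t) (c + t) (d - t)) in *.
  assert (Rabs F5 <= e * ((b - a) * (d - c))).
  { eapply Rle_trans; [exact G|]. apply Rmult_le_compat_l; [assumption|].
    apply Rmult_le_compat; lra. }
  replace (F1 + (F3 + (F5 + F4) + F2)) with ((F1 + F2 + F3 + F4) + F5) by ring.
  eapply Rle_trans; [apply Rabs_triang|].
  generalize (Rabs_plus4 F1 F2 F3 F4); lra.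
Qed.

(** Area of the depth-[k] dyadic cells of a rectangle that meet [K]; it decreases with [k] to the
    outer content of [K], and takes the place of Lebesgue measure. *)
Fixpoint cell_area (K : R -> R -> Prop) (k : nat) (a b c d : R) : R :=
  match k with
  | O => if excluded_middle_informative (exists x y, in_rect a b c d x y /\ K x y)
         then (b - a) * (d - c) else 0
  | S k => cell_area K k a ((a + b) / 2) c ((c + d) / 2)
         + cell_area K k ((a + b) / 2) b c ((c + d) / 2)
         + cell_area K k a ((a + b) / 2) ((c + d) / 2) d
         + cell_area K k ((a + b) / 2) b ((c + d) / 2) d
  end.

Lemma cell_area_pos K k : forall a b c d, a <= b -> c <= d -> 0 <= cell_area K k a b c d.
Proof.
  induction k as [|k IH]; intros a b c d Hab Hcd; cbn [cell_area].
  - destruct excluded_middle_informative; [|lra]. apply Rmult_le_pos; lra.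
  - repeat apply Rplus_le_le_0_compat; apply IH; lra.
Qed.

Lemma cell_area_empty K k : forall a b c d, a <= b -> c <= d ->
  (forall x y, in_rect a b c d x y -> ~ K x y) -> cell_area K k a b c d = 0.
Proof.
  induction k as [|k IH]; intros a b c d Hab Hcd H; cbn [cell_area].
  - destruct excluded_middle_informative as [[x [y [H1 H2]]]|]; [|reflexivity].
    exfalso; apply (H x y); assumption.
  - rewrite !IH; try lra; intros x y [? ?]; apply H; split; lra.
Qed.

Definition overlap (a b p q : R) : R := Rmax 0 (Rmin b q - Rmax a p).

Lemma overlap_split (a m b p q : R) : a <= m <= b -> p <= q ->
  overlap a b p q = overlap a m p q + overlap m b p q.
Proof.
  intros H1 H2. unfold overlap, Rmax, Rmin.
  repeat (destruct Rle_dec); lra.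
Qed.

Lemma overlap_full (a b p q : R) : a <= b -> p <= a -> b <= q -> overlap a b p q = b - a.
Proof.
  intros. unfold overlap. rewrite (Rmin_left b q), (Rmax_left a p), Rmax_right; lra.
Qed.

Lemma overlap_pos (a b p q : R) : 0 <= overlap a b p q.
Proof. apply Rmax_l. Qed.

Lemma overlap_le (a b p q : R) : p <= q -> overlap a b p q <= q - p.
Proof.
  intros H. unfold overlap, Rmax, Rmin. repeat (destruct Rle_dec); lra.
Qed.

(** A cell of depth [k] that meets [K] lies within one cell side of the hull [[a', b'] x [c', d']],
    hence in [[p, q] x [p', q']], and its area equals its overlap with that rectangle. Overlaps are
    additive under quartering, so they pass through the recursion. *)
Lemma cell_area_overlap K p q p' q' (a' b' c' d' : R) k : forall a b c d, a <= b -> c <= d ->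
  p <= q -> p' <= q' ->
  (forall x y, in_rect a b c d x y -> K x y -> in_rect a' b' c' d' x y) ->
  p <= a' - (b - a) * (/ 2) ^ k -> b' + (b - a) * (/ 2) ^ k <= q ->
  p' <= c' - (d - c) * (/ 2) ^ k -> d' + (d - c) * (/ 2) ^ k <= q' ->
  cell_area K k a b c d <= overlap a b p q * overlap c d p' q'.
Proof.
  induction k as [|k IH]; intros a b c d Hab Hcd Hpq Hpq' HK H1 H2 H3 H4;
    cbn [cell_area pow] in *.
  - destruct excluded_middle_informative as [[x [y [Hxy Kxy]]]|].
    + destruct (HK x y Hxy Kxy) as [? ?]; destruct Hxy.
      rewrite !overlap_full; lra.
    + apply Rmult_le_pos; apply overlap_pos.
  - assert (0 <= (/ 2) ^ k) by (apply pow_le; lra).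
    rewrite (overlap_split a ((a + b) / 2) b p q) by lra.
    rewrite (overlap_split c ((c + d) / 2) d p' q') by lra.
    assert (W1 : ((a + b) / 2 - a) * (/ 2) ^ k = (b - a) * (/ 2 * (/ 2) ^ k)) by field.
    assert (W2 : (b - (a + b) / 2) * (/ 2) ^ k = (b - a) * (/ 2 * (/ 2) ^ k)) by field.
    assert (W3 : ((c + d) / 2 - c) * (/ 2) ^ k = (d - c) * (/ 2 * (/ 2) ^ k)) by field.
    assert (W4 : (d - (c + d) / 2) * (/ 2) ^ k = (d - c) * (/ 2 * (/ 2) ^ k)) by field.
    rewrite Rmult_plus_distr_r, !Rmult_plus_distr_l.
    assert (C1 : cell_area K k a ((a + b) / 2) c ((c + d) / 2) <=
      overlap a ((a + b) / 2) p q * overlap c ((c + d) / 2) p' q').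
    { apply IH; rewrite ?W1, ?W2, ?W3, ?W4; try lra; intros x y [] ?; apply HK; try split;
        lra || assumption. }
    assert (C2 : cell_area K k ((a + b) / 2) b c ((c + d) / 2) <=
      overlap ((a + b) / 2) b p q * overlap c ((c + d) / 2) p' q').
    { apply IH; rewrite ?W1, ?W2, ?W3, ?W4; try lra; intros x y [] ?; apply HK; try split;
        lra || assumption. }
    assert (C3 : cell_area K k a ((a + b) / 2) ((c + d) / 2) d <=
      overlap a ((a + b) / 2) p q * overlap ((c + d) / 2) d p' q').
    { apply IH; rewrite ?W1, ?W2, ?W3, ?W4; try lra; intros x y [] ?; apply HK; try split;
        lra || assumption. }
    assert (C4 : cell_area K k ((a + b) / 2) b ((c + d) / 2) d <=
      overlap ((a + b) / 2) b p q * overlap ((c + d) / 2) d p' q').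
    { apply IH; rewrite ?W1, ?W2, ?W3, ?W4; try lra; intros x y [] ?; apply HK; try split;
        lra || assumption. }
    lra.
Qed.

(** The hull is enlarged by one cell side in each direction. Expanding the product gives the hull
    area and error terms with coefficients 2, 2 and 4, whence the 8. *)
Lemma cell_area_le (K : R -> R -> Prop) (k : nat) (a b c d a' b' c' d' : R) :
  a <= b -> c <= d -> a <= a' -> a' <= b' -> b' <= b -> c <= c' -> c' <= d' -> d' <= d ->
  (forall x y, in_rect a b c d x y -> K x y -> in_rect a' b' c' d' x y) ->
  cell_area K k a b c d <=
    (b' - a') * (d' - c') + 8 * ((b - a) * (d - c)) * (/ 2) ^ k.
Proof.
  intros Hab Hcd A1 A2 A3 C1 C2 C3 HK.
  assert (Hpow : 0 <= (/ 2) ^ k <= 1).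
  { split; [apply pow_le; lra|]. rewrite <- (pow1 k). apply pow_incr; lra. }
  set (h := (/ 2) ^ k) in *.
  assert (0 <= (b - a) * h) by (apply Rmult_le_pos; lra).
  assert (0 <= (d - c) * h) by (apply Rmult_le_pos; lra).
  eapply Rle_trans.
  { apply (cell_area_overlap K (a' - (b - a) * h) (b' + (b - a) * h)
      (c' - (d - c) * h) (d' + (d - c) * h) a' b' c' d'); try assumption; unfold h in *; lra. }
  eapply Rle_trans.
  { apply Rmult_le_compat; try apply overlap_pos; apply overlap_le; lra. }
  assert ((b' - a') * ((d - c) * h) <= (b - a) * ((d - c) * h)) by (apply Rmult_le_compat_r; lra).
  assert ((d' - c') * ((b - a) * h) <= (d - c) * ((b - a) * h)) by (apply Rmult_le_compat_r; lra).
  assert ((b - a) * h * ((d - c) * h) <= (b - a) * h * ((d - c) * 1)).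
  { apply Rmult_le_compat_l; [assumption|]. apply Rmult_le_compat_l; lra. }
  lra.
Qed.

(** Some cell area comes within [e] of the infimum over all depths, and no later one falls below
    that infimum. *)
Lemma cell_area_cauchy (K : R -> R -> Prop) (a b c d e : R) : a <= b -> c <= d -> 0 < e ->
  exists k, forall l, cell_area K k a b c d <= cell_area K (k + l) a b c d + e.
Proof.
  intros Hab Hcd He.
  destruct (completeness (fun z => exists k, z = - cell_area K k a b c d)) as [s [S1 S2]].
  - exists 0; intros z [k ->]. generalize (cell_area_pos K k a b c d Hab Hcd); lra.
  - exists (- cell_area K 0 a b c d), 0%nat; reflexivity.
  - assert (H : exists k, s - e < - cell_area K k a b c d).
    { apply NNPP; intros HN. assert (s <= s - e); [|lra].
      apply S2; intros z [k ->]. apply Rnot_lt_le; intros H; apply HN; exists k; exact H. }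
    destruct H as [k Hk]. exists k; intros l.
    assert (- cell_area K (k + l) a b c d <= s) by (apply S1; exists (k + l)%nat; reflexivity).
    lra.
Qed.

(** The first term charges a cell that meets [K] in full; the second charges the area not covered by
    its content at depth [l]. Summed over the cells of depth [k], they exceed [e] times the total
    area by [e] times the drop of [cell_area] from depth [k] to [k + l], which is small for a
    suitable [k]. Quartering keeps the aspect ratio, so every cell satisfies the hypothesis. *)
Lemma flux_le_of_cells (P Q : R -> R -> R) (K : R -> R -> Prop) (e a0 b0 c0 d0 : R) :
  cont2 P -> cont2 Q -> 0 <= e ->
  (forall a b c d, a0 <= a -> a <= b -> b <= b0 -> c0 <= c -> c <= d -> d <= d0 ->
     b - a <= 2 * (d - c) -> d - c <= 2 * (b - a) -> forall e1, 0 < e1 ->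
     exists L, forall l, (L <= l)%nat ->
       Rabs (flux P Q a b c d) <= e * cell_area K 0 a b c d +
         e * ((b - a) * (d - c) - cell_area K l a b c d) + e1) ->
  a0 <= b0 -> c0 <= d0 -> b0 - a0 <= 2 * (d0 - c0) -> d0 - c0 <= 2 * (b0 - a0) ->
  Rabs (flux P Q a0 b0 c0 d0) <= e * ((b0 - a0) * (d0 - c0)).
Proof.
  intros HP HQ He Hcell H1 H2 H3 H4.
  assert (Sum : forall k a b c d, a0 <= a -> a <= b -> b <= b0 -> c0 <= c -> c <= d -> d <= d0 ->
     b - a <= 2 * (d - c) -> d - c <= 2 * (b - a) -> forall e1, 0 < e1 ->
     exists L, forall l, (L <= l)%nat ->
       Rabs (flux P Q a b c d) <= e * cell_area K k a b c d +
         e * ((b - a) * (d - c) - cell_area K (k + l) a b c d) + e1).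
  { intros k; induction k as [|k IH]; intros a b c d; intros.
    - apply Hcell; assumption.
    - set (m := (a + b) / 2). set (n := (c + d) / 2).
      assert (a <= m <= b /\ c <= n <= d) by (unfold m, n; lra).
      assert (m - a = (b - a) / 2 /\ b - m = (b - a) / 2 /\
              n - c = (d - c) / 2 /\ d - n = (d - c) / 2) by (unfold m, n; lra).
      destruct (IH a m c n) with (e1 := e1 / 4) as [L1 HL1]; try lra.
      destruct (IH m b c n) with (e1 := e1 / 4) as [L2 HL2]; try lra.
      destruct (IH a m n d) with (e1 := e1 / 4) as [L3 HL3]; try lra.
      destruct (IH m b n d) with (e1 := e1 / 4) as [L4 HL4]; try lra.
      exists (L1 + L2 + L3 + L4)%nat; intros l Hl.
      specialize (HL1 l ltac:(lia)). specialize (HL2 l ltac:(lia)).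
      specialize (HL3 l ltac:(lia)). specialize (HL4 l ltac:(lia)).
      rewrite (flux_quad P Q a m b c n d HP HQ).
      eapply Rle_trans; [apply Rabs_plus4|].
      cbn [cell_area Nat.add]. fold m; fold n.
      assert (Area : (b - a) * (d - c) = (m - a) * (n - c) + (b - m) * (n - c)
         + (m - a) * (d - n) + (b - m) * (d - n)) by ring.
      rewrite Area. lra. }
  apply Rle_plus_epsilon; intros e1 He1.
  (* The denominator has [e + 1] because [e] may be 0. *)
  destruct (cell_area_cauchy K a0 b0 c0 d0 (e1 / (2 * (e + 1))) H1 H2) as [k Hk].
  { apply Rdiv_lt_0_compat; lra. }
  destruct (Sum k a0 b0 c0 d0) with (e1 := e1 / 2) as [L HL]; try lra.
  specialize (HL L (Nat.le_refl L)). specialize (Hk L).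
  assert (e * (cell_area K k a0 b0 c0 d0) <=
    e * (cell_area K (k + L) a0 b0 c0 d0 + e1 / (2 * (e + 1)))) by (apply Rmult_le_compat_l; lra).
  assert (e * (e1 / (2 * (e + 1))) <= e1 / 2).
  { apply (Rmult_le_reg_r (2 * (e + 1))); [lra|].
    replace (e * (e1 / (2 * (e + 1))) * (2 * (e + 1))) with (e * e1) by (field; lra). nra. }
  lra.
Qed.

(** Halving the longer side repeatedly brings the ratio of the sides below 2; in [Claim] the number
    [n] allows a ratio of [2 * 2 ^ n]. Degenerate rectangles, which no halving improves, have zero
    flux. *)
Lemma flux_all_aspects (P Q : R -> R -> R) (e a0 b0 c0 d0 : R) : cont2 P -> cont2 Q ->
  (forall a b c d, a0 <= a -> a <= b -> b <= b0 -> c0 <= c -> c <= d -> d <= d0 ->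
     b - a <= 2 * (d - c) -> d - c <= 2 * (b - a) ->
     Rabs (flux P Q a b c d) <= e * ((b - a) * (d - c))) ->
  a0 <= b0 -> c0 <= d0 ->
  Rabs (flux P Q a0 b0 c0 d0) <= e * ((b0 - a0) * (d0 - c0)).
Proof.
  intros HP HQ H Hab Hcd.
  assert (Claim : forall n a b c d,
     a0 <= a -> a <= b -> b <= b0 -> c0 <= c -> c <= d -> d <= d0 ->
     (b - a) * (/ 2) ^ n <= 2 * (d - c) -> (d - c) * (/ 2) ^ n <= 2 * (b - a) ->
     Rabs (flux P Q a b c d) <= e * ((b - a) * (d - c))).
  { intros n; induction n as [|n IH]; intros a b c d ? ? ? ? ? ? H1 H2; cbn [pow] in *.
    - apply H; lra.
    - assert (Hpow : 0 <= (/ 2) ^ n <= 1).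
      { split; [apply pow_le; lra|]. rewrite <- (pow1 n). apply pow_incr; lra. }
      destruct (Rle_dec (b - a) (2 * (d - c))) as [L1|L1];
      [destruct (Rle_dec (d - c) (2 * (b - a))) as [L2|L2]|].
      + apply H; lra.
      + set (m := (c + d) / 2).
        rewrite (flux_split_y P Q a b c m d HP HQ).
        assert (Rabs (flux P Q a b c m) <= e * ((b - a) * (m - c))).
        { apply IH; unfold m; try lra. nra. }
        assert (Rabs (flux P Q a b m d) <= e * ((b - a) * (d - m))).
        { apply IH; unfold m; try lra. nra. }
        eapply Rle_trans; [apply Rabs_triang|]. lra.
      + set (m := (a + b) / 2).
        rewrite (flux_split_x P Q a m b c d HP HQ).
        assert (Rabs (flux P Q a m c d) <= e * ((m - a) * (d - c))).
        { apply IH; unfold m; try lra. nra. }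
        assert (Rabs (flux P Q m b c d) <= e * ((b - m) * (d - c))).
        { apply IH; unfold m; try lra. nra. }
        eapply Rle_trans; [apply Rabs_triang|]. lra. }
  destruct (Rle_lt_or_eq_dec a0 b0 Hab) as [Hlt|E].
  2:{ assert (E' : flux P Q a0 b0 c0 d0 = 0).
      { generalize (flux_bound P Q a0 b0 c0 d0 0 (Rabs (Q a0 d0 - Q a0 c0)) HP HQ Hab Hcd).
        rewrite E, Rminus_diag, Rmult_0_r, Rmult_0_l, Rplus_0_l. intros B.
        apply Rabs_eq_0, Rle_antisym; [|apply Rabs_pos]. apply B.
        - intros; rewrite Rminus_diag, Rabs_R0; lra.
        - intros x Hx. replace x with b0 by lra. lra. }
      rewrite E', E, Rabs_R0. lra. }
  destruct (Rle_lt_or_eq_dec c0 d0 Hcd) as [Hlt'|E].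
  2:{ assert (E' : flux P Q a0 b0 c0 d0 = 0).
      { generalize (flux_bound P Q a0 b0 c0 d0 (Rabs (P b0 c0 - P a0 c0)) 0 HP HQ Hab Hcd).
        rewrite E, Rminus_diag, Rmult_0_r, Rmult_0_l, Rplus_0_l. intros B.
        apply Rabs_eq_0, Rle_antisym; [|apply Rabs_pos]. apply B.
        - intros x Hx. replace x with d0 by lra. lra.
        - intros; rewrite Rminus_diag, Rabs_R0; lra. }
      rewrite E', E, Rabs_R0. lra. }
  destruct (pow_half_small (Rmax (b0 - a0) (d0 - c0)) (Rmin (b0 - a0) (d0 - c0))) as [n Hn].
  { apply Rmin_glb_lt; lra. }
  assert (Hpow : 0 <= (/ 2) ^ n) by (apply pow_le; lra).
  apply (Claim n); try lra.
  - generalize (Rmax_l (b0 - a0) (d0 - c0)) (Rmin_r (b0 - a0) (d0 - c0)); nra.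
  - generalize (Rmax_r (b0 - a0) (d0 - c0)) (Rmin_l (b0 - a0) (d0 - c0)); nra.
Qed.

(** * The Looman-Menchoff theorem *)

Definition dq (F : R -> R) (t h : R) : R := (F (t + h) - F t) / h.

(** A Cauchy condition on difference quotients that does not mention the derivative. For fixed steps
    it is a closed condition on the point, although the derivative itself need not depend
    continuously on the point. *)
Definition stable (F : R -> R) (t N d : R) : Prop :=
  forall h h', h <> 0 -> Rabs h < d -> h' <> 0 -> Rabs h' < d ->
    Rabs (dq F t h - dq F t h') <= N.

Lemma stable_mono (F : R -> R) (t N d d' : R) : d' <= d -> stable F t N d -> stable F t N d'.
Proof. intros Hd H h h' ? ? ? ?; apply H; try assumption; lra. Qed.

Lemma pow_half_mono (n m : nat) : (n <= m)%nat -> (/ 2) ^ m <= (/ 2) ^ n.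
Proof.
  intros H. replace m with (n + (m - n))%nat by lia.
  induction (m - n)%nat as [|k IH]; [rewrite Nat.add_0_r; lra|].
  rewrite Nat.add_succ_r; cbn [pow]. assert (0 <= (/ 2) ^ (n + k)) by (apply pow_le; lra). lra.
Qed.

Lemma stable_exists (F : R -> R) (t N l : R) : is_derive F t l -> 0 < N ->
  exists n : nat, stable F t N ((/ 2) ^ n).
Proof.
  intros H HN. apply is_derive_Reals in H.
  destruct (H (N / 2)) as [d Hd]; [lra|].
  destruct (pow_half_small 1 d (cond_pos d)) as [n Hn]. rewrite Rmult_1_l in Hn.
  exists n; intros h h' h1 h2 h3 h4. unfold dq.
  assert (A := Hd h h1 ltac:(lra)). assert (B := Hd h' h3 ltac:(lra)).
  apply Rabs_def2 in A; apply Rabs_def2 in B. apply Rabs_le; lra.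
Qed.

(** Three errors of size [N]: from step [s - t] to step [d / 2] at [t], from [t] to [t0] at step
    [d / 2], and from step [d / 2] to the limit [l] at [t0]. *)
Lemma stable_lip (F F0 : R -> R) (t t0 l N d : R) : 0 < d -> is_derive F0 t0 l ->
  stable F0 t0 N d -> stable F t N d ->
  Rabs (dq F t (d / 2) - dq F0 t0 (d / 2)) <= N ->
  forall s, Rabs (s - t) < d -> Rabs (F s - F t - l * (s - t)) <= 3 * N * Rabs (s - t).
Proof.
  intros Hd Hl S0 S H s Hs.
  destruct (Req_dec s t) as [->|Hne].
  { replace (F t - F t - l * (t - t)) with 0 by ring. rewrite Rminus_diag, Rabs_R0; lra. }
  assert (B0 : Rabs (dq F0 t0 (d / 2) - l) <= N).
  { apply Rle_plus_epsilon; intros e He. apply is_derive_Reals in Hl.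
    destruct (Hl e He) as [r Hr]. set (h := Rmin (r / 2) (d / 2)).
    assert (0 < h) by (apply Rmin_glb_lt; [generalize (cond_pos r)|]; lra).
    assert (h < r) by (generalize (Rmin_l (r / 2) (d / 2)) (cond_pos r); unfold h; lra).
    assert (h < d) by (generalize (Rmin_r (r / 2) (d / 2)); unfold h; lra).
    assert (A := Hr h ltac:(lra) ltac:(rewrite Rabs_right; lra)).
    assert (B := S0 (d / 2) h ltac:(lra) ltac:(rewrite Rabs_right; lra)
                  ltac:(lra) ltac:(rewrite Rabs_right; lra)).
    fold (dq F0 t0 h) in A.
    replace (dq F0 t0 (d / 2) - l) with ((dq F0 t0 (d / 2) - dq F0 t0 h) + (dq F0 t0 h - l)) by ring.
    eapply Rle_trans; [apply Rabs_triang|]. lra. }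
  assert (B1 := S (s - t) (d / 2) ltac:(lra) Hs ltac:(lra) ltac:(rewrite Rabs_right; lra)).
  assert (B2 : Rabs (dq F t (s - t) - l) <= 3 * N).
  { replace (dq F t (s - t) - l) with ((dq F t (s - t) - dq F t (d / 2)) +
      ((dq F t (d / 2) - dq F0 t0 (d / 2)) + (dq F0 t0 (d / 2) - l))) by ring.
    eapply Rle_trans; [apply Rabs_triang|].
    generalize (Rabs_triang (dq F t (d / 2) - dq F0 t0 (d / 2)) (dq F0 t0 (d / 2) - l)); lra. }
  replace (F s - F t - l * (s - t)) with ((dq F t (s - t) - l) * (s - t)).
  2:{ unfold dq. replace (t + (s - t)) with s by ring. field; lra. }
  rewrite Rabs_mult. apply Rmult_le_compat_r; [apply Rabs_pos|assumption].
Qed.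

Definition swap (P : R -> R -> R) (x y : R) : R := P y x.

Lemma cont2_swap (P : R -> R -> R) : cont2 P -> cont2 (swap P).
Proof.
  intros H x y e. destruct (H y x e) as [d Hd]. exists d; intros; apply Hd; assumption.
Qed.

Lemma cont2_shift (P : R -> R -> R) (h k : R) : cont2 P -> cont2 (fun x y => P (x + h) (y + k)).
Proof.
  intros H x y e. destruct (H (x + h) (y + k) e) as [d Hd]. exists d; intros u v Hu Hv.
  apply Hd; [replace (u + h - (x + h)) with (u - x) by ring
            |replace (v + k - (y + k)) with (v - y) by ring]; assumption.
Qed.

Lemma cont2_dq (P : R -> R -> R) (h : R) : cont2 P -> cont2 (fun x y => dq (fun s => P s y) x h).
Proof.
  intros H x y. unfold dq, Rdiv. apply continuity_2d_pt_mult; [|apply continuity_2d_pt_const].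
  apply continuity_2d_pt_minus; [|apply H].
  apply continuity_2d_pt_ext with (fun x y => P (x + h) (y + 0)).
  - intros; rewrite Rplus_0_r; reflexivity.
  - apply (cont2_shift P h 0 H).
Qed.

(** A pair of steps that violates the bound at one point violates it nearby, since quotients with
    fixed steps are continuous in the point. *)
Lemma unstable_near (P : R -> R -> R) (N d x y : R) : cont2 P ->
  ~ stable (fun s => P s y) x N d ->
  exists r, 0 < r /\ forall u v, near r x y u v -> ~ stable (fun s => P s v) u N d.
Proof.
  intros HP HN.
  assert (Hex : exists h h', h <> 0 /\ Rabs h < d /\ h' <> 0 /\ Rabs h' < d /\
    N < Rabs (dq (fun s => P s y) x h - dq (fun s => P s y) x h')).
  { apply NNPP; intros H; apply HN; intros h h' ? ? ? ?.
    apply Rnot_lt_le; intros L; apply H; exists h, h'; auto. }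
  destruct Hex as [h [h' [H1 [H2 [H3 [H4 H5]]]]]].
  set (G := fun x y => dq (fun s => P s y) x h - dq (fun s => P s y) x h').
  assert (HG : cont2 G).
  { intros u v; apply continuity_2d_pt_minus; apply cont2_dq; assumption. }
  destruct (cont2_usc G x y HG (Rabs (G x y) - N)) as [r [Hr HrG]]; [unfold G; lra|].
  exists r; split; [assumption|]. intros u v Huv S.
  specialize (S h h' H1 H2 H3 H4). specialize (HrG u v Huv). fold (G u v) in S.
  generalize (Rabs_triang_inv (G x y) (G u v)). rewrite (Rabs_minus_sym (G x y)). lra.
Qed.

Lemma unstable_near_r (P : R -> R -> R) (N d x y : R) : cont2 P ->
  ~ stable (fun s => P x s) y N d ->
  exists r, 0 < r /\ forall u v, near r x y u v -> ~ stable (fun s => P u s) v N d.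
Proof.
  intros HP HN. destruct (unstable_near (swap P) N d y x (cont2_swap P HP) HN) as [r [Hr H]].
  exists r; split; [assumption|]. intros u v [? ?]; apply (H v u); split; assumption.
Qed.

(** The quotients of [P] in [y] and of [Q] in [x] are included, although they do not enter the
    divergence: [cross_gap] moves along the sides of the rectangle. *)
Definition flat (P Q : R -> R -> R) (N d x y : R) : Prop :=
  (stable (fun s => P s y) x N d /\ stable (fun s => P x s) y N d) /\
  (stable (fun s => Q s y) x N d /\ stable (fun s => Q x s) y N d).

Lemma not_flat_near (P Q : R -> R -> R) (N d x y : R) : cont2 P -> cont2 Q ->
  ~ flat P Q N d x y ->
  exists r, 0 < r /\ forall u v, near r x y u v -> ~ flat P Q N d u v.
Proof.
  intros HP HQ HN. unfold flat in HN.
  apply not_and_or in HN as [HN|HN]; apply not_and_or in HN as [HN|HN].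
  - destruct (unstable_near P N d x y HP HN) as [r [Hr H]].
    exists r; split; [assumption|]; intros u v Huv [[? ?] [? ?]]; exact (H u v Huv ltac:(assumption)).
  - destruct (unstable_near_r P N d x y HP HN) as [r [Hr H]].
    exists r; split; [assumption|]; intros u v Huv [[? ?] [? ?]]; exact (H u v Huv ltac:(assumption)).
  - destruct (unstable_near Q N d x y HQ HN) as [r [Hr H]].
    exists r; split; [assumption|]; intros u v Huv [[? ?] [? ?]]; exact (H u v Huv ltac:(assumption)).
  - destruct (unstable_near_r Q N d x y HQ HN) as [r [Hr H]].
    exists r; split; [assumption|]; intros u v Huv [[? ?] [? ?]]; exact (H u v Huv ltac:(assumption)).
Qed.

Definition div_free_at (P Q : R -> R -> R) (x y : R) : Prop :=
  exists p1 p2 q1 q2,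
    is_derive (fun s => P s y) x p1 /\ is_derive (fun s => P x s) y p2 /\
    is_derive (fun s => Q s y) x q1 /\ is_derive (fun s => Q x s) y q2 /\ p1 + q2 = 0.

Lemma flat_exists (P Q : R -> R -> R) (N x y : R) : 0 < N -> div_free_at P Q x y ->
  exists n : nat, flat P Q N ((/ 2) ^ n) x y.
Proof.
  intros HN (p1 & p2 & q1 & q2 & H1 & H2 & H3 & H4 & _).
  destruct (stable_exists _ _ N _ H1 HN) as [n1 S1].
  destruct (stable_exists _ _ N _ H2 HN) as [n2 S2].
  destruct (stable_exists _ _ N _ H3 HN) as [n3 S3].
  destruct (stable_exists _ _ N _ H4 HN) as [n4 S4].
  exists (n1 + n2 + n3 + n4)%nat.
  split; split; (eapply stable_mono; [|eassumption]); apply pow_half_mono; lia.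
Qed.

Definition cross_lip (G : R -> R -> R) (M a b c d x y : R) : Prop :=
  (forall s, a <= s <= b -> Rabs (G s y - G x y) <= M * Rabs (s - x)) /\
  (forall s, c <= s <= d -> Rabs (G x s - G x y) <= M * Rabs (s - y)).

(** The path from [(b, y)] through [(b, yR)], [(a, yR)] and [(a, yL)] to [(a, y)] stays on lines
    through the two cross points: three vertical moves and one horizontal move. *)
Lemma cross_gap (G : R -> R -> R) (M a b c d yL yR : R) : 0 <= M -> a <= b -> c <= d ->
  c <= yL <= d -> cross_lip G M a b c d a yL ->
  c <= yR <= d -> cross_lip G M a b c d b yR ->
  forall y, c <= y <= d -> Rabs (G b y - G a y) <= M * (3 * (d - c) + (b - a)).
Proof.
  intros HM Hab Hcd HL [CL1 CL2] HR [CR1 CR2] y Hy.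
  assert (A1 := CR2 y Hy). assert (A2 := CR1 a ltac:(lra)).
  assert (A3 := CL2 yR HR). assert (A4 := CL2 y Hy).
  assert (D1 : Rabs (y - yR) <= d - c) by (apply Rabs_le; lra).
  assert (D2 : Rabs (a - b) <= b - a) by (apply Rabs_le; lra).
  assert (D3 : Rabs (yR - yL) <= d - c) by (apply Rabs_le; lra).
  assert (D4 : Rabs (y - yL) <= d - c) by (apply Rabs_le; lra).
  apply (Rmult_le_compat_l M) in D1, D2, D3, D4; try assumption.
  replace (G b y - G a y) with ((G b y - G b yR) + - (G a yR - G b yR) +
    (G a yR - G a yL) + - (G a y - G a yL)) by ring.
  eapply Rle_trans; [apply Rabs_plus4|]. rewrite !Rabs_Ropp. lra.
Qed.

Lemma cross_flux (P Q : R -> R -> R) (M a b c d : R) : cont2 P -> cont2 Q -> 0 <= M ->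
  a <= b -> c <= d ->
  (exists y, c <= y <= d /\ cross_lip P M a b c d a y) ->
  (exists y, c <= y <= d /\ cross_lip P M a b c d b y) ->
  (exists x, a <= x <= b /\ cross_lip Q M a b c d x c) ->
  (exists x, a <= x <= b /\ cross_lip Q M a b c d x d) ->
  Rabs (flux P Q a b c d) <=
    M * ((d - c) * (3 * (d - c) + (b - a)) + (b - a) * (3 * (b - a) + (d - c))).
Proof.
  intros HP HQ HM Hab Hcd [yL [L1 L2]] [yR [R1 R2]] [xB [B1 B2]] [xT [T1 T2]].
  eapply Rle_trans; [apply (flux_bound P Q a b c d (M * (3 * (d - c) + (b - a)))
     (M * (3 * (b - a) + (d - c)))); try assumption|].
  - apply (cross_gap P M a b c d yL yR); assumption.
  - intros x Hx.
    assert (Sw : forall x0 y0, cross_lip Q M a b c d x0 y0 ->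
      cross_lip (swap Q) M c d a b y0 x0) by (intros ? ? [? ?]; split; assumption).
    apply (cross_gap (swap Q) M c d a b xB xT); auto.
  - lra.
Qed.

Lemma cont2_sub_linear (P : R -> R -> R) (p1 p2 : R) : cont2 P ->
  cont2 (fun x y => P x y - (p1 * x + p2 * y)).
Proof.
  intros HP x y. apply continuity_2d_pt_minus; [apply HP|].
  apply continuity_2d_pt_plus; apply continuity_2d_pt_mult; try apply continuity_2d_pt_const.
  - apply continuity_2d_pt_id1.
  - apply continuity_2d_pt_id2.
Qed.

(** Here [K] is the exceptional set. Off [K] the field is [good]; the flux out of the hull of [K] is
    at most [42 * (e / 42)] times the area of the cell, by the Lipschitz bounds along the crosses
    through the points of [K] on its sides. *)
Lemma flux_cell (P Q : R -> R -> R) (K : R -> R -> Prop) (e p1 p2 q1 q2 a b c d : R) :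
  cont2 P -> cont2 Q -> 0 < e -> p1 + q2 = 0 -> a <= b -> c <= d ->
  b - a <= 2 * (d - c) -> d - c <= 2 * (b - a) ->
  (forall x y, in_rect a b c d x y -> ~ K x y ->
     good P Q e x y /\ exists r, 0 < r /\ forall u v, near r x y u v -> ~ K u v) ->
  (forall x y, in_rect a b c d x y -> K x y ->
     cross_lip (fun x y => P x y - (p1 * x + p2 * y)) (3 * (e / 42)) a b c d x y /\
     cross_lip (fun x y => Q x y - (q1 * x + q2 * y)) (3 * (e / 42)) a b c d x y) ->
  forall e1, 0 < e1 -> exists L, forall l, (L <= l)%nat ->
    Rabs (flux P Q a b c d) <= e * cell_area K 0 a b c d +
      e * ((b - a) * (d - c) - cell_area K l a b c d) + e1.
Proof.
  intros HP HQ He Hdiv Hab Hcd As1 As2 HG HK e1 He1.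
  destruct (classic (exists x y, in_rect a b c d x y /\ K x y)) as [HE|HE].
  2:{ exists 0%nat; intros l _.
      assert (N : forall x y, in_rect a b c d x y -> ~ K x y)
        by (intros x y ? ?; apply HE; exists x, y; auto).
      rewrite !cell_area_empty by assumption.
      assert (Rabs (flux P Q a b c d) <= e * ((b - a) * (d - c))).
      { apply good_rect; try assumption. intros x y Hxy. apply HG; auto. }
      lra. }
  set (E := fun x y => in_rect a b c d x y /\ K x y).
  (* Used for the four signed coordinates: each side of the hull then carries a point of [K]. *)
  assert (Ext : forall p, cont2 p -> exists x y, E x y /\ forall u v, E u v -> p u v <= p x y).
  { intros p Hp. apply (rect_max E p a b c d).
    - exact HE.
    - intros x y [? ?]; assumption.
    - intros x y Hxy NE. destruct (HG x y Hxy) as [_ [r [Hr H]]].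
      + intros Kxy; apply NE; split; assumption.
      + exists r; split; [assumption|]. intros u v Huv [_ Kuv]. apply (H u v Huv Kuv).
    - intros x y _ e2 He2. destruct (cont2_usc p x y Hp e2 He2) as [r [Hr H]].
      exists r; split; [assumption|]. intros u v _ Huv. specialize (H u v Huv).
      apply Rabs_def2 in H; lra. }
  destruct (Ext (fun x y => - x)) as [a' [yL [[RL KL] ML]]].
  { intros x y; apply continuity_2d_pt_opp, continuity_2d_pt_id1. }
  destruct (Ext (fun x y => x)) as [b' [yR [[RR KR] MR]]].
  { intros x y; apply continuity_2d_pt_id1. }
  destruct (Ext (fun x y => - y)) as [xB [c' [[RB KB] MB]]].
  { intros x y; apply continuity_2d_pt_opp, continuity_2d_pt_id2. }
  destruct (Ext (fun x y => y)) as [xT [d' [[RT KT] MT]]].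
  { intros x y; apply continuity_2d_pt_id2. }
  assert (Hull : forall x y, in_rect a b c d x y -> K x y -> in_rect a' b' c' d' x y).
  { intros x y R1 K1. assert (E1 : E x y) by (split; assumption).
    specialize (ML x y E1); specialize (MR x y E1); specialize (MB x y E1); specialize (MT x y E1).
    split; lra. }
  assert (HL := Hull _ _ RL KL). assert (HR := Hull _ _ RR KR).
  assert (HB := Hull _ _ RB KB). assert (HT := Hull _ _ RT KT).
  destruct HL as [_ HL], HR as [_ HR], HB as [HB _], HT as [HT _].
  assert (a <= a' /\ a' <= b' /\ b' <= b /\ c <= c' /\ c' <= d' /\ d' <= d).
  { destruct RL, RR, RB, RT; repeat split; lra. }
  set (w := b - a). set (h := d - c). set (w' := b' - a'). set (h' := d' - c').
  assert (Hull_flux : Rabs (flux P Q a' b' c' d') <= e * (w * h)).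
  { assert (M : forall x y, in_rect a b c d x y -> K x y ->
      cross_lip (fun x y => P x y - (p1 * x + p2 * y)) (3 * (e / 42)) a' b' c' d' x y /\
      cross_lip (fun x y => Q x y - (q1 * x + q2 * y)) (3 * (e / 42)) a' b' c' d' x y).
    { intros x y R1 K1. destruct (HK x y R1 K1) as [[A1 A2] [A3 A4]].
      repeat split; intros s Hs; [apply A1|apply A2|apply A3|apply A4]; lra. }
    (* The subtracted linear field is the derivative of the field at one point, so its divergence
       [p1 + q2] is 0 and the flux is unchanged. *)
    replace (flux P Q a' b' c' d') with
      (flux (fun x y => P x y - (p1 * x + p2 * y)) (fun x y => Q x y - (q1 * x + q2 * y)) a' b' c' d').
    2:{ rewrite flux_sub_linear by assumption. rewrite Hdiv; ring. }
    eapply Rle_trans.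
    { apply cross_flux with (M := 3 * (e / 42)); try (apply cont2_sub_linear; assumption); try lra.
      - exists yL; split; [lra|]. apply (M a' yL RL KL).
      - exists yR; split; [lra|]. apply (M b' yR RR KR).
      - exists xB; split; [lra|]. apply (M xB c' RB KB).
      - exists xT; split; [lra|]. apply (M xT d' RT KT). }
    fold w'; fold h'.
    assert (0 <= w' <= w /\ 0 <= h' <= h) by (unfold w, w', h, h'; lra).
    assert (w <= 2 * h /\ h <= 2 * w) by (unfold w, h; lra).
    assert (h' * (3 * h' + w') + w' * (3 * w' + h') <= h * (3 * h + w) + w * (3 * w + h)).
    { apply Rplus_le_compat; apply Rmult_le_compat; lra. }
    (* The left side is [3 h^2 + 3 w^2 + 2 w h], and [h^2] and [w^2] are at most [2 w h] by the
       aspect ratio. With the factor 3 of the Lipschitz constant this is the origin of 42. *)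
    assert (h * (3 * h + w) + w * (3 * w + h) <= 14 * (w * h)) by nra.
    replace (e * (w * h)) with (3 * (e / 42) * (14 * (w * h))) by field.
    apply Rmult_le_compat_l; lra. }
  (* From depth [L] on, the content of [K] exceeds the area of its hull by at most [e1 / e]. *)
  destruct (pow_half_small (8 * e * (w * h)) e1 He1) as [L HL'].
  exists L; intros l Hl.
  assert (Hpow := pow_half_mono L l Hl).
  assert (Area : cell_area K l a b c d <= w' * h' + 8 * (w * h) * (/ 2) ^ l).
  { apply cell_area_le; try lra; assumption. }
  assert (Area0 : cell_area K 0 a b c d = w * h).
  { cbn. destruct excluded_middle_informative; [reflexivity|contradiction]. }
  assert (0 <= e * (w * h)).
  { apply Rmult_le_pos; [lra|]. apply Rmult_le_pos; unfold w, h; lra. }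
  assert (Sm : e * (8 * (w * h) * (/ 2) ^ l) <= e1).
  { apply Rle_trans with (8 * e * (w * h) * (/ 2) ^ L); [|lra].
    replace (e * (8 * (w * h) * (/ 2) ^ l)) with (8 * (e * (w * h)) * (/ 2) ^ l) by ring.
    replace (8 * e * (w * h) * (/ 2) ^ L) with (8 * (e * (w * h)) * (/ 2) ^ L) by ring.
    apply Rmult_le_compat_l; lra. }
  apply (Rmult_le_compat_l e) in Area; [|lra].
  rewrite Area0.
  assert (Off : forall x y, in_rect a b c d x y -> ~ in_rect a' b' c' d' x y -> good P Q e x y).
  { intros x y R1 N. apply HG; [assumption|]. intros K1; apply N, Hull; assumption. }
  (* Four rectangles around the hull, with interiors free of [K]; their areas add up to
     [w * h - w' * h']. *)
  rewrite (flux_split_x P Q a a' b c d HP HQ), (flux_split_x P Q a' b' b c d HP HQ),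
    (flux_split_y P Q a' b' c c' d HP HQ), (flux_split_y P Q a' b' c' d' d HP HQ).
  assert (F1 : Rabs (flux P Q a a' c d) <= e * ((a' - a) * (d - c))).
  { apply good_interior; try assumption; try lra. intros x y ? ?; apply Off; [split; lra|].
    intros [? ?]; lra. }
  assert (F2 : Rabs (flux P Q b' b c d) <= e * ((b - b') * (d - c))).
  { apply good_interior; try assumption; try lra. intros x y ? ?; apply Off; [split; lra|].
    intros [? ?]; lra. }
  assert (F3 : Rabs (flux P Q a' b' c c') <= e * ((b' - a') * (c' - c))).
  { apply good_interior; try assumption; try lra. intros x y ? ?; apply Off; [split; lra|].
    intros [? ?]; lra. }
  assert (F4 : Rabs (flux P Q a' b' d' d) <= e * ((b' - a') * (d - d'))).
  { apply good_interior; try assumption; try lra. intros x y ? ?; apply Off; [split; lra|].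
    intros [? ?]; lra. }
  set (f1 := flux P Q a a' c d) in *. set (f2 := flux P Q b' b c d) in *.
  set (f3 := flux P Q a' b' c c') in *. set (f4 := flux P Q a' b' d' d) in *.
  set (f0 := flux P Q a' b' c' d') in *.
  replace (f1 + (f3 + (f0 + f4) + f2)) with (f1 + f2 + f3 + f4 + f0) by ring.
  eapply Rle_trans; [apply Rabs_triang|].
  assert (F := Rabs_plus4 f1 f2 f3 f4).
  assert (e * ((a' - a) * (d - c)) + e * ((b - b') * (d - c)) + e * ((b' - a') * (c' - c)) +
          e * ((b' - a') * (d - d')) = e * (w * h - w' * h')) by (unfold w, h, w', h'; ring).
  lra.
Qed.

Theorem looman_menchoff_flux (P Q : R -> R -> R) (O : R -> R -> Prop) (a b c d : R) :
  cont2 P -> cont2 Q ->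
  (forall x y, O x y -> exists r, 0 < r /\ forall u v, near r x y u v -> O u v) ->
  (forall x y, O x y -> div_free_at P Q x y) ->
  a <= b -> c <= d -> (forall x y, in_rect a b c d x y -> O x y) ->
  flux P Q a b c d = 0.
Proof.
  intros HP HQ HO HD Hab Hcd HR.
  (* Goodness for every [e] bounds the flux by arbitrarily small multiples of the area. *)
  enough (G : forall e, 0 < e -> forall x y, O x y -> good P Q e x y).
  { assert (0 <= (b - a) * (d - c)) by (apply Rmult_le_pos; lra).
    set (A := (b - a) * (d - c)) in *.
    apply Rabs_eq_0, Rle_antisym; [|apply Rabs_pos].
    apply Rle_plus_epsilon; intros e He. rewrite Rplus_0_l.
    assert (He' : 0 < e / (A + 1)) by (apply Rdiv_lt_0_compat; lra).
    assert (B := good_rect P Q (e / (A + 1)) a b c d HP HQ Hab Hcd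
      (fun x y H => G _ He' x y (HR x y H))). fold A in B.
    eapply Rle_trans; [exact B|]. apply (Rmult_le_reg_r (A + 1)); [lra|].
    replace (e / (A + 1) * A * (A + 1)) with (e * A) by (field; lra). nra. }
  intros e He xs ys Os. apply NNPP; intros NG.
  set (K := fun x y => O x y /\ ~ good P Q e x y).
  assert (Kcl : forall x y, O x y -> ~ K x y ->
    exists r, 0 < r /\ forall u v, near r x y u v -> ~ K u v).
  { intros x y Oxy NK. destruct (good_near P Q e x y) as [r [Hr H]].
    - apply NNPP; intros N; apply NK; split; assumption.
    - exists r; split; [assumption|]. intros u v Huv [_ N]; apply N, H, Huv. }
  assert (HN : 0 < e / 42) by lra.
  destruct (HO xs ys Os) as [rs [Hrs HOs]].
  assert (Box : forall x y, in_rect (xs - rs / 2) (xs + rs / 2) (ys - rs / 2) (ys + rs / 2) x y ->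
    O x y).
  { intros x y [? ?]; apply HOs; split; apply Rabs_def1; lra. }
  (* Every point of [K] is flat at some scale [(/ 2) ^ n]; Baire makes one scale serve a whole
     neighbourhood in [K] of some point. That point will turn out to be good, a contradiction. *)
  destruct (baire_closed K (fun n => flat P Q (e / 42) ((/ 2) ^ n)) xs ys (rs / 2))
    as [n [x0 [y0 [r [[O0 NG0] [Hr Hflat]]]]]].
  - split; assumption.
  - lra.
  - intros x y Hxy; apply Kcl, Box, Hxy.
  - intros n x y; apply not_flat_near; assumption.
  - intros x y _ [Oxy _]. apply flat_exists; [assumption|]. apply HD, Oxy.
  - apply NG0. destruct (HD x0 y0 O0) as (p1 & p2 & q1 & q2 & D1 & D2 & D3 & D4 & D5).
    set (dl := (/ 2) ^ n) in *.
    assert (Hdl : 0 < dl) by (apply pow_lt; lra).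
    destruct (HO x0 y0 O0) as [r2 [Hr2 HO2]].
    (* The four quotients with step [dl / 2] are continuous in the point: this supplies the middle
       comparison of [stable_lip]. *)
    destruct (cont2_usc _ x0 y0 (cont2_dq P (dl / 2) HP) (e / 42) HN) as [s1 [Hs1 U1]].
    destruct (cont2_usc _ y0 x0 (cont2_dq (swap P) (dl / 2) (cont2_swap P HP)) (e / 42) HN)
      as [s2 [Hs2 U2]].
    destruct (cont2_usc _ x0 y0 (cont2_dq Q (dl / 2) HQ) (e / 42) HN) as [s3 [Hs3 U3]].
    destruct (cont2_usc _ y0 x0 (cont2_dq (swap Q) (dl / 2) (cont2_swap Q HQ)) (e / 42) HN)
      as [s4 [Hs4 U4]].
    (* The condition [2 * rho < dl] keeps any two points of the box within the step range of
       [stable_lip]. *)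
    assert (Hrho : exists rho, 0 < rho /\ rho < r /\ rho < r2 /\ rho < s1 /\ rho < s2 /\ rho < s3 /\
      rho < s4 /\ 2 * rho < dl).
    { exists (Rmin (Rmin (Rmin r r2) (Rmin s1 s2)) (Rmin (Rmin s3 s4) (dl / 2)) / 2).
      set (m := Rmin (Rmin (Rmin r r2) (Rmin s1 s2)) (Rmin (Rmin s3 s4) (dl / 2))).
      assert (0 < m) by (unfold m; repeat apply Rmin_glb_lt; lra).
      generalize (Rmin_l (Rmin (Rmin r r2) (Rmin s1 s2)) (Rmin (Rmin s3 s4) (dl / 2)))
        (Rmin_r (Rmin (Rmin r r2) (Rmin s1 s2)) (Rmin (Rmin s3 s4) (dl / 2)))
        (Rmin_l (Rmin r r2) (Rmin s1 s2)) (Rmin_r (Rmin r r2) (Rmin s1 s2))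
        (Rmin_l (Rmin s3 s4) (dl / 2)) (Rmin_r (Rmin s3 s4) (dl / 2))
        (Rmin_l r r2) (Rmin_r r r2) (Rmin_l s1 s2) (Rmin_r s1 s2) (Rmin_l s3 s4) (Rmin_r s3 s4).
      fold m. intros. lra. }
    destruct Hrho as [rho [H0 [H1 [H2 [H3 [H4 [H5 [H6 H7]]]]]]]].
    assert (F0 : flat P Q (e / 42) dl x0 y0).
    { apply Hflat; [split; rewrite Rminus_diag, Rabs_R0; assumption|split; assumption]. }
    exists rho; split; [assumption|]. intros a1 b1 c1 d1 Hab1 Hcd1 Ha1 Hb1 Hc1 Hd1.
    apply flux_all_aspects; try assumption.
    intros a2 b2 c2 d2 Ha2 Hab2 Hb2 Hc2 Hcd2 Hd2 As1 As2.
    apply (flux_le_of_cells P Q K); try assumption; try lra.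
    intros a3 b3 c3 d3 Ha3 Hab3 Hb3 Hc3 Hcd3 Hd3 As3 As4.
    assert (In : forall x y, in_rect a3 b3 c3 d3 x y -> Rabs (x - x0) <= rho /\ Rabs (y - y0) <= rho).
    { intros x y [? ?]; split; apply Rabs_le; lra. }
    assert (InO : forall x y, in_rect a3 b3 c3 d3 x y -> O x y).
    { intros x y Hxy; apply HO2; destruct (In x y Hxy); split; lra. }
    apply (flux_cell P Q K e p1 p2 q1 q2); try assumption.
    + intros x y Hxy NK; split; [|apply Kcl; auto].
      apply NNPP; intros N; apply NK; split; auto.
    + intros x y Hxy Kxy.
      destruct (In x y Hxy) as [Nx Ny].
      assert (Fxy : flat P Q (e / 42) dl x y) by (apply Hflat; [split; lra|assumption]).
      destruct F0 as [[F1 F2] [F3 F4]]. destruct Fxy as [[G1 G2] [G3 G4]].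
      destruct Hxy as [Hx Hy].
      split; split; intros s Hs.
      * replace (P s y - (p1 * s + p2 * y) - (P x y - (p1 * x + p2 * y)))
          with (P s y - P x y - p1 * (s - x)) by ring.
        apply (stable_lip (fun s => P s y) (fun s => P s y0) x x0 p1 (e / 42) dl); try assumption.
        -- apply Rlt_le, (U1 x y); split; lra.
        -- apply Rabs_def1; lra.
      * replace (P x s - (p1 * x + p2 * s) - (P x y - (p1 * x + p2 * y)))
          with (P x s - P x y - p2 * (s - y)) by ring.
        apply (stable_lip (fun s => P x s) (fun s => P x0 s) y y0 p2 (e / 42) dl); try assumption.
        -- apply Rlt_le, (U2 y x); split; lra.
        -- apply Rabs_def1; lra.
      * replace (Q s y - (q1 * s + q2 * y) - (Q x y - (q1 * x + q2 * y)))
          with (Q s y - Q x y - q1 * (s - x)) by ring.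
        apply (stable_lip (fun s => Q s y) (fun s => Q s y0) x x0 q1 (e / 42) dl); try assumption.
        -- apply Rlt_le, (U3 x y); split; lra.
        -- apply Rabs_def1; lra.
      * replace (Q x s - (q1 * x + q2 * s) - (Q x y - (q1 * x + q2 * y)))
          with (Q x s - Q x y - q2 * (s - y)) by ring.
        apply (stable_lip (fun s => Q x s) (fun s => Q x0 s) y y0 q2 (e / 42) dl); try assumption.
        -- apply Rlt_le, (U4 y x); split; lra.
        -- apply Rabs_def1; lra.
Qed.

(** * Harmonic approximation and the local maximum principle *)

Definition hint (d : R) (w : R -> R -> R) (x y : R) : R := RInt (fun s => w s y) x (x + d).
Definition vint (d : R) (w : R -> R -> R) (x y : R) : R := RInt (fun t => w x t) y (y + d).

Lemma ex_RInt_l (w : R -> R -> R) (y a b : R) : cont2 w -> ex_RInt (fun s => w s y) a b.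
Proof.
  intros H. apply (ex_RInt_continuous (V := R_CompleteNormedModule)); intros z _.
  apply (cont2_l w y z H).
Qed.

Lemma ex_RInt_r (w : R -> R -> R) (x a b : R) : cont2 w -> ex_RInt (fun s => w x s) a b.
Proof. intros H. apply (ex_RInt_l (swap w) x a b (cont2_swap w H)). Qed.

Lemma hint_shift (d : R) (w : R -> R -> R) (x y : R) : cont2 w ->
  hint d w x y = RInt (fun s => w (s + x) y) 0 d.
Proof.
  intros H. unfold hint. symmetry.
  assert (E : RInt (fun s => w s y) (1 * 0 + x) (1 * d + x) = RInt (fun s => w s y) x (x + d)).
  { f_equal; ring. }
  rewrite <- E, <- (RInt_comp_lin (V := R_CompleteNormedModule)) by (apply ex_RInt_l, H).
  apply (RInt_ext (V := R_CompleteNormedModule)); intros.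
  unfold scal; cbn; unfold mult; cbn. rewrite !Rmult_1_l; reflexivity.
Qed.

Lemma cont2_hint (d : R) (w : R -> R -> R) : 0 < d -> cont2 w -> cont2 (hint d w).
Proof.
  intros Hd Hw x y e.
  assert (He : 0 < e / (2 * d)) by (apply Rdiv_lt_0_compat; [apply cond_pos|lra]).
  destruct (cont2_unif w (x - 1) (x + d + 1) (y - 1) (y + 1) _ Hw He) as [r [Hr H]].
  assert (Hr1 : 0 < Rmin r 1) by (apply Rmin_glb_lt; lra).
  exists (mkposreal _ Hr1). intros u v Hu Hv. cbn [pos] in Hu, Hv.
  generalize (Rmin_l r 1) (Rmin_r r 1); intros.
  apply Rabs_def2 in Hu; apply Rabs_def2 in Hv.
  rewrite !hint_shift by assumption.
  rewrite <- (RInt_minus (V := R_CompleteNormedModule)).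
  - apply Rle_lt_trans with ((d - 0) * (e / (2 * d))).
    + apply abs_RInt_le_const; [lra| |].
      * apply (ex_RInt_minus (V := R_NormedModule)).
        -- apply ex_RInt_ext with (fun s => w (s + u) (v + 0)).
           { intros; rewrite Rplus_0_r; reflexivity. }
           apply (ex_RInt_l (fun s y => w (s + u) (y + 0)) v), cont2_shift, Hw.
        -- apply ex_RInt_ext with (fun s => w (s + x) (y + 0)).
           { intros; rewrite Rplus_0_r; reflexivity. }
           apply (ex_RInt_l (fun s y => w (s + x) (y + 0)) y), cont2_shift, Hw.
      * intros t Ht. apply Rlt_le. apply (H (t + x) y (t + u) v).
        -- split; lra.
        -- split; lra.
        -- split; apply Rabs_def1; lra.
    + replace ((d - 0) * (e / (2 * d))) with (e / 2) by (field; lra).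
      generalize (cond_pos e); lra.
  - apply ex_RInt_ext with (fun s => w (s + u) (v + 0)).
    { intros; rewrite Rplus_0_r; reflexivity. }
    apply (ex_RInt_l (fun s y => w (s + u) (y + 0)) v), cont2_shift, Hw.
  - apply ex_RInt_ext with (fun s => w (s + x) (y + 0)).
    { intros; rewrite Rplus_0_r; reflexivity. }
    apply (ex_RInt_l (fun s y => w (s + x) (y + 0)) y), cont2_shift, Hw.
Qed.

Lemma cont2_vint (d : R) (w : R -> R -> R) : 0 < d -> cont2 w -> cont2 (vint d w).
Proof.
  intros Hd Hw. apply (cont2_swap (hint d (swap w))), cont2_hint, cont2_swap; assumption.
Qed.

Lemma hint_dx (d : R) (w : R -> R -> R) (x y : R) : cont2 w ->
  is_derive (fun x => hint d w x y) x (w (x + d) y - w x y).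
Proof.
  intros Hw.
  apply is_derive_ext with
    (fun z => RInt (fun s => w s y) 0 (z + d) - RInt (fun s => w s y) 0 z).
  { intros z. unfold hint.
    rewrite <- (RInt_Chasles (V := R_CompleteNormedModule) _ 0 z (z + d)) by (apply ex_RInt_l, Hw).
    unfold plus; cbn; ring. }
  assert (D : forall z, is_derive (fun b => RInt (fun s => w s y) 0 b) z (w z y)).
  { intros z. apply (is_derive_RInt (V := R_NormedModule) (fun s => w s y) _ 0).
    - apply filter_forall; intros b. apply (RInt_correct (V := R_CompleteNormedModule)), ex_RInt_l, Hw.
    - apply (cont2_l w y z Hw). }
  apply (is_derive_minus (V := R_NormedModule)); [|apply D].
  replace (w (x + d) y) with (1 * w (x + d) y) by ring.
  apply (is_derive_comp (V := R_NormedModule) (fun b => RInt (fun s => w s y) 0 b)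
    (fun z => z + d)); [apply D|].
  auto_derive; [exact I|ring].
Qed.

Lemma hint_dy (d : R) (w wy : R -> R -> R) (x y : R) : cont2 w -> cont2 wy ->
  (forall x y, is_derive (fun t => w x t) y (wy x y)) ->
  is_derive (fun y => hint d w x y) y (hint d wy x y).
Proof.
  intros Hw Hwy HD. unfold hint.
  replace (RInt (fun s => wy s y) x (x + d)) with
    (RInt (fun s => Derive (fun t => w s t) y) x (x + d)).
  2:{ apply (RInt_ext (V := R_CompleteNormedModule)); intros; apply is_derive_unique, HD. }
  apply (is_derive_RInt_param (fun t s => w s t) x (x + d) y).
  - apply filter_forall; intros t s _. exists (wy s t); apply HD.
  - intros t _. apply continuity_2d_pt_ext with (swap wy).
    + intros a b. symmetry. apply is_derive_unique, HD.
    + apply cont2_swap, Hwy.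
  - apply filter_forall; intros t. apply (ex_RInt_l w t), Hw.
Qed.

Lemma vint_dy (d : R) (w : R -> R -> R) (x y : R) : cont2 w ->
  is_derive (fun y => vint d w x y) y (w x (y + d) - w x y).
Proof. intros Hw. exact (hint_dx d (swap w) y x (cont2_swap w Hw)). Qed.

Lemma vint_dx (d : R) (w wx : R -> R -> R) (x y : R) : cont2 w -> cont2 wx ->
  (forall x y, is_derive (fun t => w t y) x (wx x y)) ->
  is_derive (fun x => vint d w x y) x (vint d wx x y).
Proof.
  intros Hw Hwx HD.
  exact (hint_dy d (swap w) (swap wx) y x (cont2_swap w Hw) (cont2_swap wx Hwx)
    (fun x y => HD y x)).
Qed.

(** Not normalised: one averaging contributes a factor [d ^ 2], divided out in [harmonic_approx]. *)
Definition avg (d : R) (u : R -> R -> R) : R -> R -> R := hint d (vint d u).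
(** [avg_x] and [avg_y] are the partial derivatives of [avg], written as increments of
    one-dimensional integrals. They are continuous, and together they are what [flux] computes on a
    square. *)
Definition avg_x (d : R) (u : R -> R -> R) (x y : R) : R := vint d u (x + d) y - vint d u x y.
Definition avg_y (d : R) (u : R -> R -> R) (x y : R) : R := hint d u x (y + d) - hint d u x y.

Lemma cont2_shift_l (w : R -> R -> R) (d : R) : cont2 w -> cont2 (fun x y => w (x + d) y).
Proof.
  intros H x y. apply continuity_2d_pt_ext with (fun x y => w (x + d) (y + 0)).
  - intros; rewrite Rplus_0_r; reflexivity.
  - apply (cont2_shift w d 0 H).
Qed.

Lemma cont2_shift_r (w : R -> R -> R) (d : R) : cont2 w -> cont2 (fun x y => w x (y + d)).
Proof. intros H. exact (cont2_swap _ (cont2_shift_l (swap w) d (cont2_swap w H))). Qed.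

Lemma cont2_minus (f g : R -> R -> R) : cont2 f -> cont2 g -> cont2 (fun x y => f x y - g x y).
Proof. intros Hf Hg x y; apply continuity_2d_pt_minus; [apply Hf|apply Hg]. Qed.

Lemma cont2_avg (d : R) (u : R -> R -> R) : 0 < d -> cont2 u -> cont2 (avg d u).
Proof. intros; apply cont2_hint, cont2_vint; assumption. Qed.

Lemma cont2_avg_x (d : R) (u : R -> R -> R) : 0 < d -> cont2 u -> cont2 (avg_x d u).
Proof.
  intros Hd Hu; apply cont2_minus; [apply cont2_shift_l|]; apply cont2_vint; assumption.
Qed.

Lemma cont2_avg_y (d : R) (u : R -> R -> R) : 0 < d -> cont2 u -> cont2 (avg_y d u).
Proof.
  intros Hd Hu; apply cont2_minus; [apply cont2_shift_r|]; apply cont2_hint; assumption.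
Qed.

Lemma avg_dx (d : R) (u : R -> R -> R) (x y : R) : 0 < d -> cont2 u ->
  is_derive (fun s => avg d u s y) x (avg_x d u x y).
Proof. intros Hd Hu. apply (hint_dx d (vint d u)), cont2_vint; assumption. Qed.

Lemma hint_minus (d : R) (f g : R -> R -> R) (x y : R) : cont2 f -> cont2 g ->
  hint d (fun x y => f x y - g x y) x y = hint d f x y - hint d g x y.
Proof.
  intros Hf Hg. apply (RInt_minus (V := R_CompleteNormedModule)); apply ex_RInt_l; assumption.
Qed.

Lemma avg_dy (d : R) (u : R -> R -> R) (x y : R) : 0 < d -> cont2 u ->
  is_derive (fun t => avg d u x t) y (avg_y d u x y).
Proof.
  intros Hd Hu.
  replace (avg_y d u x y) with (hint d (fun x y => u x (y + d) - u x y) x y).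
  - apply hint_dy.
    + apply cont2_vint; assumption.
    + apply cont2_minus; [apply cont2_shift_r|]; assumption.
    + intros; apply vint_dy; assumption.
  - apply (hint_minus d (fun x y => u x (y + d)) u); [apply cont2_shift_r|]; assumption.
Qed.

Lemma vint_of_dy (d : R) (g gy : R -> R -> R) (x y : R) : cont2 gy ->
  (forall x y, is_derive (fun t => g x t) y (gy x y)) ->
  vint d gy x y = g x (y + d) - g x y.
Proof.
  intros Hgy HD. apply is_RInt_unique.
  apply (is_RInt_derive (V := R_CompleteNormedModule)); intros; [apply HD|apply cont2_r, Hgy].
Qed.

Lemma hint_of_dx (d : R) (g gx : R -> R -> R) (x y : R) : cont2 gx ->
  (forall x y, is_derive (fun t => g t y) x (gx x y)) ->
  hint d gx x y = g (x + d) y - g x y.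
Proof.
  intros Hgx HD. exact (vint_of_dy d (swap g) (swap gx) y x (cont2_swap gx Hgx)
    (fun x y => HD y x)).
Qed.

(** The shared numbers [p] and [q] encode [u_x = v_y] and [u_y = - v_x]; only partial derivatives
    are required, not differentiability. *)
Definition cauchy_riemann_at (u v : R -> R -> R) (x y : R) : Prop :=
  exists p q, is_derive (fun s => u s y) x p /\ is_derive (fun s => u x s) y q /\
    is_derive (fun s => v s y) x (- q) /\ is_derive (fun s => v x s) y p.

(** Multiplication of [u + i v] by [- i]; it lets results about the real part apply to [v]. *)
Lemma cauchy_riemann_rot (u v : R -> R -> R) (x y : R) : cauchy_riemann_at u v x y ->
  cauchy_riemann_at v (fun x y => - u x y) x y.
Proof.
  intros (p & q & H1 & H2 & H3 & H4). exists (- q), p. split; [|split; [|split]]; try assumption.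
  - apply (is_derive_opp (V := R_NormedModule) (fun s => u s y)), H1.
  - apply (is_derive_opp (V := R_NormedModule) (fun s => u x s)), H2.
Qed.

Lemma cont2_opp (u : R -> R -> R) : cont2 u -> cont2 (fun x y => - u x y).
Proof. intros H x y; apply continuity_2d_pt_opp, H. Qed.

(** The two equations are the vanishing of the fluxes of [(u, - v)] and [(v, u)] out of the square,
    that is, Cauchy's theorem for the real and imaginary parts. *)
Lemma avg_cauchy_riemann (u v : R -> R -> R) (O : R -> R -> Prop) (d x y : R) :
  cont2 u -> cont2 v -> 0 < d ->
  (forall x y, O x y -> exists r, 0 < r /\ forall a b, near r x y a b -> O a b) ->
  (forall x y, O x y -> cauchy_riemann_at u v x y) ->
  (forall a b, in_rect x (x + d) y (y + d) a b -> O a b) ->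
  avg_x d u x y = avg_y d v x y /\ avg_y d u x y = - avg_x d v x y.
Proof.
  intros Hu Hv Hd HO HCR HR.
  assert (Hop : forall f, cont2 f -> RInt (fun t => f (x + d) t - f x t) y (y + d) = avg_x d f x y).
  { intros f Hf. apply (RInt_minus (V := R_CompleteNormedModule)); apply ex_RInt_r; assumption. }
  assert (Hoq : forall f, cont2 f -> RInt (fun t => f t (y + d) - f t y) x (x + d) = avg_y d f x y).
  { intros f Hf. apply (RInt_minus (V := R_CompleteNormedModule)); apply ex_RInt_l; assumption. }
  assert (F1 : flux u (fun x y => - v x y) x (x + d) y (y + d) = 0).
  { apply looman_menchoff_flux with O; try assumption; try lra.
    - apply cont2_opp, Hv.
    - intros a b Hab. destruct (HCR a b Hab) as (p & q & H1 & H2 & H3 & H4).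
      exists p, q, (- - q), (- p). split; [|split; [|split; [|split]]]; try assumption; try lra.
      + apply (is_derive_opp (V := R_NormedModule) (fun s => v s b)), H3.
      + apply (is_derive_opp (V := R_NormedModule) (fun s => v a s)), H4. }
  assert (F2 : flux v u x (x + d) y (y + d) = 0).
  { apply looman_menchoff_flux with O; try assumption; try lra.
    intros a b Hab. destruct (HCR a b Hab) as (p & q & H1 & H2 & H3 & H4).
    exists (- q), p, p, q. split; [|split; [|split; [|split]]]; try assumption; lra. }
  unfold flux in F1, F2.
  rewrite (Hop u Hu), (Hoq (fun x y => - v x y)) in F1 by (apply cont2_opp, Hv).
  rewrite (Hop v Hv), (Hoq u Hu) in F2.
  assert (E : avg_y d (fun x y => - v x y) x y = - avg_y d v x y).
  { unfold avg_y, hint.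
    rewrite !(RInt_opp (V := R_CompleteNormedModule) (fun s => v s _)) by (apply ex_RInt_l, Hv).
    unfold opp; cbn; ring. }
  rewrite E in F1. lra.
Qed.

(** Since [avg_x d u] equals the [y]-derivative of [avg d v], its integral in [y] is an increment of
    [avg d v]; similarly for [avg_y d u] in [x], with the opposite sign. Both terms are then the
    same mixed second difference of [avg d v] over the corners of the square, up to sign. Two
    averagings look ahead by [2 * d]. *)
Lemma avg_avg_harmonic (u v : R -> R -> R) (O : R -> R -> Prop) (d x y : R) :
  cont2 u -> cont2 v -> 0 < d ->
  (forall x y, O x y -> exists r, 0 < r /\ forall a b, near r x y a b -> O a b) ->
  (forall x y, O x y -> cauchy_riemann_at u v x y) ->
  (forall a b, in_rect x (x + 2 * d) y (y + 2 * d) a b -> O a b) ->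
  avg_x d (avg_x d u) x y + avg_y d (avg_y d u) x y = 0.
Proof.
  intros Hu Hv Hd HO HCR HR.
  assert (CR : forall a b, in_rect x (x + d) y (y + d) a b ->
    avg_x d u a b = avg_y d v a b /\ avg_y d u a b = - avg_x d v a b).
  { intros a b [? ?]. apply avg_cauchy_riemann with O; try assumption. intros a' b' [? ?].
      apply HR; split; lra. }
  assert (V : forall X, X = x \/ X = x + d ->
    vint d (avg_x d u) X y = avg d v X (y + d) - avg d v X y).
  { intros X HX. rewrite <- (vint_of_dy d (avg d v) (avg_y d v)).
    - apply (RInt_ext (V := R_CompleteNormedModule)). intros t Ht.
      rewrite Rmin_left, Rmax_right in Ht by lra.
      destruct (CR X t) as [E _]; [split; lra|exact E].
    - apply cont2_avg_y; assumption.
    - intros; apply avg_dy; assumption. }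
  assert (H : forall Y, Y = y \/ Y = y + d ->
    hint d (avg_y d u) x Y = - (avg d v (x + d) Y - avg d v x Y)).
  { intros Y HY. rewrite <- (hint_of_dx d (avg d v) (avg_x d v)).
    - unfold hint. rewrite <- (RInt_opp (V := R_CompleteNormedModule))
        by (apply (ex_RInt_l (avg_x d v)), cont2_avg_x; assumption).
      apply (RInt_ext (V := R_CompleteNormedModule)). intros t Ht.
      rewrite Rmin_left, Rmax_right in Ht by lra.
      destruct (CR t Y) as [_ E]; [split; lra|exact E].
    - apply cont2_avg_x; assumption.
    - intros; apply avg_dx; assumption. }
  unfold avg_x at 1, avg_y at 1.
  rewrite !V, !H by tauto. ring.
Qed.

Lemma avg_avg_dxx (d : R) (u : R -> R -> R) (x y : R) : 0 < d -> cont2 u ->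
  is_derive (fun s => avg_x d (avg d u) s y) x (avg_x d (avg_x d u) x y).
Proof.
  intros Hd Hu.
  assert (D : forall x, is_derive (fun s => vint d (avg d u) s y) x (vint d (avg_x d u) x y)).
  { intros z; apply vint_dx; [apply cont2_avg|apply cont2_avg_x|]; try assumption.
    intros; apply avg_dx; assumption. }
  apply (is_derive_minus (V := R_NormedModule)); [|apply D].
  replace (vint d (avg_x d u) (x + d) y) with (1 * vint d (avg_x d u) (x + d) y) by ring.
  apply (is_derive_comp (V := R_NormedModule) (fun s => vint d (avg d u) s y)
    (fun z => z + d)); [apply D|].
  auto_derive; [exact I|ring].
Qed.

Lemma avg_avg_dyy (d : R) (u : R -> R -> R) (x y : R) : 0 < d -> cont2 u ->
  is_derive (fun s => avg_y d (avg d u) x s) y (avg_y d (avg_y d u) x y).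
Proof.
  intros Hd Hu.
  assert (D : forall y, is_derive (fun s => hint d (avg d u) x s) y (hint d (avg_y d u) x y)).
  { intros z; apply hint_dy; [apply cont2_avg|apply cont2_avg_y|]; try assumption.
    intros; apply avg_dy; assumption. }
  apply (is_derive_minus (V := R_NormedModule)); [|apply D].
  replace (hint d (avg_y d u) x (y + d)) with (1 * hint d (avg_y d u) x (y + d)) by ring.
  apply (is_derive_comp (V := R_NormedModule) (fun s => hint d (avg d u) x s)
    (fun z => z + d)); [apply D|].
  auto_derive; [exact I|ring].
Qed.

Lemma avg_approx (d : R) (u : R -> R -> R) (x y m e : R) : 0 < d -> cont2 u ->
  (forall s t, in_rect x (x + d) y (y + d) s t -> Rabs (u s t - m) <= e) ->
  Rabs (avg d u x y - m * d ^ 2) <= e * d ^ 2.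
Proof.
  intros Hd Hu H.
  assert (V : forall s, x <= s <= x + d -> Rabs (vint d u s y - m * d) <= e * d).
  { intros s Hs.
    assert (E : vint d u s y - m * d = RInt (fun t => u s t - m) y (y + d)).
    { symmetry. unfold vint. rewrite (RInt_minus (V := R_CompleteNormedModule) (fun t => u s t)
        (fun _ => m)).
      - rewrite RInt_const. unfold minus, plus, opp, scal; cbn; unfold mult; cbn; ring.
      - apply ex_RInt_r, Hu.
      - apply ex_RInt_const. }
    rewrite E. replace (e * d) with ((y + d - y) * e) by ring.
    apply abs_RInt_le_const; [lra| |].
    - apply (ex_RInt_minus (V := R_NormedModule)); [apply ex_RInt_r, Hu|apply ex_RInt_const].
    - intros t Ht. apply H; split; lra. }
  assert (E : avg d u x y - m * d ^ 2 = RInt (fun s => vint d u s y - m * d) x (x + d)).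
  { symmetry. unfold avg, hint.
    rewrite (RInt_minus (V := R_CompleteNormedModule) (fun s => vint d u s y) (fun _ => m * d)).
    - rewrite RInt_const. unfold minus, plus, opp, scal; cbn; unfold mult; cbn; ring.
    - apply (ex_RInt_l (vint d u)), cont2_vint; assumption.
    - apply ex_RInt_const. }
  rewrite E. replace (e * d ^ 2) with ((x + d - x) * (e * d)) by ring.
  apply abs_RInt_le_const; [lra| |].
  - apply (ex_RInt_minus (V := R_NormedModule)); [|apply ex_RInt_const].
    apply (ex_RInt_l (vint d u)), cont2_vint; assumption.
  - intros s Hs; apply V; lra.
Qed.

(** The derivatives exist on the whole plane; the Laplace equation is required on the rectangle
    only. *)
Definition harmonic_on (U : R -> R -> R) (a b c d : R) : Prop :=
  cont2 U /\ exists Ux Uy Uxx Uyy : R -> R -> R, forall x y,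
    is_derive (fun s => U s y) x (Ux x y) /\ is_derive (fun s => U x s) y (Uy x y) /\
    is_derive (fun s => Ux s y) x (Uxx x y) /\ is_derive (fun s => Uy x s) y (Uyy x y) /\
    (in_rect a b c d x y -> Uxx x y + Uyy x y = 0).

(** The averages extend to the right and upwards, hence a margin [m] on those two sides only. *)
Lemma harmonic_approx (u v : R -> R -> R) (O : R -> R -> Prop) (a b c d m e : R) :
  cont2 u -> cont2 v ->
  (forall x y, O x y -> exists r, 0 < r /\ forall a b, near r x y a b -> O a b) ->
  (forall x y, O x y -> cauchy_riemann_at u v x y) ->
  0 < m -> (forall x y, in_rect a (b + m) c (d + m) x y -> O x y) -> 0 < e ->
  exists U, harmonic_on U a b c d /\
    forall x y, in_rect a b c d x y -> Rabs (U x y - u x y) <= e.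
Proof.
  intros Hu Hv HO HCR Hm HR He.
  destruct (cont2_unif u a (b + m) c (d + m) e Hu He) as [r [Hr Hun]].
  (* Two averagings reach [2 * l], which must stay within the margin and within the modulus of
     continuity [r]. *)
  set (l := Rmin (m / 2) (r / 4)).
  assert (Hl : 0 < l) by (apply Rmin_glb_lt; lra).
  assert (l <= m / 2 /\ l <= r / 4) by (split; [apply Rmin_l|apply Rmin_r]).
  assert (Hl4 : 0 < l ^ 2 * l ^ 2) by (apply Rmult_lt_0_compat; apply pow_lt; assumption).
  set (k := / (l ^ 2 * l ^ 2)).
  exists (fun x y => k * avg l (avg l u) x y). split; [split|].
  - intros x y. apply continuity_2d_pt_mult; [apply continuity_2d_pt_const|].
    apply cont2_avg; [assumption|apply cont2_avg; assumption].
  - exists (fun x y => k * avg_x l (avg l u) x y), (fun x y => k * avg_y l (avg l u) x y),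
      (fun x y => k * avg_x l (avg_x l u) x y), (fun x y => k * avg_y l (avg_y l u) x y).
    intros x y.
    assert (Hau : cont2 (avg l u)) by (apply cont2_avg; assumption).
    split; [|split; [|split; [|split]]].
    + apply (is_derive_scal (fun s => avg l (avg l u) s y)), avg_dx; assumption.
    + apply (is_derive_scal (fun s => avg l (avg l u) x s)), avg_dy; assumption.
    + apply (is_derive_scal (fun s => avg_x l (avg l u) s y)), avg_avg_dxx; assumption.
    + apply (is_derive_scal (fun s => avg_y l (avg l u) x s)), avg_avg_dyy; assumption.
    + intros [? ?]. rewrite <- Rmult_plus_distr_l.
      rewrite (avg_avg_harmonic u v O l); try assumption; [ring|].
      intros a' b' [? ?]; apply HR; split; lra.
  - intros x y [? ?].
    assert (A : Rabs (avg l (avg l u) x y - u x y * l ^ 2 * l ^ 2) <= e * l ^ 2 * l ^ 2).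
    { apply avg_approx; [assumption|apply cont2_avg; assumption|].
      intros s t [? ?]. apply avg_approx; try assumption. intros s' t' [? ?].
      apply Rlt_le, Hun; [split; lra|split; lra|]. split; apply Rabs_def1; lra. }
    replace (k * avg l (avg l u) x y - u x y) with
      (k * (avg l (avg l u) x y - u x y * l ^ 2 * l ^ 2)) by (unfold k; field; lra).
    assert (0 < k) by (apply Rinv_0_lt_compat; assumption).
    rewrite Rabs_mult, (Rabs_right k) by lra.
    apply (Rmult_le_compat_l k) in A; [|lra].
    replace (k * (e * l ^ 2 * l ^ 2)) with e in A by (unfold k; field; lra). exact A.
Qed.

(** * Exclusion of local maxima *)

Lemma second_derivative_max (h h1 : R -> R) (h2 t0 r : R) : 0 < r ->
  (forall t, is_derive h t (h1 t)) -> is_derive h1 t0 h2 ->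
  (forall t, Rabs (t - t0) < r -> h t <= h t0) -> h2 <= 0.
Proof.
  intros Hr D1 D2 Hmax. apply Rnot_lt_le; intros Hpos.
  assert (Z : h1 t0 = 0).
  { assert (pr : derivable_pt h t0) by (exists (h1 t0); apply is_derive_Reals, D1).
    rewrite <- (deriv_maximum h (t0 - r) (t0 + r) t0 pr); try lra.
    - symmetry. apply derive_pt_eq_0, is_derive_Reals, D1.
    - intros x ? ?. apply Hmax, Rabs_def1; lra. }
  apply is_derive_Reals in D2. destruct (D2 (h2 / 2)) as [s Hs]; [lra|].
  set (k := Rmin (s / 2) (r / 2)).
  assert (0 < k) by (apply Rmin_glb_lt; [generalize (cond_pos s)|]; lra).
  assert (k < s) by (generalize (Rmin_l (s / 2) (r / 2)) (cond_pos s); unfold k; lra).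
  assert (k < r) by (generalize (Rmin_r (s / 2) (r / 2)); unfold k; lra).
  destruct (MVT_cor2 h h1 t0 (t0 + k)) as [z [Hz1 Hz2]]; [lra| |].
  { intros; apply is_derive_Reals, D1. }
  assert (M := Hmax (t0 + k) ltac:(apply Rabs_def1; lra)).
  assert (A := Hs (z - t0) ltac:(lra) ltac:(apply Rabs_def1; lra)).
  replace (t0 + (z - t0)) with z in A by ring. rewrite Z in A.
  apply Rabs_def2 in A.
  assert (B : 0 < h1 z).
  { assert (C : h2 / 2 < (h1 z - 0) / (z - t0)) by lra.
    apply (Rmult_lt_compat_r (z - t0)) in C; [|lra].
    replace ((h1 z - 0) / (z - t0) * (z - t0)) with (h1 z) in C by (field; lra).
    assert (0 < h2 / 2 * (z - t0)) by (apply Rmult_lt_0_compat; lra). lra. }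
  assert (0 < h1 z * (t0 + k - t0)) by (apply Rmult_lt_0_compat; lra). lra.
Qed.

(** The Laplacian of the left side is [2 |grad U|^2 + 2 |grad V|^2 + 4 eta - 2 eta], which is
    positive, while at a maximum both pure second derivatives are at most 0. The term with weight
    [eta] is what pays for the subtracted paraboloid. *)
Lemma harmonic_no_max (U V : R -> R -> R) (a b c d p1 p2 q1 q2 eta r : R) :
  harmonic_on U a b c d -> harmonic_on V a b c d -> in_rect a b c d q1 q2 ->
  0 < eta -> 0 < r ->
  ~ (forall x y, near r q1 q2 x y ->
       U x y ^ 2 + V x y ^ 2 + eta * (x ^ 2 + y ^ 2) - eta / 2 * ((x - p1) ^ 2 + (y - p2) ^ 2) <=
       U q1 q2 ^ 2 + V q1 q2 ^ 2 + eta * (q1 ^ 2 + q2 ^ 2)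
         - eta / 2 * ((q1 - p1) ^ 2 + (q2 - p2) ^ 2)).
Proof.
  intros [_ (Ux & Uy & Uxx & Uyy & HU)] [_ (Vx & Vy & Vxx & Vyy & HV)] Hq He Hr Hmax.
  assert (X : 2 * (Ux q1 q2 ^ 2 + U q1 q2 * Uxx q1 q2) + 2 * (Vx q1 q2 ^ 2 + V q1 q2 * Vxx q1 q2)
     + eta * 2 - eta <= 0).
  { apply (second_derivative_max
      (fun x => U x q2 ^ 2 + V x q2 ^ 2 + eta * (x ^ 2 + q2 ^ 2)
         - eta / 2 * ((x - p1) ^ 2 + (q2 - p2) ^ 2))
      (fun x => 2 * (U x q2 * Ux x q2) + 2 * (V x q2 * Vx x q2) + eta * (2 * x) - eta * (x - p1))
      _ q1 r Hr).
    - intros t. destruct (HU t q2) as [D1 _]. destruct (HV t q2) as [E1 _].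
      auto_derive.
      + repeat split; eexists; eassumption.
      + rewrite (is_derive_unique (fun x : R => U x q2) _ _ D1),
          (is_derive_unique (fun x : R => V x q2) _ _ E1). field.
    - destruct (HU q1 q2) as (D1 & _ & D2 & _). destruct (HV q1 q2) as (E1 & _ & E2 & _).
      auto_derive.
      + repeat split; eexists; eassumption.
      + rewrite (is_derive_unique (fun x : R => U x q2) _ _ D1),
          (is_derive_unique (fun x : R => V x q2) _ _ E1),
          (is_derive_unique (fun x : R => Ux x q2) _ _ D2),
              (is_derive_unique (fun x : R => Vx x q2) _ _ E2). ring.
    - intros t Ht. apply (Hmax t q2). split; [assumption|]. rewrite Rminus_diag, Rabs_R0; assumption. }
  assert (Y : 2 * (Uy q1 q2 ^ 2 + U q1 q2 * Uyy q1 q2) + 2 * (Vy q1 q2 ^ 2 + V q1 q2 * Vyy q1 q2)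
     + eta * 2 - eta <= 0).
  { apply (second_derivative_max
      (fun y => U q1 y ^ 2 + V q1 y ^ 2 + eta * (q1 ^ 2 + y ^ 2)
         - eta / 2 * ((q1 - p1) ^ 2 + (y - p2) ^ 2))
      (fun y => 2 * (U q1 y * Uy q1 y) + 2 * (V q1 y * Vy q1 y) + eta * (2 * y) - eta * (y - p2))
      _ q2 r Hr).
    - intros t. destruct (HU q1 t) as (_ & D1 & _). destruct (HV q1 t) as (_ & E1 & _).
      auto_derive.
      + repeat split; eexists; eassumption.
      + rewrite (is_derive_unique (fun y : R => U q1 y) _ _ D1),
          (is_derive_unique (fun y : R => V q1 y) _ _ E1). field.
    - destruct (HU q1 q2) as (_ & D1 & _ & D2 & _). destruct (HV q1 q2) as (_ & E1 & _ & E2 & _).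
      auto_derive.
      + repeat split; eexists; eassumption.
      + rewrite (is_derive_unique (fun y : R => U q1 y) _ _ D1),
          (is_derive_unique (fun y : R => V q1 y) _ _ E1),
          (is_derive_unique (fun y : R => Uy q1 y) _ _ D2),
              (is_derive_unique (fun y : R => Vy q1 y) _ _ E2). ring.
    - intros t Ht. apply (Hmax q1 t). split; [|assumption]. rewrite Rminus_diag, Rabs_R0; assumption. }
  destruct (HU q1 q2) as (_ & _ & _ & _ & LU). destruct (HV q1 q2) as (_ & _ & _ & _ & LV).
  specialize (LU Hq); specialize (LV Hq).
  assert (Uyy q1 q2 = - Uxx q1 q2) by lra. assert (Vyy q1 q2 = - Vxx q1 q2) by lra.
  rewrite H, H0 in *.
  generalize (pow2_ge_0 (Ux q1 q2)) (pow2_ge_0 (Vx q1 q2)) (pow2_ge_0 (Uy q1 q2))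
    (pow2_ge_0 (Vy q1 q2)); lra.
Qed.

(** Nearest point of [[m - r, m + r]]. Composition with it turns a function continuous near a point
    into one continuous on the plane, unchanged near that point. *)
Definition clamp (m r x : R) : R := Rmax (m - r) (Rmin x (m + r)).

Lemma clamp_in (m r x : R) : 0 < r -> m - r <= clamp m r x <= m + r.
Proof.
  intros. unfold clamp, Rmax, Rmin. repeat destruct Rle_dec; lra.
Qed.

Lemma clamp_id (m r x : R) : m - r <= x <= m + r -> clamp m r x = x.
Proof.
  intros. unfold clamp, Rmax, Rmin. repeat destruct Rle_dec; lra.
Qed.

Lemma clamp_lip (m r x y d : R) : 0 < r -> Rabs (x - y) < d -> Rabs (clamp m r x - clamp m r y) < d.
Proof.
  intros Hr H. apply Rabs_def2 in H.
  apply Rabs_def1; unfold clamp, Rmax, Rmin; repeat destruct Rle_dec; lra.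
Qed.

Lemma clamp_cont2 (u : R -> R -> R) (p1 p2 r : R) : 0 < r ->
  (forall x y, near (2 * r) p1 p2 x y -> continuity_2d_pt u x y) ->
  cont2 (fun x y => u (clamp p1 r x) (clamp p2 r y)).
Proof.
  intros Hr Hu x y e.
  destruct (Hu (clamp p1 r x) (clamp p2 r y)) with (eps := e) as [d Hd].
  - generalize (clamp_in p1 r x Hr) (clamp_in p2 r y Hr); intros.
    split; apply Rabs_def1; lra.
  - exists d; intros a b Ha Hb; apply Hd; apply clamp_lip; assumption.
Qed.

(** Subtracting [eta / 2 * |z - p|^2] makes the maximum strict on the boundary of a small square,
    so it survives the replacement of [u], [v] by nearby harmonic functions. *)
Theorem cauchy_riemann_no_max (u v : R -> R -> R) (p1 p2 r eta : R) : 0 < r -> 0 < eta ->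
  (forall x y, near r p1 p2 x y ->
     continuity_2d_pt u x y /\ continuity_2d_pt v x y /\ cauchy_riemann_at u v x y) ->
  ~ (forall x y, near r p1 p2 x y ->
       u x y ^ 2 + v x y ^ 2 + eta * (x ^ 2 + y ^ 2) <=
       u p1 p2 ^ 2 + v p1 p2 ^ 2 + eta * (p1 ^ 2 + p2 ^ 2)).
Proof.
  intros Hr He Huv Hmax.
  (* Clamping is the identity up to [r1]; the comparison square has half side [r2], and
     [r2 + r / 8 < r1] leaves room for the averages. *)
  set (r1 := r / 2). set (r2 := r / 4).
  set (u' := fun x y => u (clamp p1 r1 x) (clamp p2 r1 y)).
  set (v' := fun x y => v (clamp p1 r1 x) (clamp p2 r1 y)).
  assert (Cu : cont2 u').
  { apply clamp_cont2; [unfold r1; lra|]. intros; apply Huv.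
    unfold r1 in *; replace (2 * (r / 2)) with r in * by field; assumption. }
  assert (Cv : cont2 v').
  { apply clamp_cont2; [unfold r1; lra|]. intros; apply Huv.
    unfold r1 in *; replace (2 * (r / 2)) with r in * by field; assumption. }
  assert (Eq : forall f x y, near r1 p1 p2 x y -> f (clamp p1 r1 x) (clamp p2 r1 y) = f x y :> R).
  { intros f x y [Hx Hy]. apply Rabs_def2 in Hx; apply Rabs_def2 in Hy.
    rewrite !clamp_id by lra. reflexivity. }
  set (O := near r1 p1 p2).
  assert (HO : forall x y, O x y -> exists q, 0 < q /\ forall a b, near q x y a b -> O a b).
  { intros x y [Hx Hy].
    exists (Rmin (r1 - Rabs (x - p1)) (r1 - Rabs (y - p2))). split.
    - apply Rmin_glb_lt; lra.
    - intros a b [Ha Hb].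
      generalize (Rmin_l (r1 - Rabs (x - p1)) (r1 - Rabs (y - p2)))
        (Rmin_r (r1 - Rabs (x - p1)) (r1 - Rabs (y - p2))); intros.
      split.
      + replace (a - p1) with ((a - x) + (x - p1)) by ring.
        eapply Rle_lt_trans; [apply Rabs_triang|]; lra.
      + replace (b - p2) with ((b - y) + (y - p2)) by ring.
        eapply Rle_lt_trans; [apply Rabs_triang|]; lra. }
  assert (HCR : forall x y, O x y -> cauchy_riemann_at u' v' x y).
  { intros x y Oxy.
    assert (N : near r p1 p2 x y) by (destruct Oxy; split; unfold r1 in *; lra).
    destruct (Huv x y N) as [_ [_ (p & q & H1 & H2 & H3 & H4)]].
    destruct (HO x y Oxy) as [rho [Hrho HB]].
    assert (N0 : forall z, Rabs (z - z) < rho) by (intros; rewrite Rminus_diag, Rabs_R0; assumption).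
    exists p, q; split; [|split; [|split]].
    - apply is_derive_ext_loc with (fun s => u s y); [|assumption].
      exists (mkposreal _ Hrho); intros s Hs; symmetry. apply (Eq u). apply HB; split; auto.
    - apply is_derive_ext_loc with (fun s => u x s); [|assumption].
      exists (mkposreal _ Hrho); intros s Hs; symmetry. apply (Eq u). apply HB; split; auto.
    - apply is_derive_ext_loc with (fun s => v s y); [|assumption].
      exists (mkposreal _ Hrho); intros s Hs; symmetry. apply (Eq v). apply HB; split; auto.
    - apply is_derive_ext_loc with (fun s => v x s); [|assumption].
      exists (mkposreal _ Hrho); intros s Hs; symmetry. apply (Eq v). apply HB; split; auto. }
  set (a := p1 - r2). set (b := p1 + r2). set (c := p2 - r2). set (d := p2 + r2).
  assert (HR : forall x y, in_rect a (b + r / 8) c (d + r / 8) x y -> O x y).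
  { unfold a, b, c, d, r2. intros x y [? ?]; split; apply Rabs_def1; unfold r1; lra. }
  destruct (cont2_bounded u' a b c d Cu) as [M1 [HM1 B1]].
  destruct (cont2_bounded v' a b c d Cv) as [M2 [HM2 B2]].
  (* Least value of the subtracted paraboloid on the boundary of the square. Each approximated
     square contributes an error [g / 8], so two points compared cost at most [g / 2]. *)
  set (g := eta / 2 * r2 ^ 2).
  assert (Hg : 0 < g).
  { unfold g. apply Rmult_lt_0_compat; [lra|]. apply pow_lt; unfold r2; lra. }
  assert (App : forall M, 0 < M -> exists e, 0 < e /\ forall U w, Rabs w <= M -> Rabs (U - w) <= e ->
    Rabs (U ^ 2 - w ^ 2) <= g / 8).
  { intros M HM. exists (Rmin 1 (g / (8 * (2 * M + 1)))). split.
    { apply Rmin_glb_lt; [lra|]. apply Rdiv_lt_0_compat; lra. }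
    intros U w Hw HU.
    assert (L1 : Rabs (U - w) <= 1) by (eapply Rle_trans; [exact HU|apply Rmin_l]).
    assert (L2 : Rabs (U - w) <= g / (8 * (2 * M + 1))) by (eapply Rle_trans; [exact HU|apply Rmin_r]).
    replace (U ^ 2 - w ^ 2) with ((U - w) * (U - w + 2 * w)) by ring.
    rewrite Rabs_mult.
    assert (L3 : Rabs (U - w + 2 * w) <= 2 * M + 1).
    { eapply Rle_trans; [apply Rabs_triang|]. rewrite Rabs_mult, (Rabs_right 2) by lra. lra. }
    apply Rle_trans with (g / (8 * (2 * M + 1)) * (2 * M + 1)).
    - apply Rmult_le_compat; try apply Rabs_pos; assumption.
    - right; field; lra. }
  destruct (App M1 HM1) as [e1 [He1 A1]]. destruct (App M2 HM2) as [e2 [He2 A2]].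
  destruct (harmonic_approx u' v' O a b c d (r / 8) e1) as [U [HU AU]]; try assumption; try lra.
  destruct (harmonic_approx v' (fun x y => - u' x y) O a b c d (r / 8) e2) as [V [HV AV]];
    try assumption; try lra.
  { apply cont2_opp, Cu. }
  { intros x y Oxy; apply cauchy_riemann_rot, HCR, Oxy. }
  set (f := fun x y => U x y ^ 2 + V x y ^ 2 + eta * (x ^ 2 + y ^ 2)
     - eta / 2 * ((x - p1) ^ 2 + (y - p2) ^ 2)).
  assert (Hr2 : 0 < r2) by (unfold r2; lra).
  assert (Cf : cont2 f).
  { assert (S : forall h, cont2 h -> cont2 (fun x y => h x y ^ 2)).
    { intros h Hh x y. apply continuity_2d_pt_ext with (fun x y => h x y * h x y).
      - intros; ring.
      - apply continuity_2d_pt_mult; apply Hh. }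
    intros x y. unfold f.
    apply continuity_2d_pt_minus; [apply continuity_2d_pt_plus; [apply continuity_2d_pt_plus|]|].
    - apply (S U), HU.
    - apply (S V), HV.
    - apply continuity_2d_pt_mult; [apply continuity_2d_pt_const|].
      apply continuity_2d_pt_plus.
      + apply (S (fun x y => x)). intros ? ?; apply continuity_2d_pt_id1.
      + apply (S (fun x y => y)). intros ? ?; apply continuity_2d_pt_id2.
    - apply continuity_2d_pt_mult; [apply continuity_2d_pt_const|].
      apply continuity_2d_pt_plus.
      + apply (S (fun x y => x - p1)). intros ? ?; apply continuity_2d_pt_minus;
          [apply continuity_2d_pt_id1|apply continuity_2d_pt_const].
      + apply (S (fun x y => y - p2)). intros ? ?; apply continuity_2d_pt_minus;
          [apply continuity_2d_pt_id2|apply continuity_2d_pt_const]. }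
  destruct (rect_max (in_rect a b c d) f a b c d) as [q1 [q2 [Hq Hmaxf]]].
  { exists p1, p2; unfold a, b, c, d; split; lra. }
  { auto. }
  { intros; contradiction. }
  { intros x y _ e He'. destruct (cont2_usc f x y Cf e He') as [rho [? H]].
    exists rho; split; [assumption|]. intros s t _ Hst. specialize (H s t Hst).
    apply Rabs_def2 in H; lra. }
  assert (Close : forall x y, in_rect a b c d x y ->
    Rabs (f x y - (u x y ^ 2 + v x y ^ 2 + eta * (x ^ 2 + y ^ 2)
      - eta / 2 * ((x - p1) ^ 2 + (y - p2) ^ 2))) <= g / 4).
  { intros x y Hxy.
    assert (N : near r1 p1 p2 x y).
    { destruct Hxy; unfold a, b, c, d, r2, r1 in *; split; apply Rabs_def1; lra. }
    assert (D1 := A1 (U x y) (u' x y) (B1 x y Hxy) (AU x y Hxy)).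
    assert (D2 := A2 (V x y) (v' x y) (B2 x y Hxy) (AV x y Hxy)).
    unfold u' in D1; unfold v' in D2. rewrite (Eq u x y N) in D1. rewrite (Eq v x y N) in D2.
    unfold f.
    match goal with |- Rabs ?z <= _ =>
      replace z with ((U x y ^ 2 - u x y ^ 2) + (V x y ^ 2 - v x y ^ 2)) by ring end.
    eapply Rle_trans; [apply Rabs_triang|]. lra. }
  assert (Hp : in_rect a b c d p1 p2) by (unfold a, b, c, d; split; lra).
  assert (Int : a < q1 < b /\ c < q2 < d).
  { apply NNPP; intros HB.
    assert (Far : r2 ^ 2 <= (q1 - p1) ^ 2 + (q2 - p2) ^ 2).
    { assert (Side : q1 - p1 = - r2 \/ q1 - p1 = r2 \/ q2 - p2 = - r2 \/ q2 - p2 = r2).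
      { destruct Hq. unfold a, b, c, d in *.
        destruct (Req_dec q1 (p1 - r2)); [left; lra|].
        destruct (Req_dec q1 (p1 + r2)); [right; left; lra|].
        destruct (Req_dec q2 (p2 - r2)); [right; right; left; lra|].
        destruct (Req_dec q2 (p2 + r2)); [right; right; right; lra|].
        exfalso; apply HB; lra. }
      generalize (pow2_ge_0 (q1 - p1)) (pow2_ge_0 (q2 - p2)); intros.
      destruct Side as [S|[S|[S|S]]]; rewrite S in *; lra. }
    assert (C1 := Close p1 p2 Hp). assert (C2 := Close q1 q2 Hq).
    apply Rabs_le_between in C1; apply Rabs_le_between in C2.
    assert (M := Hmaxf p1 p2 Hp).
    assert (N : near r p1 p2 q1 q2).
    { destruct Hq; unfold a, b, c, d, r2 in *; split; apply Rabs_def1; lra. }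
    specialize (Hmax q1 q2 N).
    assert (g <= eta / 2 * ((q1 - p1) ^ 2 + (q2 - p2) ^ 2)) by (apply Rmult_le_compat_l; lra).
    replace ((p1 - p1) ^ 2 + (p2 - p2) ^ 2) with 0 in C1 by ring.
    lra. }
  apply (harmonic_no_max U V a b c d p1 p2 q1 q2 eta
    (Rmin (Rmin (q1 - a) (b - q1)) (Rmin (q2 - c) (d - q2)))); try assumption.
  - repeat apply Rmin_glb_lt; lra.
  - intros x y [Hx Hy].
    set (z := Rmin (Rmin (q1 - a) (b - q1)) (Rmin (q2 - c) (d - q2))) in *.
    assert (z <= q1 - a /\ z <= b - q1 /\ z <= q2 - c /\ z <= d - q2).
    { unfold z; repeat split;
       first [eapply Rle_trans; [apply Rmin_l|]; first [apply Rmin_l|apply Rmin_r]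
             |eapply Rle_trans; [apply Rmin_r|]; first [apply Rmin_l|apply Rmin_r]]. }
    apply Rabs_def2 in Hx; apply Rabs_def2 in Hy.
    apply (Hmaxf x y). split; lra.
Qed.

(** * The maximum principle in polar coordinates *)

(** [px] and [py] are the real and imaginary parts of [exp (s + i (z + t))]: [s] is the logarithm of
    the radius, [t] the angle measured from the direction [z]. *)
Definition px (z s t : R) : R := exp s * cos (z + t).
Definition py (z s t : R) : R := exp s * sin (z + t).

Definition radius (x y : R) : R := sqrt (x ^ 2 + y ^ 2).
Definition log_radius (x y : R) : R := ln (x ^ 2 + y ^ 2) / 2.
(** Cartesian coordinates after rotation by [- z], which turns the direction [z] into the positive
    real axis. The slit plane is then the set [0 < radius x y + rot_x z x y]. *)
Definition rot_x (z x y : R) : R := x * cos z + y * sin z.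
Definition rot_y (z x y : R) : R := y * cos z - x * sin z.

(** Half-angle formula: a single expression for the argument relative to [z],
    valid on the whole plane slit along the direction opposite to [z]. *)
Definition angle (z x y : R) : R := 2 * atan (rot_y z x y / (radius x y + rot_x z x y)).

Lemma cos_sin_sq (z : R) : cos z ^ 2 + sin z ^ 2 = 1.
Proof. generalize (sin2_cos2 z); unfold Rsqr; nra. Qed.

Lemma polar_sq (z s t : R) : px z s t ^ 2 + py z s t ^ 2 = exp s ^ 2.
Proof.
  unfold px, py. generalize (cos_sin_sq (z + t)); intros H.
  replace ((exp s * cos (z + t)) ^ 2 + (exp s * sin (z + t)) ^ 2) with
    (exp s ^ 2 * (cos (z + t) ^ 2 + sin (z + t) ^ 2)) by ring.
  rewrite H; ring.
Qed.

Lemma radius_polar (z s t : R) : radius (px z s t) (py z s t) = exp s.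
Proof. unfold radius. rewrite polar_sq. apply sqrt_pow2, Rlt_le, exp_pos. Qed.

Lemma log_radius_polar (z s t : R) : log_radius (px z s t) (py z s t) = s.
Proof.
  unfold log_radius. rewrite polar_sq. replace (exp s ^ 2) with (exp (s + s)).
  - rewrite ln_exp; field.
  - rewrite exp_plus; ring.
Qed.

Lemma rot_x_polar (z s t : R) : rot_x z (px z s t) (py z s t) = exp s * cos t.
Proof.
  unfold rot_x, px, py. replace t with (z + t - z) at 3 by ring.
  rewrite (cos_minus (z + t) z). ring.
Qed.

Lemma rot_y_polar (z s t : R) : rot_y z (px z s t) (py z s t) = exp s * sin t.
Proof.
  unfold rot_y, px, py. replace t with (z + t - z) at 3 by ring.
  rewrite (sin_minus (z + t) z). ring.
Qed.

Lemma one_plus_cos (t : R) : 1 + cos t = 2 * cos (t / 2) ^ 2.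
Proof.
  replace t with (2 * (t / 2)) at 1 by field. rewrite cos_2a_cos. ring.
Qed.

Lemma cos_half_pos (t : R) : Rabs t < PI -> 0 < cos (t / 2).
Proof. intros H. apply Rabs_def2 in H. apply cos_gt_0; lra. Qed.

Lemma slit_polar (z s t : R) : Rabs t < PI ->
  0 < radius (px z s t) (py z s t) + rot_x z (px z s t) (py z s t).
Proof.
  intros H. rewrite radius_polar, rot_x_polar.
  replace (exp s + exp s * cos t) with (exp s * (1 + cos t)) by ring.
  rewrite one_plus_cos. generalize (cos_half_pos t H) (exp_pos s); intros.
  apply Rmult_lt_0_compat; [assumption|]. apply Rmult_lt_0_compat; [lra|]. apply pow_lt; assumption.
Qed.

Lemma angle_polar (z s t : R) : Rabs t < PI -> angle z (px z s t) (py z s t) = t.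
Proof.
  intros H. unfold angle. rewrite radius_polar, rot_x_polar, rot_y_polar.
  assert (C := cos_half_pos t H).
  replace (exp s * sin t / (exp s + exp s * cos t)) with (tan (t / 2)).
  - apply Rabs_def2 in H. rewrite atan_tan by lra. field.
  - replace (exp s + exp s * cos t) with (exp s * (1 + cos t)) by ring.
    rewrite one_plus_cos. replace (sin t) with (2 * sin (t / 2) * cos (t / 2)).
    + unfold tan. generalize (exp_pos s); intros. field. split; lra.
    + rewrite <- sin_2a. f_equal; field.
Qed.

Lemma radius_sq (x y : R) : radius x y ^ 2 = x ^ 2 + y ^ 2.
Proof.
  unfold radius. apply pow2_sqrt.
  generalize (pow2_ge_0 x) (pow2_ge_0 y); lra.
Qed.

Lemma radius_pos (z x y : R) : 0 < radius x y + rot_x z x y -> 0 < radius x y /\ 0 < x ^ 2 + y ^ 2.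
Proof.
  intros H. assert (0 <= radius x y) by apply sqrt_pos.
  assert (Hne : radius x y <> 0).
  { intros E. assert (S := radius_sq x y). rewrite E in S.
    generalize (pow2_ge_0 x) (pow2_ge_0 y); intros.
    assert (x = 0) by nra. assert (y = 0) by nra. unfold rot_x in H; subst. lra. }
  split; [lra|]. rewrite <- radius_sq. apply pow_lt; lra.
Qed.

Lemma rot_sq (z x y : R) : rot_x z x y ^ 2 + rot_y z x y ^ 2 = radius x y ^ 2.
Proof.
  rewrite radius_sq. unfold rot_x, rot_y. generalize (cos_sin_sq z); intros H.
  replace ((x * cos z + y * sin z) ^ 2 + (y * cos z - x * sin z) ^ 2) with
    ((x ^ 2 + y ^ 2) * (cos z ^ 2 + sin z ^ 2)) by ring.
  rewrite H; ring.
Qed.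

Lemma half_angle_sq (z x y : R) : 0 < radius x y + rot_x z x y ->
  1 + (rot_y z x y / (radius x y + rot_x z x y)) ^ 2 =
  2 * radius x y / (radius x y + rot_x z x y).
Proof.
  intros H. assert (E := rot_sq z x y).
  set (q := radius x y) in *. set (X := rot_x z x y) in *. set (Y := rot_y z x y) in *.
  apply (Rmult_eq_reg_r ((q + X) ^ 2)); [|apply pow_nonzero; lra].
  replace ((1 + (Y / (q + X)) ^ 2) * (q + X) ^ 2) with ((q + X) ^ 2 + Y ^ 2) by (field; lra).
  replace (2 * q / (q + X) * (q + X) ^ 2) with (2 * q * (q + X)) by (field; lra).
  nra.
Qed.

Lemma cos_sin_atan (q : R) :
  cos (2 * atan q) = (1 - q ^ 2) / (1 + q ^ 2) /\ sin (2 * atan q) = 2 * q / (1 + q ^ 2).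
Proof.
  assert (C : cos (atan q) <> 0).
  { destruct (atan_bound q). apply Rgt_not_eq, cos_gt_0; lra. }
  assert (T : sin (atan q) = q * cos (atan q)).
  { rewrite <- (tan_atan q) at 2. unfold tan. field. exact C. }
  assert (S := cos_sin_sq (atan q)). rewrite T in S.
  assert (Hq : 0 < 1 + q ^ 2) by (generalize (pow2_ge_0 q); lra).
  rewrite cos_2a, sin_2a, T.
  assert (E : cos (atan q) ^ 2 = / (1 + q ^ 2)).
  { apply (Rmult_eq_reg_r (1 + q ^ 2)); [|lra]. rewrite Rinv_l by lra. lra. }
  split.
  - replace (cos (atan q) * cos (atan q) - q * cos (atan q) * (q * cos (atan q))) with
      (cos (atan q) ^ 2 * (1 - q ^ 2)) by ring. rewrite E. field; lra.
  - replace (2 * (q * cos (atan q)) * cos (atan q)) with (cos (atan q) ^ 2 * (2 * q)) by ring.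
    rewrite E. field; lra.
Qed.

Lemma cos_sin_angle (z x y : R) : 0 < radius x y + rot_x z x y ->
  radius x y * cos (angle z x y) = rot_x z x y /\ radius x y * sin (angle z x y) = rot_y z x y.
Proof.
  intros H. destruct (radius_pos z x y H) as [Hr _].
  unfold angle. assert (S := half_angle_sq z x y H). assert (E := rot_sq z x y).
  set (q := rot_y z x y / (radius x y + rot_x z x y)) in *.
  destruct (cos_sin_atan q) as [-> ->].
  assert (Q : rot_y z x y = q * (radius x y + rot_x z x y)) by (unfold q; field; lra).
  assert (N : 1 - q ^ 2 = 2 - 2 * radius x y / (radius x y + rot_x z x y)) by lra.
  rewrite N, S. set (r := radius x y) in *. set (X := rot_x z x y) in *.
  split; [field; lra|]. rewrite Q. field; lra.
Qed.

Lemma exp_log_radius (x y : R) : 0 < x ^ 2 + y ^ 2 -> exp (log_radius x y) = radius x y.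
Proof.
  intros H. unfold log_radius, radius. rewrite <- Rpower_sqrt by assumption.
  unfold Rpower. f_equal; field.
Qed.

Lemma polar_of_cartesian (z x y : R) : 0 < radius x y + rot_x z x y ->
  px z (log_radius x y) (angle z x y) = x /\ py z (log_radius x y) (angle z x y) = y.
Proof.
  intros H. destruct (radius_pos z x y H) as [Hr Hxy].
  destruct (cos_sin_angle z x y H) as [C S].
  unfold px, py. rewrite exp_log_radius by assumption. rewrite cos_plus, sin_plus.
  assert (T := cos_sin_sq z).
  split.
  - replace (radius x y * (cos z * cos (angle z x y) - sin z * sin (angle z x y))) with
      (cos z * (radius x y * cos (angle z x y)) - sin z * (radius x y * sin (angle z x y))) by ring.
    rewrite C, S. unfold rot_x, rot_y.
    replace (cos z * (x * cos z + y * sin z) - sin z * (y * cos z - x * sin z)) with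
      (x * (cos z ^ 2 + sin z ^ 2)) by ring. rewrite T; ring.
  - replace (radius x y * (sin z * cos (angle z x y) + cos z * sin (angle z x y))) with
      (sin z * (radius x y * cos (angle z x y)) + cos z * (radius x y * sin (angle z x y))) by ring.
    rewrite C, S. unfold rot_x, rot_y.
    replace (sin z * (x * cos z + y * sin z) + cos z * (y * cos z - x * sin z)) with
      (y * (cos z ^ 2 + sin z ^ 2)) by ring. rewrite T; ring.
Qed.

(** The derivative is [2 (k' (r + X) - Y (g' + h'))] divided by [(r + X)^2 (1 + (Y / (r + X))^2)],
    and the half-angle identity turns this denominator into [2 r (r + X)]. Both partial derivatives
    of [angle] are instances. *)
Lemma is_derive_half_angle (g h k : R -> R) (t g' h' k' r X Y l : R) :
  is_derive g t g' -> is_derive h t h' -> is_derive k t k' ->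
  r = g t -> X = h t -> Y = k t -> 0 < r + X -> 0 < r ->
  1 + (Y / (r + X)) ^ 2 = 2 * r / (r + X) ->
  k' * (r + X) - Y * (g' + h') = l * (r * (r + X)) ->
  is_derive (fun s => 2 * atan (k s / (g s + h s))) t l.
Proof.
  intros Dg Dh Dk -> -> -> H1 H2 H3 H4.
  auto_derive.
  - repeat split; try lra; eexists; eassumption.
  - rewrite (is_derive_unique (fun s : R => g s) _ _ Dg), (is_derive_unique (fun s : R => h s) _ _ Dh),
      (is_derive_unique (fun s : R => k s) _ _ Dk).
    replace (1 + k t * / (g t + h t) * (k t * / (g t + h t) * 1)) with
      (1 + (k t / (g t + h t)) ^ 2) by (unfold Rdiv; ring).
    rewrite H3.
    apply (Rmult_eq_reg_r (g t * (g t + h t))); [|apply Rgt_not_eq, Rmult_lt_0_compat; assumption].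
    rewrite <- H4. field. lra.
Qed.

(** The pair is a branch of the complex logarithm up to a constant; the derivatives are the
    components of [1 / (x + i y)]. *)
Lemma polar_cauchy_riemann (z x y : R) : 0 < radius x y + rot_x z x y ->
  cauchy_riemann_at log_radius (angle z) x y.
Proof.
  intros H. destruct (radius_pos z x y H) as [Hr Hxy].
  assert (S := half_angle_sq z x y H). assert (T := cos_sin_sq z). assert (Q := radius_sq x y).
  set (r := radius x y) in *.
  assert (Id : x * rot_y z x y - y * rot_x z x y = - (sin z * r ^ 2)).
  { rewrite Q. unfold rot_x, rot_y. ring. }
  assert (Id2 : x * rot_x z x y + y * rot_y z x y = cos z * r ^ 2).
  { rewrite Q. unfold rot_x, rot_y. ring. }
  exists (x / r ^ 2), (y / r ^ 2). split; [|split; [|split]].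
  - unfold log_radius. rewrite Q. auto_derive; [lra|field; lra].
  - unfold log_radius. rewrite Q. auto_derive; [lra|field; lra].
  - apply (is_derive_half_angle (fun s => radius s y) (fun s => rot_x z s y) (fun s => rot_y z s y)
      x (x / r) (cos z) (- sin z) r (rot_x z x y) (rot_y z x y)); try reflexivity; try assumption.
    + unfold radius. auto_derive; [lra|]. fold (radius x y).
      replace (x * (x * 1) + y * (y * 1)) with (x ^ 2 + y ^ 2) by ring. fold (radius x y) r. field; lra.
    + unfold rot_x. auto_derive; [exact I|ring].
    + unfold rot_y. auto_derive; [exact I|ring].
    + set (X := rot_x z x y) in *. set (Y := rot_y z x y) in *.
      assert (EY : y = X * sin z + Y * cos z).
      { unfold X, Y, rot_x, rot_y. replace ((x * cos z + y * sin z) * sin z + (y * cos z - x * sin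
          z) * cos z)
          with (y * (cos z ^ 2 + sin z ^ 2)) by ring. rewrite T; ring. }
      apply (Rmult_eq_reg_r r); [|lra].
      replace ((- sin z * (r + X) - Y * (x / r + cos z)) * r) with
        (- (sin z * r ^ 2) - r * (X * sin z + Y * cos z) - x * Y) by (field; lra).
      rewrite <- EY, <- Id. field; lra.
  - apply (is_derive_half_angle (fun s => radius x s) (fun s => rot_x z x s) (fun s => rot_y z x s)
      y (y / r) (sin z) (cos z) r (rot_x z x y) (rot_y z x y)); try reflexivity; try assumption.
    + unfold radius. auto_derive; [lra|]. fold (radius x y).
      replace (x * (x * 1) + y * (y * 1)) with (x ^ 2 + y ^ 2) by ring. fold (radius x y) r. field; lra.
    + unfold rot_x. auto_derive; [exact I|ring].
    + unfold rot_y. auto_derive; [exact I|ring].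
    + set (X := rot_x z x y) in *. set (Y := rot_y z x y) in *.
      assert (EX : x = X * cos z - Y * sin z).
      { unfold X, Y, rot_x, rot_y. replace ((x * cos z + y * sin z) * cos z - (y * cos z - x * sin
          z) * sin z)
          with (x * (cos z ^ 2 + sin z ^ 2)) by ring. rewrite T; ring. }
      apply (Rmult_eq_reg_r r); [|lra].
      replace ((cos z * (r + X) - Y * (y / r + sin z)) * r) with
        (cos z * r ^ 2 + r * (X * cos z - Y * sin z) - y * Y) by (field; lra).
      rewrite <- EX, <- Id2. field; lra.
Qed.

Lemma continuity_2d_pt_comp1 (f : R -> R) (g : R -> R -> R) (x y : R) :
  (forall t, continuity_pt f t) -> continuity_2d_pt g x y ->
  continuity_2d_pt (fun x y => f (g x y)) x y.
Proof. intros Hf Hg. apply continuity_1d_2d_pt_comp; [apply Hf|assumption]. Qed.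

Lemma continuity_2d_pt_pow2 (x y : R) : continuity_2d_pt (fun x y => x ^ 2 + y ^ 2) x y.
Proof.
  apply continuity_2d_pt_ext with (fun x y => x * x + y * y); [intros; ring|].
  apply continuity_2d_pt_plus; apply continuity_2d_pt_mult;
    first [apply continuity_2d_pt_id1|apply continuity_2d_pt_id2].
Qed.

Lemma continuity_radius (x y : R) : continuity_2d_pt radius x y.
Proof.
  apply (continuity_1d_2d_pt_comp sqrt); [|apply continuity_2d_pt_pow2].
  apply continuity_pt_sqrt. generalize (pow2_ge_0 x) (pow2_ge_0 y); lra.
Qed.

Lemma continuity_rot_x (z x y : R) : continuity_2d_pt (rot_x z) x y.
Proof.
  apply continuity_2d_pt_plus; apply continuity_2d_pt_mult; try apply continuity_2d_pt_const;
    first [apply continuity_2d_pt_id1|apply continuity_2d_pt_id2].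
Qed.

Lemma continuity_rot_y (z x y : R) : continuity_2d_pt (rot_y z) x y.
Proof.
  apply continuity_2d_pt_minus; apply continuity_2d_pt_mult; try apply continuity_2d_pt_const;
    first [apply continuity_2d_pt_id1|apply continuity_2d_pt_id2].
Qed.

Lemma continuity_log_radius (x y : R) : 0 < x ^ 2 + y ^ 2 -> continuity_2d_pt log_radius x y.
Proof.
  intros H. apply continuity_2d_pt_mult; [|apply continuity_2d_pt_const].
  apply (continuity_1d_2d_pt_comp ln); [|apply continuity_2d_pt_pow2].
  apply derivable_continuous_pt. exists (/ (x ^ 2 + y ^ 2)). apply derivable_pt_lim_ln, H.
Qed.

Lemma continuity_angle (z x y : R) : 0 < radius x y + rot_x z x y ->
  continuity_2d_pt (angle z) x y.
Proof.
  intros H. apply continuity_2d_pt_mult; [apply continuity_2d_pt_const|].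
  apply (continuity_2d_pt_comp1 atan).
  - intros t. apply derivable_continuous_pt, derivable_pt_atan.
  - apply continuity_2d_pt_mult; [apply continuity_rot_y|].
    apply (continuity_2d_pt_inv (fun x y => radius x y + rot_x z x y)); [|lra].
    apply continuity_2d_pt_plus; [apply continuity_radius|apply continuity_rot_x].
Qed.

(** * Analytic multipliers *)

Lemma cauchy_riemann_plus (a b a' b' : R -> R -> R) (x y : R) :
  cauchy_riemann_at a b x y -> cauchy_riemann_at a' b' x y ->
  cauchy_riemann_at (fun x y => a x y + a' x y) (fun x y => b x y + b' x y) x y.
Proof.
  intros (p & q & H1 & H2 & H3 & H4) (p' & q' & H1' & H2' & H3' & H4').
  exists (p + p'), (q + q'). split; [|split; [|split]].
  - apply (is_derive_plus (V := R_NormedModule) (fun s => a s y)); assumption.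
  - apply (is_derive_plus (V := R_NormedModule) (fun s => a x s)); assumption.
  - replace (- (q + q')) with (- q + - q') by ring.
    apply (is_derive_plus (V := R_NormedModule) (fun s => b s y)); assumption.
  - apply (is_derive_plus (V := R_NormedModule) (fun s => b x s)); assumption.
Qed.

(** Real and imaginary parts of [C exp (k (s + i (t - tau)))], that is, of a rotated power [z^k] in
    logarithmic polar coordinates. *)
Definition wave_re (C k tau s t : R) : R := C * exp (k * s) * cos (k * (t - tau)).
Definition wave_im (C k tau s t : R) : R := C * exp (k * s) * sin (k * (t - tau)).

Lemma cauchy_riemann_wave (S T : R -> R -> R) (C k tau x y : R) : cauchy_riemann_at S T x y ->
  cauchy_riemann_at (fun x y => wave_re C k tau (S x y) (T x y))
    (fun x y => wave_im C k tau (S x y) (T x y)) x y.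
Proof.
  intros (p & q & H1 & H2 & H3 & H4).
  set (E := exp (k * S x y)). set (c := cos (k * (T x y + - tau))). set (s := sin (k * (T x y + - tau))).
  exists (C * k * E * (c * p + s * q)), (C * k * E * (c * q - s * p)).
  unfold wave_re, wave_im. split; [|split; [|split]]; auto_derive;
    try (repeat split; eexists; eassumption).
  - rewrite (is_derive_unique (fun s : R => S s y) _ _ H1),
      (is_derive_unique (fun s : R => T s y) _ _ H3).
    fold E c s. ring.
  - rewrite (is_derive_unique (fun s : R => S x s) _ _ H2),
      (is_derive_unique (fun s : R => T x s) _ _ H4).
    fold E c s. ring.
  - rewrite (is_derive_unique (fun s : R => S s y) _ _ H1),
      (is_derive_unique (fun s : R => T s y) _ _ H3).
    fold E c s. ring.
  - rewrite (is_derive_unique (fun s : R => S x s) _ _ H2),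
      (is_derive_unique (fun s : R => T x s) _ _ H4).
    fold E c s. ring.
Qed.

(** Product of [u + i v] with [exp (a + i b)]; by [mult_exp_sq] the squared modulus is multiplied by
    [exp (2 * a)]. *)
Lemma cauchy_riemann_mult_exp (u v a b : R -> R -> R) (x y : R) :
  cauchy_riemann_at u v x y -> cauchy_riemann_at a b x y ->
  cauchy_riemann_at (fun x y => exp (a x y) * (u x y * cos (b x y) - v x y * sin (b x y)))
    (fun x y => exp (a x y) * (u x y * sin (b x y) + v x y * cos (b x y))) x y.
Proof.
  intros (p & q & H1 & H2 & H3 & H4) (p' & q' & H1' & H2' & H3' & H4').
  set (E := exp (a x y)). set (c := cos (b x y)). set (s := sin (b x y)).
  exists (E * (p' * (u x y * c - v x y * s) + (p * c + q * s) + q' * (u x y * s + v x y * c))),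
    (E * (q' * (u x y * c - v x y * s) + (q * c - p * s) - p' * (u x y * s + v x y * c))).
  split; [|split; [|split]]; auto_derive; try (repeat split; eexists; eassumption).
  - rewrite (is_derive_unique (fun s : R => u s y) _ _ H1),
      (is_derive_unique (fun s : R => v s y) _ _ H3),
      (is_derive_unique (fun s : R => a s y) _ _ H1'), (is_derive_unique (fun s : R => b s y) _ _ H3').
    fold E c s. ring.
  - rewrite (is_derive_unique (fun s : R => u x s) _ _ H2),
      (is_derive_unique (fun s : R => v x s) _ _ H4),
      (is_derive_unique (fun s : R => a x s) _ _ H2'), (is_derive_unique (fun s : R => b x s) _ _ H4').
    fold E c s. ring.
  - rewrite (is_derive_unique (fun s : R => u s y) _ _ H1),
      (is_derive_unique (fun s : R => v s y) _ _ H3),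
      (is_derive_unique (fun s : R => a s y) _ _ H1'), (is_derive_unique (fun s : R => b s y) _ _ H3').
    fold E c s. ring.
  - rewrite (is_derive_unique (fun s : R => u x s) _ _ H2),
      (is_derive_unique (fun s : R => v x s) _ _ H4),
      (is_derive_unique (fun s : R => a x s) _ _ H2'), (is_derive_unique (fun s : R => b x s) _ _ H4').
    fold E c s. ring.
Qed.

Lemma mult_exp_sq (u v a b : R) :
  (exp a * (u * cos b - v * sin b)) ^ 2 + (exp a * (u * sin b + v * cos b)) ^ 2 =
  (u ^ 2 + v ^ 2) * exp (2 * a).
Proof.
  replace (exp (2 * a)) with (exp a ^ 2).
  - replace ((exp a * (u * cos b - v * sin b)) ^ 2 + (exp a * (u * sin b + v * cos b)) ^ 2) with
      ((u ^ 2 + v ^ 2) * exp a ^ 2 * (cos b ^ 2 + sin b ^ 2)) by ring.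
    rewrite cos_sin_sq; ring.
  - replace (2 * a) with (a + a) by ring. rewrite exp_plus; ring.
Qed.

Lemma continuity_wave_re (S T : R -> R -> R) (C k tau x y : R) :
  continuity_2d_pt S x y -> continuity_2d_pt T x y ->
  continuity_2d_pt (fun x y => wave_re C k tau (S x y) (T x y)) x y.
Proof.
  intros HS HT. unfold wave_re. apply continuity_2d_pt_mult.
  - apply continuity_2d_pt_mult; [apply continuity_2d_pt_const|].
    apply (continuity_2d_pt_comp1 exp).
    + intros; apply derivable_continuous_pt, derivable_pt_exp.
    + apply continuity_2d_pt_mult; [apply continuity_2d_pt_const|assumption].
  - apply (continuity_2d_pt_comp1 cos); [apply continuity_cos|].
    apply continuity_2d_pt_mult; [apply continuity_2d_pt_const|].
    apply continuity_2d_pt_minus; [assumption|apply continuity_2d_pt_const].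
Qed.

Lemma continuity_wave_im (S T : R -> R -> R) (C k tau x y : R) :
  continuity_2d_pt S x y -> continuity_2d_pt T x y ->
  continuity_2d_pt (fun x y => wave_im C k tau (S x y) (T x y)) x y.
Proof.
  intros HS HT. unfold wave_im. apply continuity_2d_pt_mult.
  - apply continuity_2d_pt_mult; [apply continuity_2d_pt_const|].
    apply (continuity_2d_pt_comp1 exp).
    + intros; apply derivable_continuous_pt, derivable_pt_exp.
    + apply continuity_2d_pt_mult; [apply continuity_2d_pt_const|assumption].
  - apply (continuity_2d_pt_comp1 sin); [apply continuity_sin|].
    apply continuity_2d_pt_mult; [apply continuity_2d_pt_const|].
    apply continuity_2d_pt_minus; [assumption|apply continuity_2d_pt_const].
Qed.

Lemma continuity_mult_exp (u v a b : R -> R -> R) (x y : R) :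
  continuity_2d_pt u x y -> continuity_2d_pt v x y ->
  continuity_2d_pt a x y -> continuity_2d_pt b x y ->
  continuity_2d_pt (fun x y => exp (a x y) * (u x y * cos (b x y) - v x y * sin (b x y))) x y /\
  continuity_2d_pt (fun x y => exp (a x y) * (u x y * sin (b x y) + v x y * cos (b x y))) x y.
Proof.
  intros Hu Hv Ha Hb.
  assert (E : continuity_2d_pt (fun x y => exp (a x y)) x y).
  { apply (continuity_2d_pt_comp1 exp); [|assumption].
    intros; apply derivable_continuous_pt, derivable_pt_exp. }
  assert (Cb : continuity_2d_pt (fun x y => cos (b x y)) x y)
    by (apply (continuity_2d_pt_comp1 cos); [apply continuity_cos|assumption]).
  assert (Sb : continuity_2d_pt (fun x y => sin (b x y)) x y)
    by (apply (continuity_2d_pt_comp1 sin); [apply continuity_sin|assumption]).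
  split; apply continuity_2d_pt_mult; try assumption;
    [apply continuity_2d_pt_minus|apply continuity_2d_pt_plus];
    apply continuity_2d_pt_mult; assumption.
Qed.

(** The first power is centred on the bisector and cancels the growth; the second, centred at [tau],
    is the comparison function of a given substrip. *)
Definition weight_re (A B k l tau s t : R) : R := wave_re A k 0 s t + wave_re B l tau s t.
Definition weight_im (A B k l tau s t : R) : R := wave_im A k 0 s t + wave_im B l tau s t.

Definition polar_mod2 (u v : R -> R -> R) (z s t : R) : R :=
  u (px z s t) (py z s t) ^ 2 + v (px z s t) (py z s t) ^ 2.

Lemma exp_le (x y : R) : x <= y -> exp x <= exp y.
Proof.
  intros [H| ->]; [apply Rlt_le, exp_increasing, H|lra].
Qed.

(** A value above [K] would give [N exp (2 W) + eta |z|^2] an interior maximum for small [eta].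
    Carried back to the plane by [log_radius] and [angle], available because [al < PI], it
    contradicts [cauchy_riemann_no_max]. On the sides of the strip only the modulus needs to be
    continuous. *)
Theorem strip_max (u v : R -> R -> R) (z al A B k l tau s1 s2 t1 t2 K : R) :
  al < PI ->
  (forall s t, Rabs t < al ->
     continuity_2d_pt u (px z s t) (py z s t) /\ continuity_2d_pt v (px z s t) (py z s t) /\
     cauchy_riemann_at u v (px z s t) (py z s t)) ->
  (forall s t, Rabs t <= al -> forall e, 0 < e -> exists r, 0 < r /\ forall s' t', Rabs t' <= al ->
     near r s t s' t' -> Rabs (polar_mod2 u v z s' t' - polar_mod2 u v z s t) < e) ->
  - al <= t1 -> t2 <= al ->
  (forall s t, in_rect s1 s2 t1 t2 s t -> s = s1 \/ s = s2 \/ t = t1 \/ t = t2 ->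
     polar_mod2 u v z s t * exp (2 * weight_re A B k l tau s t) <= K) ->
  forall s t, in_rect s1 s2 t1 t2 s t ->
     polar_mod2 u v z s t * exp (2 * weight_re A B k l tau s t) <= K.
Proof.
  intros Hal Hint Hcont Ht1 Ht2 Hbd ss ts Hss.
  set (N := polar_mod2 u v z) in *. set (W := weight_re A B k l tau) in *.
  apply Rnot_lt_le; intros Hbig.
  set (G := N ss ts * exp (2 * W ss ts) - K).
  (* The added term stays below half the excess [G] on the rectangle, so it cannot move the maximum
     to the boundary. *)
  set (eta := G / (2 * exp s2 ^ 2)).
  assert (HG : 0 < G) by (unfold G; lra).
  assert (Hs2 : 0 < exp s2 ^ 2) by (apply pow_lt, exp_pos).
  assert (Heta : 0 < eta) by (apply Rdiv_lt_0_compat; lra).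
  assert (Eeta : eta * exp s2 ^ 2 = G / 2) by (unfold eta; field; apply Rgt_not_eq, exp_pos).
  set (psi := fun s t => N s t * exp (2 * W s t) + eta * exp s ^ 2).
  assert (CW : cont2 (fun s t => exp (2 * W s t))).
  { intros s t. apply (continuity_2d_pt_comp1 exp).
    - intros; apply derivable_continuous_pt, derivable_pt_exp.
    - apply continuity_2d_pt_mult; [apply continuity_2d_pt_const|].
      apply continuity_2d_pt_plus; apply (continuity_wave_re (fun s t => s) (fun s t => t));
        first [apply continuity_2d_pt_id1|apply continuity_2d_pt_id2]. }
  assert (CE : cont2 (fun s t => eta * exp s ^ 2)).
  { intros s t. apply continuity_2d_pt_mult; [apply continuity_2d_pt_const|].
    apply (continuity_2d_pt_comp1 (fun s => exp s ^ 2) (fun s t => s)); [|apply continuity_2d_pt_id1].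
    intros x. apply derivable_continuous_pt. exists (2 * exp x ^ 2). apply is_derive_Reals.
    auto_derive; [exact I|ring]. }
  assert (InT : forall s t, in_rect s1 s2 t1 t2 s t -> Rabs t <= al)
    by (intros s t [? ?]; apply Rabs_le; lra).
  destruct (rect_max (in_rect s1 s2 t1 t2) psi s1 s2 t1 t2) as [s0 [t0 [Hin0 Hmax]]].
  - exists ss, ts; assumption.
  - auto.
  - intros; contradiction.
  - intros s t Hst e He.
    set (X := N s t). set (Y := exp (2 * W s t)).
    assert (HX : 0 <= X) by (unfold X, N, polar_mod2; generalize (pow2_ge_0 (u (px z s t) (py z s t)))
      (pow2_ge_0 (v (px z s t) (py z s t))); lra).
    assert (HY : 0 < Y) by apply exp_pos.
    (* The product rises by at most [d1 (Y + 1) + d2 (X + 1) <= e / 2]; the [eta] term takes another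
       [e / 4]. *)
    set (d1 := Rmin 1 (e / (4 * (Y + 1)))). set (d2 := Rmin 1 (e / (4 * (X + 1)))).
    assert (Hd1 : 0 < d1) by (apply Rmin_glb_lt; [lra|apply Rdiv_lt_0_compat; lra]).
    assert (Hd2 : 0 < d2) by (apply Rmin_glb_lt; [lra|apply Rdiv_lt_0_compat; lra]).
    destruct (Hcont s t (InT s t Hst) d1 Hd1) as [r1 [Hr1 C1]].
    destruct (cont2_usc _ s t CW d2 Hd2) as [r2 [Hr2 C2]].
    destruct (cont2_usc _ s t CE (e / 4)) as [r3 [Hr3 C3]]; [lra|].
    exists (Rmin r1 (Rmin r2 r3)). split; [repeat apply Rmin_glb_lt; assumption|].
    intros s' t' Hst' [Ns Nt].
    generalize (Rmin_l r1 (Rmin r2 r3)) (Rmin_r r1 (Rmin r2 r3)) (Rmin_l r2 r3) (Rmin_r r2 r3); intros.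
    assert (D1 := C1 s' t' (InT _ _ Hst') ltac:(split; lra)).
    assert (D2 := C2 s' t' ltac:(split; lra)). assert (D3 := C3 s' t' ltac:(split; lra)).
    cbv beta in D2, D3.
    fold X in D1; fold Y in D2. unfold psi; fold X; fold Y.
    apply Rabs_def2 in D1; apply Rabs_def2 in D2; apply Rabs_def2 in D3.
    set (X' := N s' t') in *. set (Y' := exp (2 * W s' t')) in *.
    assert (HY' : 0 < Y') by apply exp_pos.
    assert (L1 : d1 * (Y + 1) <= e / 4).
    { apply Rle_trans with (e / (4 * (Y + 1)) * (Y + 1)); [|right; field; lra].
      apply Rmult_le_compat_r; [lra|apply Rmin_r]. }
    assert (L2 : d2 * (X + 1) <= e / 4).
    { apply Rle_trans with (e / (4 * (X + 1)) * (X + 1)); [|right; field; lra].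
      apply Rmult_le_compat_r; [lra|apply Rmin_r]. }
    assert (d2 <= 1) by apply Rmin_l.
    assert (X' * Y' <= (X + d1) * Y') by (apply Rmult_le_compat_r; lra).
    assert ((X + d1) * Y' <= (X + d1) * (Y + d2)) by (apply Rmult_le_compat_l; lra).
    assert (d1 * d2 <= d1 * 1) by (apply Rmult_le_compat_l; lra).
    assert (X * d2 <= d2 * (X + 1)) by lra.
    assert ((X + d1) * (Y + d2) = X * Y + d1 * Y + X * d2 + d1 * d2) by ring.
    lra.
  - assert (Mono : forall s, s <= s2 -> eta * exp s ^ 2 <= G / 2).
    { intros s Hs. rewrite <- Eeta. apply Rmult_le_compat_l; [lra|].
      apply pow_incr; split; [apply Rlt_le, exp_pos|apply exp_le, Hs]. }
    assert (Big : K + G <= psi s0 t0).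
    { eapply Rle_trans; [|apply (Hmax ss ts Hss)]. unfold psi, G.
      assert (0 < eta * exp ss ^ 2) by (apply Rmult_lt_0_compat; [assumption|apply pow_lt,
          exp_pos]). lra. }
    assert (Int : s1 < s0 < s2 /\ t1 < t0 < t2).
    { apply NNPP; intros HB.
      assert (Bd : s0 = s1 \/ s0 = s2 \/ t0 = t1 \/ t0 = t2).
      { destruct Hin0. destruct (Req_dec s0 s1); [tauto|]. destruct (Req_dec s0 s2); [tauto|].
        destruct (Req_dec t0 t1); [tauto|]. destruct (Req_dec t0 t2); [tauto|].
        exfalso; apply HB; lra. }
      assert (Q := Hbd s0 t0 Hin0 Bd). assert (E := Mono s0 ltac:(destruct Hin0; lra)).
      unfold psi in Big. lra. }
    assert (At0 : Rabs t0 < al) by (apply Rabs_def1; lra).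
    assert (Api : Rabs t0 < PI) by lra.
    set (x0 := px z s0 t0). set (y0 := py z s0 t0).
    assert (Slit : 0 < radius x0 y0 + rot_x z x0 y0) by (apply slit_polar, Api).
    assert (C0 : continuity_2d_pt (fun x y => radius x y + rot_x z x y) x0 y0).
    { apply continuity_2d_pt_plus; [apply continuity_radius|apply continuity_rot_x]. }
    destruct (radius_pos z x0 y0 Slit) as [_ Pos0].
    set (g := Rmin (Rmin (s0 - s1) (s2 - s0)) (Rmin (t0 - t1) (t2 - t0))).
    assert (Hg : 0 < g) by (unfold g; repeat apply Rmin_glb_lt; lra).
    assert (g <= s0 - s1 /\ g <= s2 - s0 /\ g <= t0 - t1 /\ g <= t2 - t0).
    { unfold g; repeat split;
       first [eapply Rle_trans; [apply Rmin_l|]; first [apply Rmin_l|apply Rmin_r]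
             |eapply Rle_trans; [apply Rmin_r|]; first [apply Rmin_l|apply Rmin_r]]. }
    destruct (C0 (mkposreal _ Slit)) as [r1 R1].
    destruct (continuity_log_radius x0 y0 Pos0 (mkposreal _ Hg)) as [r2 R2].
    destruct (continuity_angle z x0 y0 Slit (mkposreal _ Hg)) as [r3 R3].
    set (r := Rmin r1 (Rmin r2 r3)).
    assert (Hr : 0 < r) by (unfold r; repeat apply Rmin_glb_lt; apply cond_pos).
    (* Points near [(x0, y0)] have polar coordinates inside the rectangle, so the maximum is also
       local in Cartesian coordinates. *)
    assert (Inv : forall x y, near r x0 y0 x y -> 0 < radius x y + rot_x z x y /\
      s1 < log_radius x y < s2 /\ t1 < angle z x y < t2).
    { intros x y [Nx Ny].
      generalize (Rmin_l r1 (Rmin r2 r3)) (Rmin_r r1 (Rmin r2 r3)) (Rmin_l r2 r3) (Rmin_r r2 r3);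
          fold r; intros.
      assert (D1 := R1 x y ltac:(lra) ltac:(lra)). assert (D2 := R2 x y ltac:(lra) ltac:(lra)).
      assert (D3 := R3 x y ltac:(lra) ltac:(lra)). cbn [pos] in D1, D2, D3.
      unfold x0, y0 in D2, D3. rewrite log_radius_polar in D2. rewrite angle_polar in D3 by assumption.
      apply Rabs_def2 in D1; apply Rabs_def2 in D2; apply Rabs_def2 in D3. repeat split; lra. }
    set (a := fun x y => weight_re A B k l tau (log_radius x y) (angle z x y)).
    set (b := fun x y => weight_im A B k l tau (log_radius x y) (angle z x y)).
    apply (cauchy_riemann_no_max
      (fun x y => exp (a x y) * (u x y * cos (b x y) - v x y * sin (b x y)))
      (fun x y => exp (a x y) * (u x y * sin (b x y) + v x y * cos (b x y)))
      x0 y0 r eta Hr Heta).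
    + intros x y Nxy. destruct (Inv x y Nxy) as [Sl [Is It]].
      destruct (polar_of_cartesian z x y Sl) as [Ex Ey].
      destruct (radius_pos z x y Sl) as [_ Pos].
      destruct (Hint (log_radius x y) (angle z x y)) as [Cu [Cv CR]].
      { apply Rabs_def1; lra. }
      rewrite Ex, Ey in Cu, Cv, CR.
      assert (Cl := continuity_log_radius x y Pos). assert (Ca := continuity_angle z x y Sl).
      assert (Da : continuity_2d_pt a x y) by (apply continuity_2d_pt_plus;
          apply continuity_wave_re; assumption).
      assert (Db : continuity_2d_pt b x y) by (apply continuity_2d_pt_plus;
          apply continuity_wave_im; assumption).
      destruct (continuity_mult_exp u v a b x y Cu Cv Da Db) as [M1 M2].
      split; [exact M1|split; [exact M2|]].
      apply cauchy_riemann_mult_exp; [assumption|].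
      apply cauchy_riemann_plus; apply cauchy_riemann_wave, polar_cauchy_riemann; assumption.
    + intros x y Nxy. rewrite !mult_exp_sq.
      assert (Val : forall x y, 0 < radius x y + rot_x z x y ->
        (u x y ^ 2 + v x y ^ 2) * exp (2 * a x y) + eta * (x ^ 2 + y ^ 2) =
        psi (log_radius x y) (angle z x y)).
      { intros x' y' Sl'. destruct (polar_of_cartesian z x' y' Sl') as [Ex Ey].
        destruct (radius_pos z x' y' Sl') as [_ Pos].
        unfold psi, N, polar_mod2. rewrite Ex, Ey, exp_log_radius, radius_sq by assumption.
            reflexivity. }
      destruct (Inv x y Nxy) as [Sl [Is It]].
      rewrite !Val by assumption.
      replace (log_radius x0 y0) with s0 by (symmetry; apply log_radius_polar).
      replace (angle z x0 y0) with t0 by (symmetry; apply angle_polar, Api).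
      apply Hmax. split; lra.
Qed.

(** * The Phragmen-Lindelof argument *)

(** The conclusion of [strip_max] as a property of [N] alone, which separates the growth argument
    from the underlying functions. *)
Definition strip_principle (N : R -> R -> R) (al : R) : Prop :=
  forall A B k l tau s1 s2 t1 t2 K, - al <= t1 -> t2 <= al ->
  (forall s t, in_rect s1 s2 t1 t2 s t -> s = s1 \/ s = s2 \/ t = t1 \/ t = t2 ->
     N s t * exp (2 * weight_re A B k l tau s t) <= K) ->
  forall s t, in_rect s1 s2 t1 t2 s t -> N s t * exp (2 * weight_re A B k l tau s t) <= K.

Lemma cos_ge_of_abs (x y : R) : Rabs x <= y -> y <= PI -> cos y <= cos x.
Proof.
  intros H Hy. assert (0 <= y) by (generalize (Rabs_pos x); lra).
  destruct (Rle_dec 0 x) as [Hx|Hx].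
  - rewrite Rabs_right in H by lra. apply cos_decr_1; lra.
  - rewrite Rabs_left in H by lra. rewrite <- (cos_neg x). apply cos_decr_1; lra.
Qed.

(** As [l * (t2 - t1) < PI], the cosine of [l * (t - tau)] has a positive minimum on the substrip,
    and the factor [exp (- 2 B exp (l s) cos (l (t - tau)))] beats the growth allowed on the
    right. *)
Lemma strip_growth_max (N : R -> R -> R) (al A k l t1 t2 K : R) :
  strip_principle N al -> (forall s t, 0 <= N s t) -> 0 <= K ->
  - al <= t1 -> t1 <= t2 -> t2 <= al -> 0 < l -> l * (t2 - t1) < PI ->
  let V := fun s t => N s t * exp (2 * wave_re A k 0 s t) in
  (forall s, V s t1 <= K) -> (forall s, V s t2 <= K) ->
  (forall e, 0 < e -> exists S, forall s t, s <= S -> t1 <= t <= t2 -> V s t <= K + e) ->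
  (forall g e, 0 < g -> 0 < e -> exists S, forall s t, S <= s -> t1 <= t <= t2 ->
     V s t <= e * exp (g * exp (l * s))) ->
  forall s t, t1 <= t <= t2 -> V s t <= K.
Proof.
  intros HN Npos HK Ha1 H12 Ha2 Hl Hw V HV1 HV2 Hleft Hright ss ts Hts.
  apply Rnot_lt_le; intros Hbig.
  set (v := V ss ts) in *. set (e := (v - K) / 2).
  assert (He : 0 < e) by (unfold e; lra).
  set (Y := exp (l * ss)). assert (HY : 0 < Y) by apply exp_pos.
  set (L := ln (v / (K + e))).
  assert (Hq : 1 < v / (K + e)).
  { apply (Rmult_lt_reg_r (K + e)); [lra|].
    replace (v / (K + e) * (K + e)) with v by (field; lra). unfold e; lra. }
  assert (HL : 0 < L) by (unfold L; rewrite <- ln_1; apply ln_increasing; lra).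
  (* Instead of letting [B] tend to 0, it is fixed so that the factor costs at most
     [exp (- (L / 2))] at the chosen point, where the value exceeds [K + e] by the factor
     [exp L]. *)
  set (B := L / (4 * Y)).
  assert (HB : 0 < B) by (apply Rdiv_lt_0_compat; lra).
  set (tau := (t1 + t2) / 2). set (c0 := cos (l * (t2 - t1) / 2)).
  assert (Hc0 : 0 < c0).
  { assert (0 <= l * (t2 - t1)) by (apply Rmult_le_pos; lra). apply cos_gt_0; lra. }
  assert (Hcos : forall t, t1 <= t <= t2 -> c0 <= cos (l * (t - tau))).
  { intros t Ht. apply cos_ge_of_abs.
    - assert (l * t1 <= l * t) by (apply Rmult_le_compat_l; lra).
      assert (l * t <= l * t2) by (apply Rmult_le_compat_l; lra).
      apply Rabs_le; unfold tau; lra.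
    - assert (0 <= l * (t2 - t1)) by (apply Rmult_le_pos; lra). lra. }
  destruct (Hleft e He) as [S1 HS1].
  destruct (Hright (2 * (B * c0)) e) as [S2 HS2]; [|assumption|].
  { apply Rmult_lt_0_compat; [lra|]. apply Rmult_lt_0_compat; assumption. }
  assert (Vpos : forall s t, 0 <= V s t).
  { intros s t. apply Rmult_le_pos; [apply Npos|apply Rlt_le, exp_pos]. }
  assert (Split : forall s t, N s t * exp (2 * weight_re A (- B) k l tau s t) =
    V s t * exp (- (2 * (B * exp (l * s) * cos (l * (t - tau)))))).
  { intros s t. unfold V, weight_re, wave_re. rewrite (Rmult_assoc (N s t)), <- exp_plus.
    f_equal. f_equal. ring. }
  assert (Decay : forall s t, t1 <= t <= t2 ->
    exp (- (2 * (B * exp (l * s) * cos (l * (t - tau))))) <= exp (- (2 * (B * c0) * exp (l * s)))).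
  { intros s t Ht. apply exp_le. specialize (Hcos t Ht).
    assert (0 < B * exp (l * s)) by (apply Rmult_lt_0_compat; [assumption|apply exp_pos]).
    assert (B * exp (l * s) * c0 <= B * exp (l * s) * cos (l * (t - tau)))
      by (apply Rmult_le_compat_l; lra). lra. }
  assert (Decay1 : forall s t, t1 <= t <= t2 ->
    exp (- (2 * (B * exp (l * s) * cos (l * (t - tau))))) <= 1).
  { intros s t Ht. eapply Rle_trans; [apply (Decay s t Ht)|]. rewrite <- exp_0. apply exp_le.
    assert (0 < 2 * (B * c0) * exp (l * s)); [|lra].
    apply Rmult_lt_0_compat; [|apply exp_pos]. apply Rmult_lt_0_compat; [lra|].
    apply Rmult_lt_0_compat; assumption. }
  (* The rectangle reaches far enough left for [Hleft] and far enough right for the decay to win,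
     and contains the chosen point. *)
  assert (Fin : N ss ts * exp (2 * weight_re A (- B) k l tau ss ts) <= K + e).
  { apply (HN A (- B) k l tau (Rmin S1 ss) (Rmax S2 ss) t1 t2); try assumption.
    - intros s t [Hs Ht] Hb. rewrite Split.
      assert (D := Decay1 s t Ht). assert (D0 := Decay s t Ht). assert (P := Vpos s t).
      assert (E0 := exp_pos (- (2 * (B * exp (l * s) * cos (l * (t - tau)))))).
      assert (Case : V s t <= K + e \/ S2 <= s).
      { destruct Hb as [-> | [-> | [-> | ->]]].
        - left; apply HS1; [apply Rmin_l|assumption].
        - right; apply Rmax_l.
        - left; specialize (HV1 s); lra.
        - left; specialize (HV2 s); lra. }
      destruct Case as [C|C].
      + apply Rle_trans with (V s t * 1); [apply Rmult_le_compat_l; assumption|lra].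
      + assert (Q := HS2 s t C Ht).
        apply Rle_trans with (e * exp (2 * (B * c0) * exp (l * s)) * exp (- (2 * (B * c0) * exp (l
            * s)))).
        * apply Rmult_le_compat; lra.
        * rewrite Rmult_assoc, <- exp_plus, Rplus_opp_r, exp_0. lra.
    - split; [|assumption]. split; [apply Rmin_r|apply Rmax_r]. }
  rewrite Split in Fin. fold v Y in Fin.
  assert (Low : exp (- (L / 2)) <= exp (- (2 * (B * Y * cos (l * (ts - tau)))))).
  { apply exp_le. destruct (COS_bound (l * (ts - tau))) as [_ C].
    assert (BY : B * Y = L / 4) by (unfold B; field; lra). rewrite BY.
    assert (L / 4 * cos (l * (ts - tau)) <= L / 4 * 1) by (apply Rmult_le_compat_l; lra). lra. }
  assert (Fin2 : v * exp (- (L / 2)) <= K + e).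
  { eapply Rle_trans; [|exact Fin]. apply Rmult_le_compat_l; [apply Vpos|exact Low]. }
  assert (EL : v = (K + e) * exp L) by (unfold L; rewrite exp_ln by lra; field; lra).
  assert (Half : exp L * exp (- (L / 2)) = exp (L / 2)) by (rewrite <- exp_plus; f_equal; field).
  assert (1 < exp (L / 2)) by (rewrite <- exp_0; apply exp_increasing; lra).
  rewrite EL in Fin2. rewrite Rmult_assoc, Half in Fin2.
  assert ((K + e) * 1 < (K + e) * exp (L / 2)) by (apply Rmult_lt_compat_l; lra). lra.
Qed.

Lemma exp_ge_eventually (k y : R) : 0 < k -> exists S, forall s, S <= s -> y <= exp (k * s).
Proof.
  intros Hk. exists (y / k). intros s Hs.
  apply (Rmult_le_compat_l k) in Hs; [|lra].
  replace (k * (y / k)) with y in Hs by (field; lra).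
  generalize (exp_ineq1_le (k * s)); lra.
Qed.

(** [N] stands for a squared modulus and [M2] for [M ^ 2]. The bound near [s = -oo] replaces a side
    at the vertex, and [rho * al <= PI / 2] makes the multiplier at most 1 on the whole strip. *)
Theorem phragmen_lindelof_strip (N : R -> R -> R) (al rho a A M2 : R) :
  strip_principle N al -> (forall s t, 0 <= N s t) -> 0 < al -> 0 < rho -> rho * al <= PI / 2 ->
  0 <= M2 -> 0 <= a -> a < A ->
  (forall s, N s al <= M2) -> (forall s, N s (- al) <= M2) ->
  (forall e, 0 < e -> exists S, forall s t, s <= S -> Rabs t <= al -> N s t <= M2 + e) ->
  (forall s1 s2, exists C, forall s t, s1 <= s <= s2 -> Rabs t <= al -> N s t <= C) ->
  (exists S, forall s t, S <= s -> Rabs t <= al -> N s t <= exp (2 * (a * exp (rho * s)))) ->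
  forall s t, Rabs t <= al -> N s t <= M2 * exp (2 * (A * exp (rho * s) * cos (rho * t))).
Proof.
  intros HN Npos Hal Hrho Hopen HM2 Ha HaA Hb1 Hb2 Hleft Hloc [S2 Hgrow].
  set (V := fun s t => N s t * exp (2 * wave_re (- A) rho 0 s t)).
  assert (Hcos : forall t, Rabs t <= al -> 0 <= cos (rho * t)).
  { intros t Ht.
    assert (rho * Rabs t <= rho * al) by (apply Rmult_le_compat_l; lra).
    assert (Rabs (rho * t) <= PI / 2) by (rewrite Rabs_mult, (Rabs_right rho) by lra; lra).
    apply Rabs_le_between in H0. apply cos_ge_0; lra. }
  assert (VN : forall s t, Rabs t <= al -> V s t <= N s t).
  { intros s t Ht. unfold V, wave_re. rewrite Rminus_0_r.
    apply Rle_trans with (N s t * 1); [|lra]. apply Rmult_le_compat_l; [apply Npos|].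
    rewrite <- exp_0. apply exp_le.
    assert (0 <= A * exp (rho * s) * cos (rho * t)).
    { apply Rmult_le_pos; [|apply Hcos, Ht]. apply Rmult_le_pos; [lra|apply Rlt_le, exp_pos]. }
    lra. }
  assert (Ral : Rabs al <= al) by (rewrite Rabs_right; lra).
  assert (Rmal : Rabs (- al) <= al) by (rewrite Rabs_Ropp; exact Ral).
  assert (R0 : Rabs 0 <= al) by (rewrite Rabs_R0; lra).
  (* On the bisector the cosine is 1, so for large [s] the multiplier with rate [A > a] cancels the
     growth. *)
  assert (Mid : exists B0, forall s, V s 0 <= B0).
  { destruct (Hleft 1 ltac:(lra)) as [S1 HS1].
    destruct (Hloc S1 S2) as [C HC].
    exists (Rmax (M2 + 1) (Rmax C 1)). intros s.
    destruct (Rle_dec s S1) as [L|L].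
    { eapply Rle_trans; [|apply Rmax_l]. eapply Rle_trans; [apply VN, R0|]. apply HS1; assumption. }
    destruct (Rle_dec s S2) as [L2|L2].
    { eapply Rle_trans; [|apply Rmax_r]. eapply Rle_trans; [|apply Rmax_l].
      eapply Rle_trans; [apply VN, R0|]. apply HC; [lra|assumption]. }
    eapply Rle_trans; [|apply Rmax_r]. eapply Rle_trans; [|apply Rmax_r].
    unfold V, wave_re. rewrite Rminus_0_r, Rmult_0_r, cos_0.
    apply Rle_trans with (exp (2 * (a * exp (rho * s))) * exp (2 * (- A * exp (rho * s) * 1))).
    - apply Rmult_le_compat_r; [apply Rlt_le, exp_pos|]. apply Hgrow; [lra|assumption].
    - rewrite <- exp_plus. eapply Rle_trans; [apply exp_le with (y := 0)|right; apply exp_0].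
        assert (a * exp (rho * s) <= A * exp (rho * s)) by (apply Rmult_le_compat_r; [apply Rlt_le,
        exp_pos|lra]). lra. }
  destruct Mid as [B0 HB0].
  set (K1 := Rmax M2 B0).
  assert (HK1 : 0 <= K1 /\ M2 <= K1 /\ B0 <= K1).
  { generalize (Rmax_l M2 B0) (Rmax_r M2 B0); fold K1; lra. }
  assert (Vbd : forall s, V s al <= M2 /\ V s (- al) <= M2).
  { intros s; split; (eapply Rle_trans; [apply VN; assumption|]); [apply Hb1|apply Hb2]. }
  (* With [Y = exp (rho / 2 * s)] the growth exponent is [2 a Y^2] and the comparison exponent
     [g Y^3]; their difference [D] eventually exceeds [/ e]. *)
  assert (Hgrow2 : forall g e, 0 < g -> 0 < e -> exists S, forall s t, S <= s -> Rabs t <= al ->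
    V s t <= e * exp (g * exp (3 * rho / 2 * s))).
  { intros g e Hg He.
    destruct (exp_ge_eventually (rho / 2) (Rmax 1 ((2 * a + / e) / g))) as [S HS]; [lra|].
    exists (Rmax S S2). intros s t Hs Ht.
    assert (Y0 := HS s ltac:(eapply Rle_trans; [apply Rmax_l|exact Hs])).
    assert (Hs2 : S2 <= s) by (eapply Rle_trans; [apply Rmax_r|exact Hs]).
    eapply Rle_trans; [apply VN, Ht|]. eapply Rle_trans; [apply Hgrow; assumption|].
    set (Y := exp (rho / 2 * s)) in *.
    assert (Y1 : 1 <= Y) by (eapply Rle_trans; [apply Rmax_l|exact Y0]).
    assert (Y2 : (2 * a + / e) / g <= Y) by (eapply Rle_trans; [apply Rmax_r|exact Y0]).
    apply (Rmult_le_compat_l g) in Y2; [|lra].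
    replace (g * ((2 * a + / e) / g)) with (2 * a + / e) in Y2 by (field; lra).
    replace (exp (rho * s)) with (Y * Y) by (unfold Y; rewrite <- exp_plus; f_equal; field).
    replace (exp (3 * rho / 2 * s)) with (Y * Y * Y)
      by (unfold Y; rewrite <- !exp_plus; f_equal; field).
    assert (He' : 0 < / e) by (apply Rinv_0_lt_compat, He).
    set (D := g * (Y * Y * Y) - 2 * (a * (Y * Y))).
    assert (HD : / e <= D).
    { replace D with ((g * Y - 2 * a) * (Y * Y)) by (unfold D; ring).
      assert (1 <= Y * Y) by nra.
      apply Rle_trans with ((/ e) * 1); [lra|]. apply Rmult_le_compat; lra. }
    replace (g * (Y * Y * Y)) with (D + 2 * (a * (Y * Y))) by (unfold D; ring).
    rewrite exp_plus, <- (Rmult_assoc e).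
    apply Rle_trans with (1 * exp (2 * (a * (Y * Y)))); [rewrite Rmult_1_l; apply Rle_refl|].
    apply Rmult_le_compat_r; [apply Rlt_le, exp_pos|].
    replace 1 with (e * / e) by (field; lra). apply Rmult_le_compat_l; [lra|].
    generalize (exp_ineq1_le D); lra. }
  (* The width is at most [al], so [3 * rho / 2] times it is at most [3 PI / 4]. *)
  assert (Half : forall t1 t2, - al <= t1 -> t1 <= t2 -> t2 <= al -> t2 - t1 <= al ->
    (forall s, V s t1 <= K1) -> (forall s, V s t2 <= K1) ->
    forall s t, t1 <= t <= t2 -> V s t <= K1).
  { intros t1 t2 H1 H2 H3 H4 H5 H6.
    apply (strip_growth_max N al (- A) rho (3 * rho / 2) t1 t2 K1); try assumption; try lra.
    - assert (3 * rho / 2 * (t2 - t1) <= 3 * rho / 2 * al) by (apply Rmult_le_compat_l; lra).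
      generalize PI_RGT_0; lra.
    - intros e He. destruct (Hleft e He) as [S HS]. exists S; intros s t Hs Ht.
      assert (At : Rabs t <= al) by (apply Rabs_le; lra).
      generalize (VN s t At) (HS s t Hs At); unfold V; lra.
    - intros g e Hg He. destruct (Hgrow2 g e Hg He) as [S HS]. exists S; intros s t Hs Ht.
      apply HS; [assumption|apply Rabs_le; lra]. }
  assert (Bounded : forall s t, Rabs t <= al -> V s t <= K1).
  { intros s t Ht. apply Rabs_le_between in Ht. destruct (Rle_dec 0 t).
    - apply (Half 0 al); try lra; intros s'; [specialize (HB0 s')|specialize (Vbd s')]; lra.
    - apply (Half (- al) 0); try lra; intros s'; [specialize (Vbd s')|specialize (HB0 s')]; lra. }
  (* The bound [K1] has done its work: a bounded function satisfies every growth condition, so the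
     smaller exponent [rho / 2] suffices and the bisector is no longer a side. *)
  assert (Final : forall s t, - al <= t <= al -> V s t <= M2).
  { apply (strip_growth_max N al (- A) rho (rho / 2) (- al) al M2); try assumption; try lra.
    - generalize PI_RGT_0; lra.
    - apply Vbd.
    - apply Vbd.
    - intros e He. destruct (Hleft e He) as [S HS]. exists S; intros s t Hs Ht.
      assert (At : Rabs t <= al) by (apply Rabs_le; lra).
      generalize (VN s t At) (HS s t Hs At); unfold V; lra.
    - intros g e Hg He.
      destruct (exp_ge_eventually (rho / 2) (K1 / (e * g))) as [S HS]; [lra|].
      exists S; intros s t Hs Ht.
      assert (At : Rabs t <= al) by (apply Rabs_le; lra).
      eapply Rle_trans; [apply (Bounded s t At)|].
      assert (Y := HS s Hs). set (E := exp (rho / 2 * s)) in *.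
      assert (Heg : 0 < e * g) by (apply Rmult_lt_0_compat; assumption).
      apply (Rmult_le_compat_l (e * g)) in Y; [|lra].
      replace (e * g * (K1 / (e * g))) with K1 in Y by (field; lra).
      assert (e * (g * E) <= e * exp (g * E)); [|lra].
      apply Rmult_le_compat_l; [lra|]. generalize (exp_ineq1_le (g * E)); lra. }
  intros s t Ht. apply Rabs_le_between in Ht. assert (F := Final s t Ht).
  unfold V, wave_re in F. rewrite Rminus_0_r in F.
  apply (Rmult_le_compat_r (exp (2 * (A * exp (rho * s) * cos (rho * t))))) in F;
    [|apply Rlt_le, exp_pos].
  rewrite Rmult_assoc, <- exp_plus in F.
  replace (2 * (- A * exp (rho * s) * cos (rho * t)) + 2 * (A * exp (rho * s) * cos (rho * t)))
    with 0 in F by ring.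
  rewrite exp_0, Rmult_1_r in F. exact F.
Qed.

(** * Reduction of slice regular functions to the scalar case *)

Definition qdot (p q : quat) : R := qa p * qa q + qb p * qb q + qc p * qc q + qd p * qd q.

Lemma qnorm_sq (q : quat) : qnorm q ^ 2 = qdot q q.
Proof.
  unfold qnorm, qdot. rewrite pow2_sqrt; [ring|].
  generalize (pow2_ge_0 (qa q)) (pow2_ge_0 (qb q)) (pow2_ge_0 (qc q)) (pow2_ge_0 (qd q)); lra.
Qed.

Lemma qnorm_pos (q : quat) : 0 <= qnorm q.
Proof. apply sqrt_pos. Qed.

Lemma qdot_mul_I (I p q : quat) : in_S I -> qdot (qmul I p) (qmul I q) = qdot p q.
Proof.
  intros [H0 H1]. transitivity ((qb I ^ 2 + qc I ^ 2 + qd I ^ 2) * qdot p q).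
  - unfold qdot, qmul; cbn. rewrite H0; ring.
  - rewrite H1; ring.
Qed.

Lemma qdot_I_skew (I p q : quat) : in_S I -> qdot (qmul I p) q = - qdot p (qmul I q).
Proof. intros [H0 _]. unfold qdot, qmul; cbn. rewrite H0; ring. Qed.

(** Left multiplication by [I] is an isometry and skew, so [c] and [I c] are orthonormal; this is
    Bessel's inequality. *)
Lemma qdot_bessel (I c p : quat) : in_S I -> qdot c c = 1 ->
  qdot p c ^ 2 + qdot p (qmul I c) ^ 2 <= qnorm p ^ 2.
Proof.
  intros HI Hc. rewrite qnorm_sq.
  assert (H1 := qdot_mul_I I c c HI). rewrite Hc in H1.
  assert (H2 : qdot c (qmul I c) = 0).
  { assert (S := qdot_I_skew I c c HI).
    assert (Sy : qdot (qmul I c) c = qdot c (qmul I c)) by (unfold qdot; ring). lra. }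
  set (d := qmul I c) in *. set (u := qdot p c). set (v := qdot p d).
  assert (E : (qa p - u * qa c - v * qa d) ^ 2 + (qb p - u * qb c - v * qb d) ^ 2 +
    (qc p - u * qc c - v * qc d) ^ 2 + (qd p - u * qd c - v * qd d) ^ 2 =
    qdot p p - 2 * u * qdot p c - 2 * v * qdot p d + u ^ 2 * qdot c c + v ^ 2 * qdot d d
      + 2 * u * v * qdot c d) by (unfold qdot; ring).
  rewrite Hc, H1, H2 in E. fold u v in E.
  generalize (pow2_ge_0 (qa p - u * qa c - v * qa d)) (pow2_ge_0 (qb p - u * qb c - v * qb d))
    (pow2_ge_0 (qc p - u * qc c - v * qc d)) (pow2_ge_0 (qd p - u * qd c - v * qd d)).
  intros. lra.
Qed.

Lemma slice_dist (I : quat) (x y u v : R) : in_S I ->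
  qnorm (qsub (slice_pt I x y) (slice_pt I u v)) = sqrt ((x - u) ^ 2 + (y - v) ^ 2).
Proof.
  intros [H0 H1]. unfold qnorm. f_equal. cbn. rewrite H0.
  transitivity ((x - u) ^ 2 + (y - v) ^ 2 * (qb I ^ 2 + qc I ^ 2 + qd I ^ 2)).
  - ring.
  - rewrite H1; ring.
Qed.

Lemma slice_dist_lt (I : quat) (x y u v e : R) : in_S I ->
  Rabs (x - u) < e / 2 -> Rabs (y - v) < e / 2 ->
  qnorm (qsub (slice_pt I x y) (slice_pt I u v)) < e.
Proof.
  intros HI H1 H2. rewrite slice_dist by assumption.
  assert (0 < e) by (generalize (Rabs_pos (x - u)); lra).
  apply Rabs_def2 in H1; apply Rabs_def2 in H2.
  rewrite <- (sqrt_pow2 e) by lra. apply sqrt_lt_1.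
  - generalize (pow2_ge_0 (x - u)) (pow2_ge_0 (y - v)); lra.
  - apply pow2_ge_0.
  - nra.
Qed.

Lemma slice_norm (I : quat) (x y : R) : in_S I -> qnorm (slice_pt I x y) = sqrt (x ^ 2 + y ^ 2).
Proof.
  intros [H0 H1]. unfold qnorm. f_equal. cbn. rewrite H0.
  transitivity (x ^ 2 + y ^ 2 * (qb I ^ 2 + qc I ^ 2 + qd I ^ 2)).
  - ring.
  - rewrite H1; ring.
Qed.

Lemma slice_inj (I : quat) (x y u v : R) : in_S I -> slice_pt I x y = slice_pt I u v ->
  x = u /\ y = v.
Proof.
  intros HI E. assert (D := slice_dist I x y u v HI). rewrite E in D.
  rewrite slice_dist in D by assumption.
  replace ((u - u) ^ 2 + (v - v) ^ 2) with 0 in D by ring. rewrite sqrt_0 in D.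
  generalize (pow2_ge_0 (x - u)) (pow2_ge_0 (y - v)); intros P1 P2.
  symmetry in D. apply sqrt_eq_0 in D; [|lra].
  split; apply Rminus_diag_uniq; nra.
Qed.

Lemma slice_zero (I : quat) : slice_pt I 0 0 = qzero.
Proof. unfold slice_pt, qzero, qreal, qadd, qscale; cbn. f_equal; ring. Qed.

Lemma slice_polar (I : quat) (r t : R) :
  qscale r (qexpI I t) = slice_pt I (r * cos t) (r * sin t).
Proof. unfold qexpI, slice_pt, qscale, qadd, qreal; cbn. f_equal; ring. Qed.

Lemma closure_of_mem (O : qset) (q : quat) : O q -> q_closure O q.
Proof.
  intros H e He. exists q; split; [assumption|].
  assert (E : qnorm (qsub q q) ^ 2 = 0) by (rewrite qnorm_sq; unfold qdot; cbn; ring).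
  generalize (qnorm_pos (qsub q q)); nra.
Qed.

(** Regularity says [Dx = - I Dy]. Pairing it with [c] and with [I c] gives [<Dx, c> = <Dy, I c>]
    and [<Dx, I c> = - <Dy, c>]. This projection onto the plane of [c] and [I c] replaces a
    splitting of [f] into two holomorphic components. *)
Lemma slice_cauchy_riemann (Omega : qset) (f : quat -> quat) (I c : quat) (x y : R) :
  slice_regular Omega f -> in_S I -> Omega (slice_pt I x y) ->
  cauchy_riemann_at (fun x y => qdot (f (slice_pt I x y)) c)
    (fun x y => qdot (f (slice_pt I x y)) (qmul I c)) x y.
Proof.
  intros [_ Hreg] HI Hxy. destruct (Hreg I HI x y Hxy) as (Dx & Dy & HDx & HDy & HE).
  assert (E : Dx = qopp (qmul I Dy)).
  { assert (Ea := f_equal qa HE). assert (Eb := f_equal qb HE).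
    assert (Ec := f_equal qc HE). assert (Ed := f_equal qd HE). cbn in Ea, Eb, Ec, Ed.
    destruct Dx as [d1 d2 d3 d4]. unfold qopp, qmul; cbn in *. f_equal; lra. }
  assert (Lin : forall (g : R -> quat) t d w,
      qderiv g t d -> is_derive (fun s => qdot (g s) w) t (qdot d w)).
  { intros g t d w (G1 & G2 & G3 & G4). apply is_derive_Reals in G1, G2, G3, G4.
    assert (Lin4 : forall (g1 g2 g3 g4 : R -> R) l1 l2 l3 l4 w1 w2 w3 w4, is_derive g1 t l1 ->
      is_derive g2 t l2 -> is_derive g3 t l3 -> is_derive g4 t l4 ->
      is_derive (fun s => g1 s * w1 + g2 s * w2 + g3 s * w3 + g4 s * w4) t
        (l1 * w1 + l2 * w2 + l3 * w3 + l4 * w4)).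
    { intros g1 g2 g3 g4 l1 l2 l3 l4 w1 w2 w3 w4 D1 D2 D3 D4. auto_derive.
      - repeat split; eexists; eassumption.
      - rewrite (is_derive_unique (fun s : R => g1 s) _ _ D1),
          (is_derive_unique (fun s : R => g2 s) _ _ D2),
          (is_derive_unique (fun s : R => g3 s) _ _ D3), (is_derive_unique (fun s : R => g4 s) _ _ D4).
        ring. }
    apply (Lin4 (fun s => qa (g s)) (fun s => qb (g s)) (fun s => qc (g s)) (fun s => qd (g s)));
      assumption. }
  assert (Opp : forall w, qdot Dx w = - qdot (qmul I Dy) w) by (intros w; rewrite E; unfold qdot;
      cbn; ring).
  exists (qdot Dx c), (qdot Dy c). split; [|split; [|split]].
  - apply Lin, HDx.
  - apply Lin, HDy.
  - replace (- qdot Dy c) with (qdot Dx (qmul I c)) by (rewrite Opp, qdot_mul_I by assumption;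
      reflexivity).
    apply (Lin (fun s => f (slice_pt I s y))), HDx.
  - replace (qdot Dx c) with (qdot Dy (qmul I c)) by (rewrite Opp, qdot_I_skew by assumption; ring).
    apply (Lin (fun s => f (slice_pt I x s))), HDy.
Qed.

Lemma dot_lt (I c p q : quat) (e : R) : in_S I -> qdot c c = 1 -> qnorm (qsub p q) < e ->
  Rabs (qdot p c - qdot q c) < e /\ Rabs (qdot p (qmul I c) - qdot q (qmul I c)) < e.
Proof.
  intros HI Hc H. assert (B := qdot_bessel I c (qsub p q) HI Hc).
  assert (P := qnorm_pos (qsub p q)).
  assert (Sub : forall w, qdot p w - qdot q w = qdot (qsub p q) w) by (intros; unfold qdot; cbn; ring).
  rewrite !Sub. set (n := qnorm (qsub p q)) in *.
  generalize (pow2_ge_0 (qdot (qsub p q) c)) (pow2_ge_0 (qdot (qsub p q) (qmul I c))); intros.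
  assert (Ab : forall z, z ^ 2 <= n ^ 2 -> Rabs z < e).
  { intros z Hz. eapply Rle_lt_trans; [|exact H]. rewrite <- (Rabs_right n) by lra.
    apply Rsqr_le_abs_0. unfold Rsqr; lra. }
  split; apply Ab; lra.
Qed.

Definition dot_mod2 (I c : quat) (f : quat -> quat) (q : quat) : R :=
  qdot (f q) c ^ 2 + qdot (f q) (qmul I c) ^ 2.

Lemma sq_sub_le (u u' d : R) : 0 <= d -> d <= 1 -> Rabs (u' - u) < d ->
  Rabs (u' ^ 2 - u ^ 2) <= d * (2 * Rabs u + 1).
Proof.
  intros H0 H1 H. replace (u' ^ 2 - u ^ 2) with ((u' - u) * ((u' - u) + 2 * u)) by ring.
  rewrite Rabs_mult. apply Rmult_le_compat; try apply Rabs_pos; [lra|].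
  eapply Rle_trans; [apply Rabs_triang|]. rewrite Rabs_mult, (Rabs_right 2) by lra. lra.
Qed.

Lemma dot_mod2_cont (Omega : qset) (f : quat -> quat) (I c q : quat) (e : R) :
  cont_on_closure Omega f -> in_S I -> qdot c c = 1 -> q_closure Omega q -> 0 < e ->
  exists d, 0 < d /\ forall p, q_closure Omega p -> qnorm (qsub p q) < d ->
    Rabs (dot_mod2 I c f p - dot_mod2 I c f q) < e.
Proof.
  intros Hf HI Hc Hq He. unfold dot_mod2.
  set (u := qdot (f q) c). set (v := qdot (f q) (qmul I c)).
  set (L := 2 * Rabs u + 1 + (2 * Rabs v + 1)).
  assert (HL : 0 < L) by (unfold L; generalize (Rabs_pos u) (Rabs_pos v); lra).
  set (g := Rmin 1 (e / (2 * L))).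
  assert (Hg : 0 < g) by (apply Rmin_glb_lt; [lra|apply Rdiv_lt_0_compat; lra]).
  destruct (Hf q Hq g Hg) as [d [Hd H]].
  exists d; split; [assumption|]. intros p Hp Hpq.
  destruct (dot_lt I c (f p) (f q) g HI Hc (H p Hp Hpq)) as [Du Dv]. fold u in Du; fold v in Dv.
  assert (g <= 1) by apply Rmin_l.
  assert (Su := sq_sub_le u _ g ltac:(lra) H0 Du). assert (Sv := sq_sub_le v _ g ltac:(lra) H0 Dv).
  set (u' := qdot (f p) c) in *. set (v' := qdot (f p) (qmul I c)) in *.
  replace (u' ^ 2 + v' ^ 2 - (u ^ 2 + v ^ 2)) with ((u' ^ 2 - u ^ 2) + (v' ^ 2 - v ^ 2)) by ring.
  eapply Rle_lt_trans; [apply Rabs_triang|].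
  assert (g * L <= e / 2).
  { apply Rle_trans with (e / (2 * L) * L); [|right; field; lra].
    apply Rmult_le_compat_r; [lra|apply Rmin_r]. }
  assert (g * L = g * (2 * Rabs u + 1) + g * (2 * Rabs v + 1)) by (unfold L; ring).
  lra.
Qed.

Lemma le_of_le_mult_exp (x y : R) : 0 <= y -> (forall e, 0 < e -> x <= y * exp e) -> x <= y.
Proof.
  intros Hy H. apply Rnot_lt_le; intros L.
  destruct (Rle_lt_or_eq_dec 0 y Hy) as [P|E].
  - assert (Hq : 1 < x / y).
    { apply (Rmult_lt_reg_r y); [assumption|]. replace (x / y * y) with x by (field; lra). lra. }
    assert (HL : 0 < ln (x / y)) by (rewrite <- ln_1; apply ln_increasing; lra).
    assert (B := H (ln (x / y) / 2) ltac:(lra)).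
    assert (E : x = y * exp (ln (x / y))) by (rewrite exp_ln by lra; field; lra).
    assert (exp (ln (x / y) / 2) < exp (ln (x / y))) by (apply exp_increasing; lra).
    assert (y * exp (ln (x / y) / 2) < y * exp (ln (x / y))) by (apply Rmult_lt_compat_l; lra).
    lra.
  - specialize (H 1 ltac:(lra)). rewrite <- E in H, L. lra.
Qed.

(** * Logarithmic polar coordinates on a slice *)

Lemma cont2_px (z : R) : cont2 (px z).
Proof.
  intros s t. apply continuity_2d_pt_mult.
  - apply (continuity_2d_pt_comp1 exp); [|apply continuity_2d_pt_id1].
    intros; apply derivable_continuous_pt, derivable_pt_exp.
  - apply (continuity_2d_pt_comp1 cos); [apply continuity_cos|].
    apply continuity_2d_pt_plus; [apply continuity_2d_pt_const|apply continuity_2d_pt_id2].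
Qed.

Lemma cont2_py (z : R) : cont2 (py z).
Proof.
  intros s t. apply continuity_2d_pt_mult.
  - apply (continuity_2d_pt_comp1 exp); [|apply continuity_2d_pt_id1].
    intros; apply derivable_continuous_pt, derivable_pt_exp.
  - apply (continuity_2d_pt_comp1 sin); [apply continuity_sin|].
    apply continuity_2d_pt_plus; [apply continuity_2d_pt_const|apply continuity_2d_pt_id2].
Qed.

Definition polar_pt (I : quat) (z s t : R) : quat := slice_pt I (px z s t) (py z s t).

Lemma polar_pt_cont (I : quat) (z s t e : R) : in_S I -> 0 < e ->
  exists r, 0 < r /\ forall s' t', near r s t s' t' ->
    qnorm (qsub (polar_pt I z s' t') (polar_pt I z s t)) < e.
Proof.
  intros HI He.
  destruct (cont2_usc (px z) s t (cont2_px z) (e / 2)) as [r1 [Hr1 H1]]; [lra|].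
  destruct (cont2_usc (py z) s t (cont2_py z) (e / 2)) as [r2 [Hr2 H2]]; [lra|].
  exists (Rmin r1 r2); split; [apply Rmin_glb_lt; assumption|].
  intros s' t' [Ns Nt]. generalize (Rmin_l r1 r2) (Rmin_r r1 r2); intros.
  apply slice_dist_lt; [assumption|apply H1|apply H2]; split; lra.
Qed.

Lemma polar_pt_norm (I : quat) (z s t : R) : in_S I -> qnorm (polar_pt I z s t) = exp s.
Proof.
  intros HI. unfold polar_pt. rewrite slice_norm, polar_sq by assumption.
  apply sqrt_pow2, Rlt_le, exp_pos.
Qed.

Lemma polar_pt_dist0 (I : quat) (z s t : R) : in_S I -> qnorm (qsub (polar_pt I z s t) qzero) = exp s.
Proof.
  intros HI. unfold polar_pt. rewrite <- (slice_zero I), slice_dist by assumption.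
  rewrite !Rminus_0_r, polar_sq. apply sqrt_pow2, Rlt_le, exp_pos.
Qed.

(** Equal points have equal radii, so [cos (t - t') = 1], and less than a full turn separates the
    angles. *)
Lemma polar_inj (z s t r t' : R) : 0 < r -> r * cos (z + t') = px z s t ->
  r * sin (z + t') = py z s t -> Rabs (t - t') < 2 * PI -> t = t'.
Proof.
  intros Hr Hx Hy Ht. unfold px, py in *.
  assert (C1 := cos_sin_sq (z + t')). assert (C2 := cos_sin_sq (z + t)).
  assert (Es := exp_pos s).
  assert (E : r ^ 2 = exp s ^ 2).
  { transitivity ((r * cos (z + t')) ^ 2 + (r * sin (z + t')) ^ 2).
    - transitivity (r ^ 2 * (cos (z + t') ^ 2 + sin (z + t') ^ 2)); [rewrite C1; ring|ring].
    - rewrite Hx, Hy. transitivity (exp s ^ 2 * (cos (z + t) ^ 2 + sin (z + t) ^ 2)); [ring|].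
      rewrite C2; ring. }
  assert (Er : r = exp s) by nra. rewrite Er in Hx, Hy.
  apply Rmult_eq_reg_l in Hx; [|lra]. apply Rmult_eq_reg_l in Hy; [|lra].
  assert (D : cos (t - t') = 1).
  { replace (t - t') with (z + t - (z + t')) by ring. rewrite cos_minus, Hx, Hy.
    rewrite <- C2. ring. }
  apply Rminus_diag_uniq. set (d := t - t') in *.
  replace d with (2 * (d / 2)) in D by field. rewrite cos_2a_sin in D.
  assert (S0 : sin (d / 2) = 0) by nra.
  apply Rabs_def2 in Ht.
  destruct (Rtotal_order d 0) as [L|[L|L]]; [|assumption|].
  - assert (0 < sin (- (d / 2))) by (apply sin_gt_0; lra). rewrite sin_neg in H. lra.
  - assert (0 < sin (d / 2)) by (apply sin_gt_0; lra). lra.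
Qed.

Lemma le_exp_lnp (m : R) : m <= exp (lnp m).
Proof.
  destruct (Rle_dec m 0) as [H|H]; [generalize (exp_pos (lnp m)); lra|].
  rewrite <- (exp_ln m) at 1 by lra. apply exp_le, Rmax_l.
Qed.

Lemma type_nonneg (Mf : R -> R) (rho sigma : R) : has_type Mf rho sigma -> 0 <= sigma.
Proof.
  intros H. apply Rnot_lt_le; intros L. destruct (H (- sigma) ltac:(lra)) as [[R0 HR] _].
  specialize (HR (R0 + 1) ltac:(lra)).
  assert (0 <= lnp (Mf (R0 + 1)) / Rpower (R0 + 1) rho).
  { apply Rmult_le_pos; [apply Rmax_r|]. apply Rlt_le, Rinv_0_lt_compat, exp_pos. }
  lra.
Qed.

(** Under [r = exp s] the power [Rpower r rho] becomes [exp (rho * s)]. *)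
Lemma type_growth (Mf : R -> R) (rho sigma a : R) : has_type Mf rho sigma -> sigma < a ->
  exists S, forall s, S <= s -> Mf (exp s) <= exp (a * exp (rho * s)).
Proof.
  intros H Ha. destruct (H (a - sigma) ltac:(lra)) as [[R0 HR] _].
  destruct (exp_ge_eventually 1 (R0 + 1)) as [S HS]; [lra|].
  exists S; intros s Hs. specialize (HS s Hs). rewrite Rmult_1_l in HS.
  specialize (HR (exp s) ltac:(lra)).
  eapply Rle_trans; [apply le_exp_lnp|]. apply exp_le.
  unfold Rpower in HR. rewrite ln_exp in HR.
  assert (P := exp_pos (rho * s)).
  apply (Rmult_lt_compat_r (exp (rho * s))) in HR; [|assumption].
  replace (lnp (Mf (exp s)) / exp (rho * s) * exp (rho * s)) with (lnp (Mf (exp s))) in HR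
      by (field; lra).
  lra.
Qed.

(** The vertex 0 and the two sides of the sector lie in the closure of [Omega] but not in [Omega],
    so the bound on the boundary of [Omega] applies to them. The vertex also yields [0 <= M]. *)
Lemma angular_slice_bound (Omega : qset) (zeta phi : quat -> R) (f : quat -> quat)
  (Mf : R -> R) (rho sigma M A : R) (I c : quat) :
  angular_domain Omega zeta phi -> 0 < rho -> slice_regular Omega f -> cont_on_closure Omega f ->
  (forall r, 0 < r -> is_max_modulus Omega f r (Mf r)) -> has_type Mf rho sigma ->
  opening_le phi (PI / rho) -> (forall q, q_boundary Omega q -> qnorm (f q) <= M) ->
  in_S I -> qdot c c = 1 -> sigma < A ->
  0 <= M /\ forall s t, Rabs t <= phi I / 2 ->
    dot_mod2 I c f (polar_pt I (zeta I) s t) <= M ^ 2 * exp (2 * (A * exp (rho * s) * cos (rho * t))).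
Proof.
  intros [_ Hang] Hrho Hreg Hcont Hmax Htype Hopen Hbdry HI Hc HA.
  destruct (Hang I HI) as [Hphi Hsec]. specialize (Hopen I HI).
  set (al := phi I / 2) in *. set (z := zeta I) in *.
  assert (Hal : 0 < al) by (unfold al; lra).
  assert (Halpi : al < PI) by (unfold al; lra).
  assert (Hin : forall s t, Rabs t < al -> Omega (polar_pt I z s t)).
  { intros s t Ht. apply Hsec. exists (exp s), t.
    split; [apply exp_pos|split; [assumption|]]. rewrite slice_polar. reflexivity. }
  assert (Hcl : forall s t, Rabs t <= al -> q_closure Omega (polar_pt I z s t)).
  { intros s t Ht e He. destruct (polar_pt_cont I z s t e HI He) as [r [Hr H]].
    set (d := Rmin (1 / 2) (r / (2 * al))).
    assert (Hd : 0 < d) by (apply Rmin_glb_lt; [lra|apply Rdiv_lt_0_compat; lra]).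
    assert (Hd1 : d <= 1 / 2) by apply Rmin_l.
    assert (Hd2 : d * al <= r / 2).
    { apply Rle_trans with (r / (2 * al) * al); [|right; field; lra].
      apply Rmult_le_compat_r; [lra|apply Rmin_r]. }
    exists (polar_pt I z s (t * (1 - d))). split.
    - apply Hin. rewrite Rabs_mult, (Rabs_right (1 - d)) by lra.
      assert (0 < al * d) by (apply Rmult_lt_0_compat; assumption).
      assert (Rabs t * (1 - d) <= al * (1 - d)) by (apply Rmult_le_compat_r; lra). lra.
    - apply H. split; [rewrite Rminus_diag, Rabs_R0; assumption|].
      replace (t * (1 - d) - t) with (- (t * d)) by ring.
      rewrite Rabs_Ropp, Rabs_mult, (Rabs_right d) by lra.
      assert (Rabs t * d <= al * d) by (apply Rmult_le_compat_r; lra). lra. }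
  assert (Hout : forall s t, Rabs t = al -> ~ Omega (polar_pt I z s t)).
  { intros s t Ht HO. destruct (Hsec (polar_pt I z s t)) as [Hs _].
    destruct Hs as (r & t' & Hr & Ht' & E).
    { split; [assumption|]. exists (px z s t), (py z s t); reflexivity. }
    rewrite slice_polar in E. apply slice_inj in E; [|assumption]. destruct E as [E1 E2].
    (* Here [Rabs t = al] and [Rabs t' < al], so the angles differ by less than
       [2 * al < 2 * PI]. *)
    assert (t = t').
    { apply (polar_inj z s t r t'); auto.
      unfold Rminus; eapply Rle_lt_trans; [apply Rabs_triang|]. rewrite Rabs_Ropp. lra. }
    subst t'. lra. }
  assert (H0cl : q_closure Omega qzero).
  { intros e He. exists (polar_pt I z (ln (e / 2)) 0). split.
    - apply Hin. rewrite Rabs_R0; assumption.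
    - rewrite polar_pt_dist0, exp_ln by (assumption || lra). lra. }
  assert (H0out : ~ Omega qzero).
  { intros HO. destruct (Hsec qzero) as [Hs _]. destruct Hs as (r & t' & Hr & _ & E).
    { split; [assumption|]. exists 0, 0. symmetry; apply slice_zero. }
    rewrite slice_polar, <- (slice_zero I) in E. apply slice_inj in E; [|assumption].
    destruct E as [E1 E2]. assert (C := cos_sin_sq (z + t')).
    assert (r ^ 2 * (cos (z + t') ^ 2 + sin (z + t') ^ 2) = 0).
    { transitivity ((r * cos (z + t')) ^ 2 + (r * sin (z + t')) ^ 2); [ring|].
      rewrite <- E1, <- E2; ring. }
    rewrite C in H. nra. }
  assert (HM0 : qnorm (f qzero) <= M) by (apply Hbdry; split; assumption).
  assert (HM : 0 <= M) by (generalize (qnorm_pos (f qzero)); lra).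
  split; [assumption|].
  assert (Sq : forall q m, qnorm (f q) <= m -> dot_mod2 I c f q <= m ^ 2).
  { intros q m Hq. eapply Rle_trans; [apply qdot_bessel; assumption|].
    apply pow_incr; split; [apply qnorm_pos|assumption]. }
  set (u := fun x y => qdot (f (slice_pt I x y)) c).
  set (v := fun x y => qdot (f (slice_pt I x y)) (qmul I c)).
  assert (Hrel : forall s t, Rabs t <= al -> forall e, 0 < e -> exists r, 0 < r /\
    forall s' t', Rabs t' <= al -> near r s t s' t' ->
      Rabs (polar_mod2 u v z s' t' - polar_mod2 u v z s t) < e).
  { intros s t Ht e He.
    destruct (dot_mod2_cont Omega f I c (polar_pt I z s t) e) as [d [Hd H]]; auto.
    destruct (polar_pt_cont I z s t d HI Hd) as [r [Hr H']].
    exists r; split; [assumption|]. intros s' t' Ht' N.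
    apply (H (polar_pt I z s' t')); auto. }
  (* The midpoint of [sigma] and [A] lies strictly above the type, as the growth bound needs, and
     strictly below the rate of the multiplier. *)
  apply (phragmen_lindelof_strip (polar_mod2 u v z) al rho ((sigma + A) / 2) A (M ^ 2)); try assumption.
  - intros B1 B2 k l tau s1 s2 t1 t2 K Ht1 Ht2 Hb.
    apply (strip_max u v z al); try assumption.
    intros s t Ht. assert (HO := Hin s t Ht). destruct Hreg as [Hop Hreg'].
    destruct (Hop _ HO) as [e0 [He0 Hball]].
    assert (Cont : forall e, 0 < e -> exists d, 0 < d /\ forall x y,
      Rabs (x - px z s t) < d -> Rabs (y - py z s t) < d ->
      qnorm (qsub (f (slice_pt I x y)) (f (polar_pt I z s t))) < e).
    { intros e He. destruct (Hcont _ (closure_of_mem _ _ HO) e He) as [d [Hd H]].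
      exists (Rmin e0 d / 2). split; [assert (0 < Rmin e0 d) by (apply Rmin_glb_lt; assumption); lra|].
      intros x y Hx Hy.
      assert (D : qnorm (qsub (slice_pt I x y) (polar_pt I z s t)) < Rmin e0 d)
        by (apply slice_dist_lt; assumption).
      generalize (Rmin_l e0 d) (Rmin_r e0 d); intros.
      apply H; [|lra]. apply closure_of_mem, Hball. lra. }
    split; [|split].
    + intros e. destruct (Cont e (cond_pos e)) as [d [Hd H]].
      exists (mkposreal d Hd). intros x y Hx Hy. apply (dot_lt I c _ _ e HI Hc (H x y Hx Hy)).
    + intros e. destruct (Cont e (cond_pos e)) as [d [Hd H]].
      exists (mkposreal d Hd). intros x y Hx Hy. apply (dot_lt I c _ _ e HI Hc (H x y Hx Hy)).
    + apply (slice_cauchy_riemann Omega); try assumption. split; assumption.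
  - intros s t. apply Rplus_le_le_0_compat; apply pow2_ge_0.
  - unfold al. apply (Rmult_le_compat_l rho) in Hopen; [|lra].
    replace (rho * (PI / rho)) with PI in Hopen by (field; lra). lra.
  - apply pow2_ge_0.
  - generalize (type_nonneg Mf rho sigma Htype); lra.
  - lra.
  - intros s. apply (Sq (polar_pt I z s al)), Hbdry. split.
    + apply Hcl. rewrite Rabs_right; lra.
    + apply Hout. rewrite Rabs_right; lra.
  - intros s. apply (Sq (polar_pt I z s (- al))), Hbdry. split.
    + apply Hcl. rewrite Rabs_Ropp, Rabs_right; lra.
    + apply Hout. rewrite Rabs_Ropp, Rabs_right; lra.
  - intros e He. destruct (dot_mod2_cont Omega f I c qzero e) as [d [Hd H]]; try assumption.
    exists (ln (d / 2)). intros s t Hs Ht.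
    assert (D : Rabs (dot_mod2 I c f (polar_pt I z s t) - dot_mod2 I c f qzero) < e).
    { apply H; [apply Hcl, Ht|]. rewrite polar_pt_dist0 by assumption.
      apply exp_le in Hs. rewrite exp_ln in Hs by lra. lra. }
    apply Rabs_def2 in D. assert (S0 := Sq qzero M HM0).
    change (polar_mod2 u v z s t) with (dot_mod2 I c f (polar_pt I z s t)). lra.
  - intros s1 s2. destruct (Rle_dec s1 s2) as [Hs|Hs].
    2:{ exists 0; intros; exfalso; lra. }
    assert (InT : forall s t, in_rect s1 s2 (- al) al s t -> Rabs t <= al)
      by (intros s t [? ?]; apply Rabs_le; lra).
    destruct (rect_max (in_rect s1 s2 (- al) al) (polar_mod2 u v z) s1 s2 (- al) al)
      as [s0 [t0 [_ Hm]]].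
    + exists s1, 0; split; lra.
    + auto.
    + intros; contradiction.
    + intros s t Hst e He. destruct (Hrel s t (InT s t Hst) e He) as [r [Hr H]].
      exists r; split; [assumption|]. intros s' t' Hst' N.
      specialize (H s' t' (InT s' t' Hst') N). apply Rabs_def2 in H; lra.
    + exists (polar_mod2 u v z s0 t0). intros s t Hs' Ht. apply Hm. split; [assumption|].
      apply Rabs_le_between, Ht.
  - destruct (type_growth Mf rho sigma ((sigma + A) / 2) Htype ltac:(lra)) as [S HS].
    exists S. intros s t Hs Ht.
    destruct (Hmax (exp s) (exp_pos s)) as [_ Hle].
    assert (Q : qnorm (f (polar_pt I z s t)) <= exp ((sigma + A) / 2 * exp (rho * s))).
    { eapply Rle_trans; [apply Hle|apply HS, Hs]; [apply Hcl, Ht|apply polar_pt_norm, HI]. }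
    apply Sq in Q. eapply Rle_trans; [exact Q|].
    replace (2 * ((sigma + A) / 2 * exp (rho * s))) with
      ((sigma + A) / 2 * exp (rho * s) + (sigma + A) / 2 * exp (rho * s)) by ring.
    rewrite exp_plus. right; ring.
Qed.

Theorem theorem4p6 (Omega : qset) (zeta phi : quat -> R) (f : quat -> quat)
  (Mf : R -> R) (rho sigma M : R) :
  angular_domain Omega zeta phi ->
  0 < rho ->
  slice_regular Omega f ->
  cont_on_closure Omega f ->
  (forall r, 0 < r -> is_max_modulus Omega f r (Mf r)) ->
  has_order Mf rho ->
  has_type Mf rho sigma ->
  opening_le phi (PI / rho) ->
  (forall q, q_boundary Omega q -> qnorm (f q) <= M) ->
  forall I, in_S I -> forall r t, 0 < r -> Rabs t < phi I / 2 ->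
    qnorm (f (qscale r (qexpI I (zeta I + t)))) <=
      M * exp (sigma * Rpower r rho * cos (rho * t)).
Proof.
  intros Hang Hrho Hreg Hcont Hmax _ Htype Hopen Hbdry I HI r t Hr Ht.
  assert (Bound := fun c A => angular_slice_bound Omega zeta phi f Mf rho sigma M A I c
    Hang Hrho Hreg Hcont Hmax Htype Hopen Hbdry HI).
  set (q0 := qscale r (qexpI I (zeta I + t))).
  assert (Eq0 : polar_pt I (zeta I) (ln r) t = q0).
  { unfold q0, polar_pt, px, py. rewrite slice_polar, exp_ln by assumption. reflexivity. }
  set (D := Rpower r rho * cos (rho * t)).
  set (n := qnorm (f q0)).
  assert (Hn : 0 <= n) by apply qnorm_pos.
  assert (HM : 0 <= M).
  (* Any unit quaternion and any rate above [sigma] would do. *)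
  { destruct (Bound (qreal 1) (sigma + 1)) as [HM _]; [unfold qdot; cbn; ring|lra|exact HM]. }
  assert (Pos : 0 <= M * exp (sigma * D)) by (apply Rmult_le_pos; [assumption|apply Rlt_le, exp_pos]).
  replace (sigma * Rpower r rho * cos (rho * t)) with (sigma * D) by (unfold D; ring).
  destruct (Rle_lt_or_eq_dec 0 n Hn) as [Hn'|Hn0]; [|rewrite <- Hn0; exact Pos].
  (* The direction of [f q0]: then [<f q0, c> = n], and the projection loses nothing at [q0]. *)
  set (c := qscale (/ n) (f q0)).
  assert (Nsq : qdot (f q0) (f q0) = n ^ 2) by (symmetry; apply qnorm_sq).
  assert (Hc : qdot c c = 1).
  { transitivity ((/ n) ^ 2 * qdot (f q0) (f q0)); [unfold c, qdot; cbn; ring|].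
    rewrite Nsq. field; lra. }
  assert (Hval : n ^ 2 <= dot_mod2 I c f q0).
  { unfold dot_mod2. assert (Hu : qdot (f q0) c = n).
    { transitivity (/ n * qdot (f q0) (f q0)); [unfold c, qdot; cbn; ring|]. rewrite Nsq. field; lra. }
    rewrite Hu. generalize (pow2_ge_0 (qdot (f q0) (qmul I c))); lra. }
  assert (Sq : n ^ 2 <= (M * exp (sigma * D)) ^ 2).
  { apply le_of_le_mult_exp; [apply pow2_ge_0|]. intros e He.
    (* Chosen so that [2 * h * D <= e]; the summand 1 covers [D = 0]. *)
    set (h := e / (2 * (Rabs D + 1))). assert (HD := Rabs_pos D).
    assert (Hh : 0 < h) by (apply Rdiv_lt_0_compat; lra).
    destruct (Bound c (sigma + h) Hc ltac:(lra)) as [_ B].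
    specialize (B (ln r) t ltac:(lra)). rewrite Eq0 in B.
    eapply Rle_trans; [exact Hval|]. eapply Rle_trans; [exact B|].
    change (exp (rho * ln r)) with (Rpower r rho).
    replace (2 * ((sigma + h) * Rpower r rho * cos (rho * t))) with
      (sigma * D + sigma * D + 2 * h * D) by (unfold D; ring).
    rewrite !exp_plus.
    replace ((M * exp (sigma * D)) ^ 2 * exp e) with
      (M ^ 2 * (exp (sigma * D) * exp (sigma * D) * exp e)) by ring.
    apply Rmult_le_compat_l; [apply pow2_ge_0|].
    apply Rmult_le_compat_l; [apply Rmult_le_pos; apply Rlt_le, exp_pos|].
    apply exp_le. assert (2 * h * D <= 2 * h * (Rabs D + 1)).
    { apply Rmult_le_compat_l; [lra|]. generalize (Rle_abs D); lra. }
    assert (2 * h * (Rabs D + 1) = e) by (unfold h; field; lra). lra. }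
  apply Rnot_lt_le; intros L.
  assert ((M * exp (sigma * D)) ^ 2 < n ^ 2); [|lra].
  cbn [pow]. rewrite !Rmult_1_r. apply Rmult_le_0_lt_compat; lra.
Qed.
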